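(* Given a multi-weighted graph $\mathcal{G}=(V,E,A,(w_a)_{a\in A},(p_a)_{a\in A})$ over a finite index set $A$, a starting vertex $\iota\in V$, and a vector of payoffs $f\in\Omega^{A}$, one can decide in nondeterministic polynomial time whether there exists an ultimately periodic path $\pi=v_0v_1\cdots$ in $\mathcal{G}$ with $v_0=\iota$ such that $f_a\prec_{lex}\mathrm{pay}_a(\pi)$ for every $a\in A$.
   Context: A multi-weighted graph consists of a finite set $V$ of vertices, a set $E\subseteq V^2$ of edges, a finite index set $A$, and functions $w_a,p_a:V\to\mathbb{Z}$ for each $a\in A$ (weights and priorities). A path is an infinite sequence $v_0v_1\cdots$ with $(v_i,v_{i+1})\in E$ for all $i$; it is ultimately periodic if it has the form $u\cdot v^\omega$ for finite sequences $u,v$. For a path $\pi$ and $a\in A$: ${\sf parity}_a(\pi)=\top$ if the largest integer occurring infinitely often in $p_a(v_0)p_a(v_1)\cdots$ is even, and $\bot$ otherwise; ${\sf mp}_a(\pi)=\liminf_{n\to\infty}\frac1n\sum_{j=0}^{n-1}w_a(v_j)$; $\mathrm{pay}_a(\pi)=({\sf parity}_a(\pi),{\sf mp}_a(\pi))\in\Omega=\{\bot,\top\}\times\mathbb{R}$. The order $\prec_{lex}$ on $\Omega$ is: $(x,y)\prec_{lex}(x',y')$ iff either ($x=\bot$ and $x'=\top$) or ($x=x'$ and $y<y'$).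
   Formalization: The real components of the payoff vector f are taken to be rational, given as fractions in binary, since arbitrary real numbers have no finite encoding as input to a nondeterministic polynomial-time procedure. *)

(* Defs.v *)
From HB Require Import structures.
From mathcomp Require Import all_boot all_order all_algebra.
From mathcomp Require Import all_classical all_reals all_analysis.

Set Implicit Arguments.
Unset Strict Implicit.
Unset Printing Implicit Defensive.

Import Order.TTheory GRing.Theory Num.Theory.

Local Open Scope ring_scope.

Inductive move := MoveLeft | Stay | MoveRight.

(* [None] is the blank, [inl s] an input letter, [inr g] a letter of the
   work alphabet [G]. *)
Definition cell (S G : finType) := option (S + G).

(* The machine has [ntapes.+1] tapes; tape [ord0] initially holds the input.
   [trans q r q' a] means: in state [q], reading [r i] on tape [i], the machine
   may go to state [q'], write [(a i).1] on tape [i] and move its head by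
   [(a i).2]. *)
Record ntm (S : finType) := NTM {
  ntapes : nat;
  state : finType;
  work : finType;
  init : state;
  accepting : {set state};
  trans : state -> {ffun 'I_ntapes.+1 -> cell S work} ->
          state -> {ffun 'I_ntapes.+1 -> cell S work * move} -> bool
}.

(* A two-way infinite tape [(l, r)]: [r] lists the cells from the scanned one
   rightwards, [l] the cells to its left, nearest first; all cells beyond the
   two lists are blank. *)
Definition tape (C : Type) := (seq (option C) * seq (option C))%type.

Definition tape_read C (t : tape C) : option C := head None t.2.

Definition tape_act C (t : tape C) (a : option C * move) : tape C :=
  let: (l, r) := (t.1, a.1 :: behead t.2) in
  match a.2 with
  | MoveLeft => (behead l, head None l :: r)
  | Stay => (l, r)
  | MoveRight => (a.1 :: l, behead r)
  end.

Section Runs.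
Variables (S : finType) (M : ntm S).

Definition config := (state M * ('I_(ntapes M).+1 -> tape (S + work M)))%type.

Definition initial (x : seq S) : config :=
  (init M, fun i => ([::], if i == ord0 then [seq Some (inl s) | s <- x]
                           else [::])).

Definition step (c c' : config) : Prop :=
  exists a, trans c.1 [ffun i => tape_read (c.2 i)] c'.1 a /\
            c'.2 = fun i => tape_act (c.2 i) (a i).

Fixpoint steps (t : nat) (c c' : config) : Prop :=
  if t is t'.+1 then exists2 d, step c d & steps t' d c' else c = c'.

Definition halted (c : config) : Prop := forall c', ~ step c c'.

Definition all_runs_within (x : seq S) (T : nat) : Prop :=
  forall t c, steps t (initial x) c -> (t <= T)%N.

Definition accepts (x : seq S) : Prop :=
  exists t c, [/\ steps t (initial x) c, halted c & c.1 \in accepting M].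

End Runs.

Definition in_NP (S : finType) (L : seq S -> Prop) : Prop :=
  exists (M : ntm S) (p : {poly nat}), forall x : seq S,
    all_runs_within M x p.[size x] /\ (L x <-> accepts M x).

Record mwgraph (V A : finType) := MWGraph {
  edges : {set V * V};
  weight : A -> V -> int;
  prio : A -> V -> int
}.

Definition is_path (V A : finType) (G : mwgraph V A) (pi : nat -> V) : Prop :=
  forall i, (pi i, pi i.+1) \in edges G.

(* [pi = u . v^omega]; the default [x0] of [nth] is never reached since [v] is
   nonempty. *)
Definition ultimately_periodic (V : Type) (pi : nat -> V) : Prop :=
  exists (x0 : V) (u v : seq V), (0 < size v)%N /\
    forall i, pi i = if (i < size u)%N then nth x0 u i
                     else nth x0 v ((i - size u) %% size v).

Definition infinitely_often (s : nat -> int) (k : int) : Prop :=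
  forall N, exists n, (N <= n)%N /\ s n = k.

(* [true] stands for top and [false] for bottom. *)
Definition omega (R : realType) := (bool * R)%type.

Definition lex_lt (R : realType) (x y : omega R) : bool :=
  (~~ x.1 && y.1) || ((x.1 == y.1) && (x.2 < y.2)).

Section Payoff.
Variables (R : realType) (V A : finType) (G : mwgraph V A).
Variables (a : A) (pi : nat -> V).

Definition parity : bool :=
  `[< exists k, [/\ infinitely_often (prio G a \o pi) k,
        forall k', infinitely_often (prio G a \o pi) k' -> k' <= k
      & (2 %| k)%Z] >].

(* The averages are bounded because [V] is finite, so that the real-valued
   [limn_inf] is the genuine limit inferior. *)
Definition mean_payoff : R :=
  limn_inf (fun n : nat =>
    n%:R^-1 * \sum_(0 <= j < n) (weight G a (pi j))%:~R : R).

Definition pay : omega R := (parity, mean_payoff).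

End Payoff.

(* Binary encoding of instances over the alphabet {0, 1, #} = [option bool],
   where # = [None] terminates every word. *)

(* Least significant bit first, without superfluous leading zeros. *)
Definition nat_bits (n : nat) : seq bool :=
  [seq odd (n %/ 2 ^ i) | i <- iota 0 (trunc_log 2 n).+1].

Definition int_bits (z : int) : seq bool := (z < 0) :: nat_bits `|z|%N.

Definition word (s : seq bool) : seq (option bool) := rcons (map Some s) None.

(* The rows of the adjacency matrix, the characteristic vector of the starting
   vertex and then, for each index [a], the weights and priorities of all
   vertices, the parity component [b a] of the threshold, and the numerator
   and denominator of its rational component [q a].  The first word has length
   [#|V|], so the code can be parsed unambiguously. *)
Definition encode (V A : finType) (G : mwgraph V A) (iota : V)
    (b : A -> bool) (q : A -> int * nat) : seq (option bool) :=
  flatten [seq word [seq (u, v) \in edges G | v <- enum V] | u <- enum V]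
  ++ word [seq v == iota | v <- enum V]
  ++ flatten [seq flatten [seq word (int_bits (weight G a v))
                               ++ word (int_bits (prio G a v)) | v <- enum V]
                  ++ word [:: b a]
                  ++ word (int_bits (q a).1) ++ word (nat_bits (q a).2)
             | a <- enum A].

(* Main.v *)
Require Import Defs.
From HB Require Import structures.
From mathcomp Require Import all_boot all_order all_algebra.
From mathcomp Require Import all_classical all_reals all_analysis.
From mathcomp Require Import all_fingroup.
From mathcomp Require Import zify ring lra.

(* A path [u . v^omega] meets the thresholds iff its cycle does, and for the
   cycle only the numbers y(u, v) of traversals of the edges matter: the visited
   vertices decide parity, and mean payoff compares two linear forms in y.
   Conversely, every circulation y on the edges with connected support
   reachable from the start is realised by a closed walk (Euler).  Fixing the
   support and the set of mean-payoff constraints used, circulations are the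
   solutions of an integral linear system, which has a solution in nonnegative
   integers of polynomial bit size as soon as it has one at all (a basic
   solution, bounded by Cramer's rule).  So y is a polynomial certificate.

   To check it on a Turing machine, one implements existential second-order
   logic once and for all: over a domain of size N(x), polynomial in |x|, a
   machine guesses the tables of the relation variables and evaluates a
   first-order formula, the values of first-order variables being head
   positions.  Parsing, binary arithmetic and reachability are then described
   by recursive, hence uniquely determined, auxiliary relations; uniqueness
   allows these to be negated freely. *)

Set Implicit Arguments.
Unset Strict Implicit.
Unset Printing Implicit Defensive.

Import Order.TTheory GRing.Theory Num.Theory.

Local Open Scope ring_scope.

(** * Nondeterministic programs on two-way infinite tapes *)

(** No condition on [y] depends on its scale: parity and connectivity see only the support, while
    balance and the strict mean-payoff inequalities are homogeneous. A rational solution is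
    therefore as good as an integral one, and the determinant of Cramer's rule can be multiplied
    away. Equations in nonnegative unknowns cannot enforce [0 < y], however; the system is written
    for [y - 1] on the chosen support, so that after clearing the denominator [D] every edge of it
    carries at least [D]. On the machine side, elements of the domain double as bit positions: a
    number is a unary relation, and arithmetic is that modulo [2 ^ N]. Entries of the certificate
    have quadratically many bits and keep to the lower half of the positions, so that no sum or
    product of the check wraps around; this dictates a domain polynomially larger than the input.
    Membership in NP bounds all runs, including the rejecting ones, so a program specification has
    to control every run instead of exhibiting an accepting one. *)

Section Fragments.
Variables (S T' : finType).
Notation T := (option T').
Notation cel := (cell S bool).

(* Tapes are functions on [int]: a store gives the head positions and the
   contents. *)
Record store := Store { hd : T -> int; ct : T -> int -> cel }.

Definition reads (s : store) : {ffun T -> cel} := [ffun t => ct s t (hd s t)].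

Definition offset (m : move) : int :=
  match m with MoveLeft => -1 | Stay => 0 | MoveRight => 1 end.

Definition act (s : store) (a : {ffun T -> cel * move}) : store :=
  Store (fun t => hd s t + offset (a t).2)
        (fun t p => if p == hd s t then (a t).1 else ct s t p).

(* The exit of a fragment is [None]. *)
Record frag := Frag {
  fstate : finType;
  entry : option fstate;
  fdelta : fstate -> {ffun T -> cel} -> option fstate ->
           {ffun T -> cel * move} -> Prop }.

Definition fconfig A := (option (fstate A) * store)%type.

Definition fstep A (c c' : fconfig A) : Prop :=
  exists q a, [/\ c.1 = Some q, fdelta q (reads c.2) c'.1 a & c'.2 = act c.2 a].

(* All runs reach a configuration in [O] within the given number of steps. *)
Inductive inevitable A (O : fconfig A -> Prop) : nat -> fconfig A -> Prop :=
| inevitable_now t c : O c -> inevitable O t c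
| inevitable_later t q s :
    (forall c', fstep (Some q, s) c' -> inevitable O t c') ->
    inevitable O t.+1 (Some q, s).

Inductive reach A : fconfig A -> fconfig A -> Prop :=
| reach_refl c : reach c c
| reach_step c d e : fstep c d -> reach d e -> reach c e.

Lemma reach_trans A (c d e : fconfig A) : reach c d -> reach d e -> reach c e.
Proof. by elim=> // {}c {}d f cd _ IH /IH; apply: reach_step. Qed.

Lemma inevitable_addl A (O : fconfig A -> Prop) t t' c :
  inevitable O t' c -> inevitable O (t + t') c.
Proof.
elim=> [{}t' {}c Oc|{}t' q s _ IH]; first exact: inevitable_now.
by rewrite addnS; apply: inevitable_later.
Qed.

Lemma inevitable_bind A (O O' : fconfig A -> Prop) t t' c :
  inevitable O t c -> (forall d, O d -> inevitable O' t' d) ->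
  inevitable O' (t + t') c.
Proof.
move=> + h; elim=> [{}t {}c /h|{}t q s _ IH]; first exact: inevitable_addl.
by rewrite addSn; apply: inevitable_later.
Qed.

Lemma inevitable_impl A (O O' : fconfig A -> Prop) t t' c :
  (t <= t')%N -> (forall d, O d -> O' d) -> inevitable O t c ->
  inevitable O' t' c.
Proof.
move=> le_t h /(inevitable_bind (t' := t' - t)); rewrite subnKC //.
by apply=> d /h; apply: inevitable_now.
Qed.

Definition exits A (O : store -> Prop) (c : fconfig A) := c.1 = None /\ O c.2.

(** The two halves make [O] the exact set of results. A run that gets stuck before the exit
    satisfies [inevitable] vacuously, so [O] may be empty; this is how rejection is expressed. *)
Definition spec A (s : store) t (O : store -> Prop) :=
  inevitable (@exits A O) t (entry A, s) /\
  forall s', O s' -> reach (entry A, s) (None, s').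

(** The image of [A] has exactly the transitions of [A], so bounds on all runs and reachability both
    carry over. The value [f None] is left free: the exit of [A] may become any state of [B], which
    is what gluing requires. *)
Definition embeds A B (f : option (fstate A) -> option (fstate B)) :=
  forall a, exists2 b, f (Some a) = Some b & forall r o x,
    fdelta b r o x <-> exists2 o', fdelta a r o' x & o = f o'.

Lemma embeds_inevitable A B f (O : fconfig A -> Prop) (O' : fconfig B -> Prop) t c :
  embeds f -> (forall q s, O (q, s) -> O' (f q, s)) ->
  inevitable O t c -> inevitable O' t (f c.1, c.2).
Proof.
move=> emb h; elim=> [{}t [q s] /h|{}t q s _ IH]; first exact: inevitable_now.
rewrite /=; have [b -> hb] := emb q.
apply: inevitable_later => -[q' s'] [_ [x [[<-] /=]]] /hb[q1 ho ->] ->.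
by apply: (IH (_, _)); exists q, x.
Qed.

Lemma embeds_reach A B f (c d : fconfig A) :
  @embeds A B f -> reach c d -> reach (f c.1, c.2) (f d.1, d.2).
Proof.
move=> emb; elim=> [{}c|{}c {}d e [q [x [cq tr ds]]] _]; first exact: reach_refl.
apply: reach_step; case: c cq tr ds => _ s /= -> tr ->.
by have [b -> hb] := emb q; exists b, x; split=> //; apply/hb; exists d.1.
Qed.

Lemma spec_impl A s t t' (O O' : store -> Prop) :
  (t <= t')%N -> (forall s', O s' <-> O' s') -> spec A s t O -> spec A s t' O'.
Proof.
move=> le_t h [h1 h2]; split=> [|s' /h]; last exact: h2.
by apply: inevitable_impl h1 => // d [? /h].
Qed.

Definition Act (R : {ffun T -> cel} -> {ffun T -> cel * move} -> Prop) :=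
  @Frag unit (Some tt) (fun _ r o x => o = None /\ R r x).

Lemma spec_Act R s :
  spec (Act R) s 1 (fun s' => exists2 x, R (reads s) x & s' = act s x).
Proof.
split=> [|_ [x Rx ->]].
  apply: inevitable_later => -[q s'] [_ [x [_ /= [-> Rx] ->]]].
  by apply: inevitable_now; split=> //; exists x.
by apply: reach_step (reach_refl _); exists tt, x.
Qed.

(** Its entry is already the exit, so it takes no step; entries are optional states for this
    reason. *)
Definition Skip := @Frag void None (fun _ _ _ _ => False).

Lemma spec_Skip s : spec Skip s 0 (eq s).
Proof.
by split=> [|_ <-]; [exact: inevitable_now|exact: reach_refl].
Qed.

Section SeqFrag.
Variables A B : frag.

Definition seq_inl (o : option (fstate A)) : option (fstate A + fstate B) :=
  if o is Some a then Some (inl a) else omap inr (entry B).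

Definition Seq := @Frag (fstate A + fstate B)%type (seq_inl (entry A))
  (fun q r o x => match q with
    | inl a => exists2 o', fdelta a r o' x & o = seq_inl o'
    | inr b => exists2 o', fdelta b r o' x & o = omap inr o'
    end).

Lemma spec_Seq s t1 t2 O1 O2 :
  spec A s t1 O1 -> (forall s1, O1 s1 -> spec B s1 t2 (O2 s1)) ->
  spec Seq s (t1 + t2) (fun s2 => exists2 s1, O1 s1 & O2 s1 s2).
Proof.
have eA : @embeds A Seq seq_inl by move=> a; exists (inl a).
have eB : @embeds B Seq (omap inr) by move=> b; exists (inr b).
move=> [a1 r1] h; split=> [|s2 [s1 Os1 /(h s1 Os1).2 r2]].
  pose M c := exists2 s1, O1 s1 & c = (seq_inl None, s1) :> fconfig Seq.
  apply: (inevitable_bind (O := M)) => [|_ [s1 Os1 ->]].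
    by apply: (embeds_inevitable eA _ a1) => q s1 [/= -> Os1]; exists s1.
  apply: (embeds_inevitable eB _ (h s1 Os1).1) => q s2 [/= -> Os2].
  by split=> //; exists s1.
exact: reach_trans (embeds_reach eA (r1 _ Os1)) (embeds_reach eB r2).
Qed.

End SeqFrag.

Definition keep (r : {ffun T -> cel}) : {ffun T -> cel * move} :=
  [ffun t => (r t, Stay)].

Lemma act_keep s : act s (keep (reads s)) = s.
Proof.
case: s => h c; congr Store; apply/funext => t; rewrite !ffunE /= ?addr0 //.
by apply/funext => p; case: eqP => [->|].
Qed.

Section IfFrag.
Variables (b : {ffun T -> cel} -> bool) (A B : frag).

Definition If := @Frag (option (fstate A + fstate B)) (Some None)
  (fun q r o x => match q with
    | None => x = keep r /\
        o = if b r then omap (Some \o inl) (entry A)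
            else omap (Some \o inr) (entry B)
    | Some (inl a) => exists2 o', fdelta a r o' x & o = omap (Some \o inl) o'
    | Some (inr a) => exists2 o', fdelta a r o' x & o = omap (Some \o inr) o'
    end).

Lemma spec_If s t O : spec (if b (reads s) then A else B) s t O ->
  spec If s t.+1 O.
Proof.
set C := if _ then A else B => -[h1 h2].
have [f [eC fN fE]] : exists f, [/\ @embeds C If f, f None = None &
    f (entry C) = if b (reads s) then omap (Some \o inl) (entry A)
            else omap (Some \o inr) (entry B)].
  rewrite /C; case: (b _).
    by exists (omap (Some \o inl)); split=> // a; exists (Some (inl a)).
  by exists (omap (Some \o inr)); split=> // a; exists (Some (inr a)).
split=> [|s' /h2 /(embeds_reach eC)]; last first.
  rewrite fE fN /= => r; apply: reach_step r; exists None, (keep (reads s)).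
  by split=> //=; rewrite act_keep.
apply: inevitable_later => -[q s'] [_ [x [[<-] /= [-> ->] ->]]].
rewrite -fE act_keep; apply: (embeds_inevitable eC _ h1) => q' s1 [/= -> Os].
by split.
Qed.

End IfFrag.

Section WhileFrag.
Variables (b : {ffun T -> cel} -> bool) (A : frag).

Definition While := @Frag (option (fstate A)) (Some None)
  (fun q r o x => match q with
    | None => x = keep r /\ o = if b r then Some (entry A) else None
    | Some a => exists2 o', fdelta a r o' x & o = Some o'
    end).

Lemma spec_While_stop s : ~~ b (reads s) -> spec While s 1 (eq s).
Proof.
move=> nb; split=> [|_ <-].
  apply: inevitable_later => -[q s'] [_ [x [[<-] /= [-> ->] ->]]].
  by rewrite (negbTE nb) act_keep; apply: inevitable_now.
apply: reach_step (reach_refl _); exists None, (keep (reads s)).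
by rewrite act_keep /= (negbTE nb).
Qed.

Lemma spec_While_loop s t1 t2 O1 O2 : b (reads s) ->
  spec A s t1 O1 -> (forall s1, O1 s1 -> spec While s1 t2 (O2 s1)) ->
  spec While s (t1 + t2).+1 (fun s2 => exists2 s1, O1 s1 & O2 s1 s2).
Proof.
have eA : @embeds A While Some by move=> a; exists (Some a).
move=> bs [a1 r1] h; split=> [|s2 [s1 Os1 /(h s1 Os1).2 r2]].
  apply: inevitable_later => -[q s'] [_ [x [[<-] /= [-> ->] ->]]].
  rewrite bs act_keep.
  pose M c := exists2 s1, O1 s1 & c = (Some None, s1) :> fconfig While.
  apply: (inevitable_bind (O := M)) => [|_ [s1 Os1 ->]].
    by apply: (embeds_inevitable eA _ a1) => q' s1 [/= -> Os1]; exists s1.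
  apply: inevitable_impl (h s1 Os1).1 => // -[q2 s2] [/= -> Os2].
  by split=> //; exists s1.
apply: reach_step (reach_trans (embeds_reach eA (r1 _ Os1)) r2).
by exists None, (keep (reads s)); rewrite act_keep /= bs.
Qed.

End WhileFrag.

End Fragments.

(** * Compilation of fragments into Turing machines *)

Section Simulation.
Variables (S T' : finType) (A : frag S T').
Notation T := (option T').
Notation cel := (cell S bool).

Definition tape_of (i : 'I_#|T'|.+1) : T := omap enum_val (unlift ord0 i).
Definition tape_index (t : T) : 'I_#|T'|.+1 :=
  if t is Some u then lift ord0 (enum_rank u) else ord0.

Lemma tape_indexK : cancel tape_index tape_of.
Proof.
by case=> [u|]; rewrite /tape_of /= ?liftK ?unlift_none //= enum_rankK.
Qed.

Definition frag_ntm : ntm S :=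
  @NTM S #|T'| (option (fstate A)) bool (entry A) [set None]
    (fun q r q' a => if q is Some p then
       `[< fdelta p [ffun t => r (tape_index t)] q' [ffun t => a (tape_index t)] >]
     else false).

(** Comparing at all distances from the head, with default [None], covers the blanks beyond the two
    lists. *)
Definition tape_rep (tp : tape (S + bool)) (h : int) (f : int -> cel) :=
  forall k : nat, nth None tp.1 k = f (h - 1 - k%:Z) /\
                  nth None tp.2 k = f (h + k%:Z).

Lemma tape_rep_act tp h f (a : cel * move) : tape_rep tp h f ->
  tape_rep (tape_act tp a) (h + offset a.2) (fun p => if p == h then a.1 else f p).
Proof.
case: tp a => l r [w m] rp.
have hl k : nth None l k = f (h - 1 - k%:Z) by have [] := rp k.
have hr k : nth None r k = f (h + k%:Z) by have [] := rp k.
have hr' k : nth None (w :: behead r) k = if h + k%:Z == h then w else f (h + k%:Z).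
  case: k => [|k]; first by rewrite addr0 eqxx.
  by rewrite /= nth_behead hr ifF //; lia.
have hl' k : nth None l k = if h - 1 - k%:Z == h then w else f (h - 1 - k%:Z).
  by rewrite hl ifF //; lia.
case: m => k; rewrite /tape_act /=; split.
- by rewrite nth_behead hl'; congr (if _ == _ then _ else f _); lia.
- case: k => [|k] /=; last by rewrite [LHS]hr'; congr (if _ == _ then _ else f _); lia.
  by rewrite -nth0 hl'; congr (if _ == _ then _ else f _); lia.
- by rewrite hl'; congr (if _ == _ then _ else f _); lia.
- by rewrite [LHS]hr'; congr (if _ == _ then _ else f _); lia.
- case: k => [|k] /=; last by rewrite hl'; congr (if _ == _ then _ else f _); lia.
  by rewrite ifT //; lia.
- by rewrite nth_behead hr ifF; [congr (f _)|]; lia.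
Qed.

Definition config_rep (c : config frag_ntm) (d : fconfig A) :=
  c.1 = d.1 /\ forall t, tape_rep (c.2 (tape_index t)) (hd d.2 t) (ct d.2 t).

Lemma config_rep_reads c d : config_rep c d ->
  [ffun t => [ffun i => tape_read (c.2 i)] (tape_index t)] = reads d.2.
Proof.
move=> [_ h]; apply/ffunP => t; rewrite !ffunE /tape_read -nth0.
by have [_ ->] := h t 0%N; rewrite addr0.
Qed.

Lemma config_rep_step c d c' : config_rep c d -> step c c' ->
  exists2 d', fstep d d' & config_rep c' d'.
Proof.
move=> rp [a [tr tp]]; move: (rp) => [e h]; move: tr.
rewrite /= e; case E: d.1 => [q|] // /asboolP; rewrite (config_rep_reads rp) => tr.
exists (c'.1, act d.2 [ffun t => a (tape_index t)]).
  by exists q, [ffun t => a (tape_index t)].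
by split=> //= t; rewrite tp ffunE; apply: tape_rep_act (h t).
Qed.

Lemma config_rep_fstep c d d' : config_rep c d -> fstep d d' ->
  exists2 c', step c c' & config_rep c' d'.
Proof.
move=> rp [q [x [dq tr d's]]]; move: (rp) => [e h].
pose a := [ffun i => x (tape_of i)].
have xa : [ffun t => a (tape_index t)] = x.
  by apply/ffunP => t; rewrite !ffunE tape_indexK.
exists (d'.1, fun i => tape_act (c.2 i) (a i)).
  exists a; split=> //=; rewrite e dq; apply/asboolP.
  by rewrite (config_rep_reads rp) xa.
split=> //= t; rewrite d's /= /a ffunE tape_indexK; exact: tape_rep_act (h t).
Qed.

Lemma config_rep_inevitable O c d n t c' : config_rep c d ->
  inevitable (@exits _ _ A O) n d -> steps t c c' -> (t <= n)%N.
Proof.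
move=> rp iv; elim: iv t c rp => [{}n {}d [dN _]|{}n q s _ IH] [|t] c rp //=.
  case=> c1 /(config_rep_step rp)[d' [q [x [eq_d _ _]]]] _.
  by rewrite eq_d in dN.
by case=> c1 /(config_rep_step rp)[d' st rp'] /(IH _ st _ _ rp').
Qed.

Lemma config_rep_exit O c d n t c' : config_rep c d ->
  inevitable (@exits _ _ A O) n d -> steps t c c' -> c'.1 = None ->
  exists s, O s.
Proof.
move=> rp iv; elim: iv t c rp => [{}n {}d [dN Od]|{}n q s _ IH] [|t] c rp /=.
- by exists d.2.
- case=> c1 /(config_rep_step rp)[d' [q [x [eq_d _ _]]]] _.
  by rewrite eq_d in dN.
- by move=> <- e; case: rp; rewrite e.
by case=> c1 /(config_rep_step rp)[d' st rp'] /(IH _ st _ _ rp').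
Qed.

Lemma config_rep_reach c d d' : config_rep c d -> reach d d' ->
  exists t c', steps t c c' /\ config_rep c' d'.
Proof.
move=> rp rd; elim: rd c rp => [{}d c rp|{}d e {}d' de _ IH c rp].
  by exists 0%N, c.
have [c1 c1s /IH[t [c' [st rp']]]] := config_rep_fstep rp de.
by exists t.+1, c'; split=> //=; exists c1.
Qed.

Definition init_store (x : seq S) : store S T' :=
  Store (fun=> 0) (fun t p => if t is None then
    (if p is Posz n then omap inl (onth x n) else None) else None).

Lemma initial_rep x : config_rep (initial frag_ntm x) (entry A, init_store x).
Proof.
split=> // t k /=; split; first by rewrite nth_nil sub0r -opprD; case: t.
case: t => [u|] /=; rewrite ?nth_nil //; elim: x k => [|a x IH] [|k] //=.
Qed.

(** Acceptance means that [O] is nonempty: the exit is the only accepting state and has no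
    transitions, and runs stuck elsewhere halt without accepting. *)
Lemma spec_in_NP (L : seq S -> Prop) (p : {poly nat}) :
  (forall x, exists O, spec A (init_store x) p.[size x] O /\
                       (L x <-> exists s, O s)) -> in_NP L.
Proof.
move=> h; exists frag_ntm, p => x; have [Q [[iv rd] ->]] := h x; split.
  by move=> t c /(config_rep_inevitable (initial_rep x) iv).
split=> [[s /rd rs]|[t [c [st _]]]]; last first.
  by rewrite inE => /eqP; apply: config_rep_exit (initial_rep x) iv st.
have [t [c [st [cN _]]]] := config_rep_reach (initial_rep x) rs.
exists t, c; split=> //; last by rewrite inE cN.
by move=> c' [a []]; rewrite cN.
Qed.

End Simulation.

(** * Loops controlled by rulers *)

Section Programs.
Variables (S T' : finType).
Notation T := (option T').
Notation cel := (cell S bool).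
Notation store := (store S T').
Notation frag := (frag S T').
Implicit Types (s : store) (A B c : frag) (b : {ffun T -> cel} -> bool).

Definition sethd s t (p : int) : store :=
  Store (fun t' => if t' == t then p else hd s t') (ct s).

(** A ruler lets a head position serve as a number up to [n]: both ends are recognised by reading a
    blank. *)
Definition ruler s t (n : nat) := forall p, (ct s t p != None) = (0 <= p < n%:Z).

Definition nonblank t : {ffun T -> cel} -> bool := fun r => r t != None.

Lemma nonblankE s t n : ruler s t n -> nonblank t (reads s) = (0 <= hd s t < n%:Z).
Proof. by move=> h; rewrite /nonblank ffunE h. Qed.

Lemma hd_sethd s t p : hd (sethd s t p) t = p.
Proof. by rewrite /= eqxx. Qed.

Lemma sethd_id s t p : hd s t = p -> sethd s t p = s.
Proof.
by case: s => h c /= <-; congr Store; apply/funext => t'; case: eqP => [->|].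
Qed.

Lemma sethd_sethd s t p q : sethd (sethd s t p) t q = sethd s t q.
Proof. by congr Store; apply/funext => t' /=; case: eqP. Qed.

Lemma sethdC s t u p q : t != u ->
  sethd (sethd s t p) u q = sethd (sethd s u q) t p.
Proof.
move=> tu; congr Store; apply/funext => t' /=.
by case: (t' =P u) => // ->; rewrite eq_sym (negbTE tu).
Qed.

Lemma spec_Seq_det A B s t1 t2 s1 O :
  spec A s t1 (eq s1) -> spec B s1 t2 O -> spec (Seq A B) s (t1 + t2)%N O.
Proof.
move=> hA hB; have h : forall s', s1 = s' -> spec B s' t2 O by move=> _ <-.
apply: spec_impl (leqnn _) _ (spec_Seq hA h) => s'.
by split=> [[]|Os] //; exists s1.
Qed.

Lemma spec_While_iter b A (f : nat -> store) n k :
  (forall i, (i < n)%N -> b (reads (f i))) ->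
  (forall i, (i < n)%N -> spec A (f i) k (eq (f i.+1))) ->
  ~~ b (reads (f n)) -> spec (While b A) (f 0%N) (n * k.+1 + 1)%N (eq (f n)).
Proof.
elim: n f => [|n IH] f h1 h2 h3; first exact: spec_While_stop.
have h s' : f 1%N = s' -> spec (While b A) s' (n * k.+1 + 1)%N (eq (f n.+1)).
  move=> <-; apply: (IH (fun i => f i.+1)) => // i lt_i; [exact: h1|exact: h2].
apply: spec_impl (spec_While_loop (h1 0%N isT) (h2 0%N isT) h) => [|s'].
  by rewrite mulSn; lia.
by split=> [[]|e] //; exists (f 1%N).
Qed.

Definition move_tape t (m : move) : frag :=
  Act (fun r x => x = [ffun t' => (r t', if t' == t then m else Stay)]).

Lemma spec_move_tape t m s :
  spec (move_tape t m) s 1 (eq (sethd s t (hd s t + offset m))).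
Proof.
have e : act s [ffun t' => (reads s t', if t' == t then m else Stay)] =
         sethd s t (hd s t + offset m).
  case: s => h c; congr Store; apply/funext => t'; rewrite !ffunE /=.
    by case: eqP => [->|] //=; rewrite addr0.
  by apply/funext => p; case: eqP => [->|].
apply: spec_impl (leqnn _) _ (spec_Act _ s) => s'; rewrite -e.
by split=> [[_ -> ->]|<-] //; eexists.
Qed.

(** The initial step left brings a head standing on the blank at [n] back onto the ruler, so that
    the loop stops at -1 from every starting position between 0 and [n]. *)
Definition rewind t : frag :=
  Seq (move_tape t MoveLeft)
    (Seq (While (nonblank t) (move_tape t MoveLeft)) (move_tape t MoveRight)).

Lemma spec_rewind t s n : ruler s t n -> 0 <= hd s t <= n%:Z ->
  spec (rewind t) s (2 * n + 3)%N (eq (sethd s t 0)).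
Proof.
move=> rt; case e: (hd s t) => [m|//] /andP[_ le_m].
pose f i := sethd s t (m%:Z - 1 - i%:Z).
have fr i : ruler (f i) t n by [].
have h1 : spec (move_tape t MoveLeft) s 1 (eq (f 0%N)).
  apply: spec_impl (spec_move_tape _ _ _) => // s'.
  by rewrite /f e subr0.
have h2 : spec (While (nonblank t) (move_tape t MoveLeft)) (f 0%N) (m * 2 + 1)%N%N
    (eq (f m)).
  apply: (spec_While_iter (f := f)) => [i lt_i|i lt_i|]; rewrite ?(nonblankE (fr _)) ?hd_sethd.
  - by lia.
  - apply: spec_impl (spec_move_tape _ _ _) => // s'.
    by rewrite hd_sethd sethd_sethd /f; split=> <-; congr sethd; rewrite /=; lia.
  by rewrite negb_and; lia.
have h3 := spec_move_tape t MoveRight (f m).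
have := spec_Seq_det h1 (spec_Seq_det h2 h3).
apply: spec_impl => [|s']; first by lia.
by rewrite hd_sethd sethd_sethd; split=> <-; congr sethd; rewrite /=; lia.
Qed.

Section Loops.
(* [E m] is the effect of [m] repetitions of a basic command that neither reads
   nor moves the heads of the tapes in [L]. *)
Variables (L : pred T) (E : nat -> store -> store).
Hypothesis E0 : forall s, E 0 s = s.
Hypothesis ED : forall m n s, E (m + n)%N s = E n (E m s).
Hypothesis E_sethd : forall m s t p, L t -> E m (sethd s t p) = sethd (E m s) t p.
Hypothesis E_hd : forall m s t, L t -> hd (E m s) t = hd s t.
Hypothesis E_ct : forall m s t, L t -> ct (E m s) t = ct s t.

Definition loop_ruler t c :=
  Seq (While (nonblank t) (Seq c (move_tape t MoveRight))) (rewind t).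

Lemma spec_loop_ruler t c m k n s : L t -> ruler s t n -> hd s t = 0 ->
  (forall i p, spec c (sethd (E i s) t p) k (eq (E m (sethd (E i s) t p)))) ->
  spec (loop_ruler t c) s (n * k.+2 + 1 + (2 * n + 3))%N (eq (E (n * m)%N s)).
Proof.
move=> Lt rt h0 hc; pose f i := sethd (E (i * m)%N s) t i%:Z.
have fr i : ruler (f i) t n by move=> p; rewrite /= E_ct.
have f0 : f 0%N = s by rewrite /f mul0n E0 sethd_id.
have h1 : spec (While (nonblank t) (Seq c (move_tape t MoveRight))) (f 0%N)
    (n * k.+2 + 1)%N (eq (f n)).
  apply: (spec_While_iter (f := f)) => [i lt_i|i lt_i|]; rewrite ?(nonblankE (fr _)) ?hd_sethd.
  - by lia.
  - rewrite -addn1; apply: spec_Seq_det (hc _ _) _.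
    apply: spec_impl (spec_move_tape _ _ _) => // s'.
    rewrite E_hd // hd_sethd -E_sethd // sethd_sethd /f mulSn addnC ED -E_sethd //.
    by split=> <-; rewrite ?E_sethd //; congr sethd; rewrite /=; lia.
  by rewrite ltxx andbF.
rewrite -{1}f0; apply: spec_Seq_det h1 _.
apply: spec_impl (spec_rewind (fr n) _) => // [s'|]; last first.
  by rewrite hd_sethd; lia.
by rewrite sethd_sethd sethd_id ?E_hd.
Qed.

Definition loop_rulers (ts : seq T) c := foldr loop_ruler c ts.

Fixpoint loop_time (n k j : nat) : nat :=
  if j is j'.+1 then (n * (loop_time n k j').+2 + 1 + (2 * n + 3))%N else k.

Lemma spec_loop_rulers ts c m k n s : all L ts -> uniq ts ->
  (forall t, t \in ts -> ruler s t n /\ hd s t = 0) ->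
  (forall s', spec c s' k (eq (E m s'))) ->
  spec (loop_rulers ts c) s (loop_time n k (size ts))
    (eq (E (n ^ size ts * m)%N s)).
Proof.
move=> + + + hc; elim: ts s => [|t ts IH] s /=; first by rewrite mul1n.
move=> /andP[Lt Lts] /andP[tts uts] h.
have [rt h0] := h t (mem_head _ _).
rewrite expnS -mulnA; apply: spec_loop_ruler => // i p.
apply: IH => // u uts'; have [|ru hu] := h u; first by rewrite inE uts' orbT.
have Lu : L u by exact: allP Lts u uts'.
split; first by move=> q; rewrite /= E_ct.
by rewrite /= (_ : u == t = false) ?E_hd //; apply: contraNF tts => /eqP <-.
Qed.

Variable z : T.
Hypothesis Lz : L z.

(* The tape [z] remembers how far the head of [t] has been moved left. *)
Definition loop_head t c :=
  Seq (Seq (move_tape t MoveLeft)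
    (While (nonblank t) (Seq c (Seq (move_tape t MoveLeft) (move_tape z MoveRight)))))
  (Seq (Seq (move_tape z MoveLeft)
    (While (nonblank z) (Seq (move_tape z MoveLeft) (move_tape t MoveRight))))
    (Seq (move_tape z MoveRight) (move_tape t MoveRight))).

Lemma spec_loop_head t c m k n v s : L t -> t != z -> ruler s t n -> ruler s z n ->
  hd s z = 0 -> hd s t = v%:Z -> (v <= n)%N ->
  (forall i p q, let s' := sethd (sethd (E i s) t p) z q in
     spec c s' k (eq (E m s'))) ->
  spec (loop_head t c) s (n * (k + 6) + 6)%N (eq (E (v * m)%N s)).
Proof.
move=> Lt tz rt rz hz ht le_v hc.
(* In the first loop the heads of [t] and [z] have constant sum; when [t] runs off its ruler, [z]
   stands at [v] and tells how far to go back. *)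
have zt : z != t by rewrite eq_sym.
pose f i := sethd (sethd (E (i * m)%N s) t (v%:Z - 1 - i%:Z)) z i%:Z.
have hft i : hd (f i) t = v%:Z - 1 - i%:Z by rewrite /= (negbTE tz) eqxx.
have hfz i : hd (f i) z = i%:Z by rewrite hd_sethd.
have frt i : ruler (f i) t n by move=> p; rewrite /= E_ct.
have h1 : spec (move_tape t MoveLeft) s 1 (eq (f 0%N)).
  apply: spec_impl (spec_move_tape _ _ _) => // s'.
  by rewrite /f mul0n E0 ht subr0 sethdC // (sethd_id hz).
have h2 : spec (While (nonblank t)
      (Seq c (Seq (move_tape t MoveLeft) (move_tape z MoveRight)))) (f 0%N)
    (v * (k + (1 + 1)).+1 + 1)%N (eq (f v)).
  apply: (spec_While_iter (f := f)) => [i lt_i|i lt_i|]; rewrite ?(nonblankE (frt _)) ?hft.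
  - by lia.
  - apply: spec_Seq_det (hc _ _ _) _.
    apply: spec_Seq_det (spec_move_tape _ _ _) _.
    apply: spec_impl (spec_move_tape _ _ _) => // s'.
    rewrite /= !E_hd //= !eqxx (negbTE tz) (negbTE zt) /f mulSn addnC ED.
    rewrite !E_sethd // [sethd (sethd _ z _) t _]sethdC 1?eq_sym // !sethd_sethd.
    by split=> <-; congr (sethd (sethd _ _ _) _ _); lia.
  by lia.
pose g i := sethd (sethd (E (v * m)%N s) z (v%:Z - 1 - i%:Z)) t (i%:Z - 1).
have hgt i : hd (g i) t = i%:Z - 1 by rewrite hd_sethd.
have hgz i : hd (g i) z = v%:Z - 1 - i%:Z by rewrite /= (negbTE zt) eqxx.
have grz i : ruler (g i) z n by move=> p; rewrite /= E_ct.
have h3 : spec (move_tape z MoveLeft) (f v) 1 (eq (g 0%N)).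
  apply: spec_impl (spec_move_tape _ _ _) => // s'.
  rewrite hfz sethd_sethd /g [X in _ <-> eq X _]sethdC //.
  by split=> <-; congr (sethd (sethd _ _ _) _ _); rewrite /=; lia.
have h4 : spec (While (nonblank z)
      (Seq (move_tape z MoveLeft) (move_tape t MoveRight))) (g 0%N)
    (v * (1 + 1).+1 + 1)%N (eq (g v)).
  apply: (spec_While_iter (f := g)) => [i lt_i|i lt_i|]; rewrite ?(nonblankE (grz _)) ?hgz.
  - by lia.
  - apply: spec_Seq_det (spec_move_tape _ _ _) _.
    apply: spec_impl (spec_move_tape _ _ _) => // s'.
    rewrite hgz /= eqxx (negbTE tz) /g sethdC 1?eq_sym // sethd_sethd sethdC // sethd_sethd.
    by split=> <-; congr (sethd (sethd _ _ _) _ _); rewrite /=; lia.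
  by lia.
apply: spec_impl (spec_Seq_det (spec_Seq_det h1 h2)
  (spec_Seq_det (spec_Seq_det h3 h4)
   (spec_Seq_det (spec_move_tape _ _ _) (spec_move_tape _ _ _)))) => [|s'].
  have : (v * (k + 6) <= n * (k + 6))%N by rewrite leq_mul2r le_v orbT.
  by rewrite !mulnDr !mulnS; lia.
rewrite hgz /= eqxx (negbTE tz) /g sethdC 1?eq_sym // sethd_sethd sethdC // sethd_sethd.
rewrite [sethd (E _ _) z _]sethd_id ?E_hd //= ?hz; last by lia.
rewrite sethd_id // E_hd // ht; lia.
Qed.

End Loops.
End Programs.

(** * Evaluating first-order formulas *)

(* De Bruijn indices refer to the list of values of the variables. *)
Inductive formula (S : Type) :=
| FLetter of S & nat
| FLess of nat & nat
| FRel of nat & seq nat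
| FNot of formula S
| FAnd of formula S & formula S
| FAll of formula S.

Fixpoint fo_eval (S : eqType) (N : nat) (x : seq S) (Y : nat -> seq nat -> bool)
    (e : seq nat) (f : formula S) : bool :=
  match f with
  | FLetter s i => onth x (nth 0%N e i) == Some s
  | FLess i j => (nth 0%N e i < nth 0%N e j)%N
  | FRel k js => Y k [seq nth 0%N e j | j <- js]
  | FNot g => ~~ fo_eval N x Y e g
  | FAnd g h => fo_eval N x Y e g && fo_eval N x Y e h
  | FAll g => all (fun v => fo_eval N x Y (v :: e) g) (iota 0 N)
  end.

Fixpoint form_depth S (f : formula S) : nat :=
  match f with
  | FNot g => form_depth g
  | FAnd g h => maxn (form_depth g) (form_depth h)
  | FAll g => (form_depth g).+1
  | _ => 0
  end.

Fixpoint form_arity S (f : formula S) : nat :=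
  match f with
  | FRel _ js => size js
  | FNot g => form_arity g
  | FAnd g h => maxn (form_arity g) (form_arity h)
  | FAll g => form_arity g
  | _ => 0
  end.

Fixpoint form_rels S (f : formula S) : nat :=
  match f with
  | FRel k _ => k.+1
  | FNot g => form_rels g
  | FAnd g h => maxn (form_rels g) (form_rels h)
  | FAll g => form_rels g
  | _ => 0
  end.

(** Agreement is asked only for symbols, arities and arguments that can occur, since the guessed
    tables cover no more. *)
Lemma fo_eval_ext (S : eqType) N (x : seq S) Y Z e f :
  (forall k a, (k < form_rels f)%N -> (size a <= form_arity f)%N ->
     all (fun v => v < N)%N a -> Y k a = Z k a) -> (0 < N)%N ->
  all (fun v => v < N)%N e -> fo_eval N x Y e f = fo_eval N x Z e f.
Proof.
move=> + N0; elim: f e => //= [k js|g IH|g IHg h IHh|g IH] e YZ he.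
- apply: YZ => //; rewrite ?size_map //.
  apply/allP => _ /mapP[j _ ->]; have [je|ej] := ltnP j (size e).
    exact: all_nthP he _ je.
  (* An index beyond the environment denotes 0, which lies in the domain because [0 < N]. *)
  by rewrite nth_default.
- by rewrite IH.
- rewrite IHg ?IHh // => k a hk ha; apply: YZ; rewrite leq_max ?hk ?ha ?orbT //.
- by apply: eq_in_all => v; rewrite mem_iota /= add0n => v_N; rewrite IH //= v_N.
Qed.

Section Layout.
Variables (S : finType) (nb nv nl nr : nat).

(* Apart from the input tape [None]: rulers of length [size x + 2], one tape per
   variable whose head position is its value, loop counters, four auxiliary
   tapes, and for every relation symbol and arity a tape with its table, indexed
   by [tuple_index]. *)
Definition tape_name : finType :=
  ('I_nb + 'I_nv + 'I_nl + 'I_4 + 'I_nr.+1 * 'I_nl.+1)%type.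
Notation T := (option tape_name).
Notation cel := (cell S bool).
Notation store := (store S tape_name).
Notation frag := (frag S tape_name).

Definition tbase i : T := Some (inl (inl (inl (inl i)))).
Definition tvar i : T := Some (inl (inl (inl (inr i)))).
Definition tloop i : T := Some (inl (inl (inr i))).
Definition taux i : T := Some (inl (inr i)).
Definition trel q : T := Some (inr q).

Definition tsave : T := taux 0.
Definition tdiff : T := taux 1.
Definition tflag : T := taux 2.
Definition tlong : T := taux 3.

Definition loops : seq T := [seq tloop i | i <- enum 'I_nl].

Definition is_base (t : T) := if t is Some (inl (inl (inl (inl _)))) then true else false.
Definition is_rel (t : T) := if t is Some (inr _) then true else false.
Definition is_long (t : T) := t == tlong.
Definition is_short (t : T) := [&& ~~ is_base t, ~~ is_rel t, t != tlong & t != None].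

(* Variables are numbered from the outermost quantifier on tapes, from the
   innermost one in formulas. *)
Definition tvar_of (i : nat) : T := nth None [seq tvar i | i <- enum 'I_nv] i.

Variables (N : nat) (C : T -> int -> cel).
Hypothesis N0 : (0 < N)%N.
Hypothesis C_short : forall t p, is_short t -> (C t p != None) = (0 <= p < N%:Z).

Definition ready (e : seq nat) (s : store) := [/\ ct s = C,
  forall i, (i < nv)%N -> hd s (tvar_of i) = (nth 0%N (rev e) i)%:Z,
  forall t, t \in loops -> hd s t = 0 & hd s tsave = 0].

(** The tapes whose heads are displaced during a lookup. None of them holds a variable or a loop
    counter, so [ready] survives the displacement. *)
Definition is_probe (t : T) := [|| t == None, is_rel t | t == tdiff].

Lemma tvar_of_short i : (i < nv)%N -> is_short (tvar_of i).
Proof.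
move=> lt_i; rewrite /tvar_of (nth_map (Ordinal lt_i)) ?size_enum_ord //.
Qed.

Lemma tvar_ofE i : (i < nv)%N -> exists j, tvar_of i = tvar j.
Proof.
move=> lt_i; rewrite /tvar_of (nth_map (Ordinal lt_i)) ?size_enum_ord //.
by eexists.
Qed.

Lemma loops_short t : t \in loops -> is_short t.
Proof. by case/mapP=> i _ ->. Qed.

Lemma probe_other y t : is_probe y ->
  (t \in loops) || (t == tsave) || (t == tflag) || (t \in [seq tvar_of i | i <- iota 0 nv]) ->
  (t == y) = false.
Proof.
move=> py ht; apply: contraTF ht => /eqP ->; rewrite !negb_or.
have h u : u \in loops -> ~~ is_probe u by case/mapP=> i _ ->.
have h' u : u \in [seq tvar_of i | i <- iota 0 nv] -> ~~ is_probe u.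
  by case/mapP => i; rewrite mem_iota /= add0n => /tvar_ofE[j ->] ->.
have p1 : ~~ is_probe tsave by []. have p2 : ~~ is_probe tflag by [].
apply/andP; split; last by apply: contraL py => /h'.
apply/andP; split; last by apply: contraL py => /eqP ->.
apply/andP; split; last by apply: contraL py => /eqP ->.
by apply: contraL py => /h.
Qed.

Lemma ruler_short s t : ct s = C -> is_short t -> ruler s t N.
Proof. by move=> sC ht p; rewrite sC C_short. Qed.

Fixpoint tuple_index (a : seq nat) : nat :=
  if a is v :: a' then (v + N * tuple_index a')%N else 0.

Lemma tuple_index_lt a : all (fun v => v < N)%N a ->
  (tuple_index a < N ^ size a)%N.
Proof.
elim: a => //= v a IH /andP[hv /IH h]; rewrite expnS.
by apply: leq_trans (leq_mul (leqnn N) h); rewrite mulnS -addSn leq_add2r.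
Qed.

Definition moved y (m : move) (k : nat) (s : store) : store :=
  sethd s y (hd s y + offset m * k%:Z).

Lemma moved0 y m s : moved y m 0 s = s.
Proof. by rewrite /moved mulr0 addr0 sethd_id. Qed.

Lemma movedD y m k l s : moved y m (k + l)%N s = moved y m l (moved y m k s).
Proof.
by rewrite /moved hd_sethd sethd_sethd PoszD mulrDr addrA.
Qed.

Lemma moved_sethd y m k s t p : t != y ->
  moved y m k (sethd s t p) = sethd (moved y m k s) t p.
Proof. by move=> ty; rewrite /moved sethdC //= eq_sym (negbTE ty). Qed.

Lemma moved_hd y m k s t : t != y -> hd (moved y m k s) t = hd s t.
Proof. by move=> /negbTE ty; rewrite /= ty. Qed.

(** Component [j] of a tuple has weight [N ^ j] in [tuple_index]: for every unit of the variable's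
    head position, [j] nested loops over rulers of length [N] move the head of [y]. An index not
    below [d] denotes 0 and requires no move. *)
Fixpoint walk (y : T) (m : move) (d : nat) (j : nat) (js : seq nat) : frag :=
  if js is i :: js' then
    Seq (if (i < d)%N then
           loop_head tsave (tvar_of (d - i.+1)) (loop_rulers (take j loops) (move_tape S y m))
         else Skip S tape_name)
      (walk y m d j.+1 js')
  else Skip S tape_name.

Fixpoint walk_time n j k : nat :=
  if k is k'.+1 then (n * (loop_time n 1 j + 6) + 6 + walk_time n j.+1 k')%N
  else 0.

Lemma ready_moved e s y m k : is_probe y -> ready e s -> ready e (moved y m k s).
Proof.
move=> py [h1 h2 h3 h4]; split=> //= [i lt_i|t ht|].
- rewrite probe_other ?h2 //; apply/orP; right; apply: map_f.
  by rewrite mem_iota.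
- by rewrite probe_other ?h3 // ht.
- by rewrite probe_other ?h4 ?eqxx ?orbT.
Qed.

Lemma spec_walk y m j js e s : is_probe y -> ready e s -> (size e <= nv)%N ->
  all (fun v => v < N)%N e -> (j + size js <= nl)%N ->
  spec (walk y m (size e) j js) s (walk_time N j (size js))
    (eq (moved y m (N ^ j * tuple_index [seq nth 0%N e i | i <- js])%N s)).
Proof.
move=> py + le_e lt_e; elim: js j s => [|i js IH] j s rs /= le_j.
  by rewrite muln0 moved0; apply: spec_Skip.
rewrite [(N ^ j * _)%N]mulnDr [(N ^ j * (N * _))%N]mulnA -expnSr movedD.
apply: spec_Seq_det (IH _ _ _ _); first last.
- by rewrite addSnnS.
- exact: ready_moved.
have [lt_i|ge_i] := ltnP; last first.
  rewrite nth_default // muln0 moved0.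
  by apply: spec_impl (spec_Skip s).
pose L := fun t => t != y.
have Lvar k : (k < nv)%N -> L (tvar_of k).
  move=> lt_k; rewrite /L probe_other //; apply/orP; right; apply: map_f.
  by rewrite mem_iota.
have Lsave : L tsave by rewrite /L probe_other ?eqxx ?orbT.
have Lloop t : t \in loops -> L t by move=> lt; rewrite /L probe_other ?lt.
have [sC hv hl hz] := rs.
have lt_k : (size e - i.+1 < nv)%N by rewrite (leq_trans _ le_e) // ltn_subrL (leq_ltn_trans _ lt_i).
have Ntake : size (take j loops) = j.
  by rewrite size_takel // size_map size_enum_ord; apply: leq_trans le_j; rewrite leq_addr.
rewrite [(N ^ j * _)%N]mulnC.
apply: (spec_loop_head (L := L) (E := moved y m)) => //.
- exact: moved0.
- exact: movedD.
- by move=> *; apply: moved_sethd.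
- by move=> *; apply: moved_hd.
- exact: Lvar.
- by have [k ->] := tvar_ofE lt_k.
- by apply: ruler_short => //; apply: tvar_of_short.
- exact: ruler_short.
- rewrite hv // nth_rev; last by rewrite ltn_subrL (leq_ltn_trans _ lt_i).
  by congr (nth _ _ _)%:Z; lia.
- by apply: ltnW; apply: all_nthP lt_e _ lt_i.
move=> i0 p q; set s' := sethd _ _ _.
have := @spec_loop_rulers S tape_name L (moved y m) (moved0 y m) (movedD y m).
rewrite -[in loop_time _ _ _]Ntake -[in (N ^ _)%N]Ntake -[X in moved y m X]muln1.
move=> H; apply: H.
- by move=> *; apply: moved_sethd.
- by move=> *; apply: moved_hd.
- by [].
- by apply/allP => t /mem_take; apply: Lloop.
- by rewrite take_uniq // map_inj_uniq ?enum_uniq // => ? ? [].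
- move=> t /mem_take ht; split; first by apply: ruler_short => //; apply: loops_short.
  have tz : (t == tsave) = false by case/mapP: ht => ? _ ->.
  have tv : (t == tvar_of (size e - i.+1)) = false.
    by have [k ->] := tvar_ofE lt_k; case/mapP: ht => ? _ ->.
  by rewrite /= tz tv (negbTE (Lloop _ ht)) hl.
- by move=> s1; apply: spec_impl (spec_move_tape _ _ _) => // s2; rewrite /moved mulr1.
Qed.

Definition set_flag (b : bool) : frag :=
  If (nonblank tflag) (if b then Skip S tape_name else move_tape S tflag MoveLeft)
    (if b then move_tape S tflag MoveRight else Skip S tape_name).

(** The truth value of the last subformula is a head position as well: on the ruler of [tflag], or
    just left of it. *)
Definition flag_pos (b : bool) : int := if b then 0 else -1.

Lemma flag_nonblank s b : ct s = C -> hd s tflag = flag_pos b ->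
  nonblank tflag (reads s) = b.
Proof.
move=> sC hf; rewrite (nonblankE (ruler_short sC _)) // hf.
by case: b {hf} => //=; rewrite ltz_nat N0.
Qed.

Lemma spec_set_flag s b b' : ct s = C -> hd s tflag = flag_pos b' ->
  spec (set_flag b) s 2 (eq (sethd s tflag (flag_pos b))).
Proof.
move=> sC hf; apply: spec_If; rewrite (flag_nonblank sC hf).
case: b b' hf => -[] hf; first [
  by apply: spec_impl (spec_Skip s) => // s'; rewrite sethd_id |
  by apply: spec_impl (spec_move_tape _ _ _) => // s'; rewrite hf ].
Qed.

Definition probe_atom y d js (b : {ffun T -> cel} -> bool) : frag :=
  Seq (walk y MoveRight d 0 js)
    (Seq (If b (set_flag true) (set_flag false)) (walk y MoveLeft d 0 js)).

(** Canonical stores: only the variables and the flag are off their rest positions. Every subformula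
    ends in such a store with the same [e], which makes evaluation compositional. *)
Definition eval_store (e : seq nat) (b : bool) : store :=
  Store (fun t => if t is Some (inl (inl (inl (inr i)))) then (nth 0%N (rev e) i)%:Z
                  else if t == tflag then flag_pos b else 0) C.

Lemma eval_store_ready e b : ready e (eval_store e b).
Proof.
split=> //= [i lt_i|t /mapP[i _ ->]] //.
by rewrite /tvar_of (nth_map (Ordinal lt_i)) ?size_enum_ord //= nth_enum_ord.
Qed.

Lemma eval_store_probe e b y : is_probe y -> hd (eval_store e b) y = 0.
Proof. by rewrite /is_probe; case: y => [[[[[y|y]|y]|y]|y]|] //= /eqP[->]. Qed.

Lemma spec_probe_atom y js (b : {ffun T -> cel} -> bool) e fl : is_probe y ->
  (size e <= nv)%N -> all (fun v => v < N)%N e -> (size js <= nl)%N ->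
  spec (probe_atom y (size e) js b) (eval_store e fl)
    (walk_time N 0 (size js) + (3 + walk_time N 0 (size js)))
    (eq (eval_store e (b (reads (sethd (eval_store e fl) y
           (tuple_index [seq nth 0%N e i | i <- js])%:Z))))).
Proof.
move=> py le_e lt_e le_j; set k := tuple_index _; set b' := b _.
have hy := eval_store_probe e fl py.
have my : (tflag == y) = false by rewrite probe_other // eqxx ?orbT.
have e1 : moved y MoveRight k (eval_store e fl) = sethd (eval_store e fl) y k%:Z.
  by rewrite /moved hy add0r mul1r.
have r1 := eval_store_ready e fl.
apply: spec_Seq_det (spec_walk _ py r1 le_e lt_e _) _; first exact: le_j.
rewrite expn0 mul1n -/k e1.
set s1 := sethd _ _ _.
have f1 : hd s1 tflag = flag_pos fl by rewrite /= my.
apply: (spec_Seq_det (s1 := sethd s1 tflag (flag_pos b'))).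
  apply: spec_If; rewrite -/b'.
  by case: ifP => hb; [have := spec_set_flag true (erefl : ct s1 = C) f1|
    have := spec_set_flag false (erefl : ct s1 = C) f1];
    apply: spec_impl => // s'; rewrite hb.
have e2 : sethd s1 tflag (flag_pos b') = moved y MoveRight k (eval_store e b').
  rewrite /s1 sethdC 1?eq_sym ?my // /moved.
  rewrite eval_store_probe //.
  rewrite add0r mul1r; congr sethd; congr Store; apply/funext => t /=.
  by case: eqP => [->|].
rewrite e2; have r2 := ready_moved MoveRight k py (eval_store_ready e b').
apply: spec_impl (spec_walk MoveLeft py r2 le_e lt_e (j := 0) _) => // s'.
rewrite expn0 mul1n -/k /moved hd_sethd sethd_sethd.
by rewrite /= mul1r mulN1r addrK sethd_id.
Qed.

Lemma eval_store_cons v e b : (size e < nv)%N ->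
  eval_store (v :: e) b = sethd (eval_store e b) (tvar_of (size e)) v%:Z.
Proof.
move=> lt_e; congr Store; apply/funext => t /=.
rewrite /tvar_of (nth_map (Ordinal lt_e)) ?size_enum_ord //.
case: t => [[[[[i|i]|i]|i]|i]|] //=.
rewrite rev_cons nth_rcons size_rev [tvar _ == _](inj_eq (f := tvar)) => [|? ? []//].
have -> : (i == nth (Ordinal lt_e) (enum 'I_nv) (size e)) = (nat_of_ord i == size e).
  by rewrite -val_eqE /= nth_enum_ord.
by case: ltngtP => // lt; rewrite nth_default // size_rev ltnW.
Qed.

(** Heads of unbound variables rest at 0, so a quantifier starts its loop, and after rewinding
    leaves it, without further work. *)
Lemma eval_store_0 e b : (size e < nv)%N -> eval_store (0%N :: e) b = eval_store e b.
Proof.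
move=> lt_e; rewrite eval_store_cons // sethd_id //.
have [_ -> // _ _] := eval_store_ready e b.
by rewrite nth_default ?size_rev.
Qed.

Lemma spec_While_step (b : {ffun T -> cel} -> bool) (A : frag) s t1 t2 s1 Q : b (reads s) ->
  spec A s t1 (eq s1) -> spec (While b A) s1 t2 Q ->
  spec (While b A) s (t1 + t2).+1 Q.
Proof.
move=> bs hA hB; have h s' : s1 = s' -> spec (While b A) s' t2 Q by move=> <-.
apply: spec_impl (leqnn _) _ (spec_While_loop bs hA h) => s'.
by split=> [[]|Os] //; exists s1.
Qed.

Definition flag_on : {ffun T -> cel} -> bool := nonblank tflag.

(** For [FLess] the head of [tdiff] is displaced by the difference of the two values; as both are
    below [N], it reads a blank exactly if the difference is negative. A quantifier leaves its loop
    at the first counterexample, with the flag down. *)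
Fixpoint feval (d : nat) (f : formula S) : frag :=
  match f with
  | FLetter s i => probe_atom None d [:: i] (fun r => r None == Some (inl s))
  | FRel k js => let y := trel (inord k, inord (size js)) in
      probe_atom y d js (fun r => r y == Some (inr true))
  | FLess i j =>
      Seq (walk tdiff MoveRight d 0 [:: i])
        (Seq (walk tdiff MoveLeft d 0 [:: j])
          (Seq (If (nonblank tdiff) (set_flag false) (set_flag true))
            (Seq (walk tdiff MoveRight d 0 [:: j])
              (walk tdiff MoveLeft d 0 [:: i]))))
  | FNot g => Seq (feval d g) (If flag_on (set_flag false) (set_flag true))
  | FAnd g h => Seq (feval d g) (If flag_on (feval d h) (Skip S tape_name))
  | FAll g =>
      Seq (set_flag true)
        (Seq (While (fun r => flag_on r && nonblank (tvar_of d) r)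
               (Seq (feval d.+1 g)
                 (If flag_on (move_tape S (tvar_of d) MoveRight) (Skip S tape_name))))
             (rewind S (tvar_of d)))
  end.

Fixpoint feval_time (n : nat) (f : formula S) : nat :=
  match f with
  | FLetter _ _ => walk_time n 0 1 + (3 + walk_time n 0 1)
  | FRel _ js => walk_time n 0 (size js) + (3 + walk_time n 0 (size js))
  | FLess i j => 4 * walk_time n 0 1 + 8
  | FNot g => feval_time n g + 3
  | FAnd g h => feval_time n g + (feval_time n h).+1
  | FAll g => 2 + (n * (feval_time n g + 3) + (feval_time n g + 5) + (2 * n + 3))
  end.

Variables (x : seq S) (Y : nat -> seq nat -> bool).
Hypothesis C_input : forall n : nat, C None n%:Z = omap inl (onth x n).
Hypothesis C_rel : forall k a, (k <= nr)%N -> (size a <= nl)%N ->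
  all (fun v => v < N)%N a ->
  C (trel (inord k, inord (size a))) (tuple_index a)%:Z = Some (inr (Y k a)).
Hypothesis nl_gt0 : (0 < nl)%N.

Lemma all_lookup e js : all (fun v => v < N)%N e ->
  all (fun v => v < N)%N [seq nth 0%N e i | i <- js].
Proof.
move=> he; apply/allP => _ /mapP[j _ ->]; have [je|ej] := ltnP j (size e).
  exact: all_nthP he _ je.
by rewrite nth_default.
Qed.

Lemma spec_feval_less i j e fl : (size e <= nv)%N -> all (fun v => v < N)%N e ->
  spec (feval (size e) (FLess S i j)) (eval_store e fl) (feval_time N (FLess S i j))
    (eq (eval_store e (nth 0%N e i < nth 0%N e j)%N)).
Proof.
move=> le_e lt_e; set b := (_ < _)%N.
have py : is_probe tdiff by [].
have W s m k : ready e s ->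
    spec (walk tdiff m (size e) 0 [:: k]) s (walk_time N 0 1)
      (eq (moved tdiff m (nth 0%N e k) s)).
  move=> rs; have := spec_walk m py rs le_e lt_e (js := [:: k]) (j := 0).
  by move=> /(_ nl_gt0); rewrite expn0 mul1n [X in moved _ _ X]/= muln0 addn0.
have r0 := eval_store_ready e fl.
have r1 := ready_moved MoveRight (nth 0%N e i) py r0.
have r2 := ready_moved MoveLeft (nth 0%N e j) py r1.
set s2 := moved _ _ _ (moved _ _ _ _) in r2.
have f2 : hd s2 tflag = flag_pos fl by [].
have C2 : ct s2 = C by [].
have n2 : nonblank tdiff (reads s2) = ~~ b.
  rewrite (nonblankE (ruler_short C2 _)) // /b.
  have : (nth 0%N e i < N)%N by have := all_lookup [:: i] lt_e; rewrite /= andbT.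
  by rewrite /s2 /=; lia.
pose s3 := moved tdiff MoveLeft (nth 0%N e j) (moved tdiff MoveRight (nth 0%N e i) (eval_store e b)).
have e3 : sethd s2 tflag (flag_pos b) = s3.
  rewrite /s3 /s2 /moved !hd_sethd !sethd_sethd sethdC //; congr sethd.
  by congr Store; apply/funext => t /=; case: eqP => [->|].
have r3 : ready e s3 by do 2 apply: ready_moved => //; apply: eval_store_ready.
have h3 : spec (If (nonblank tdiff) (set_flag false) (set_flag true)) s2 3 (eq s3).
  rewrite -e3; apply: spec_If; rewrite n2.
  by case: b {n2 s3 e3 r3} => /=; apply: spec_set_flag C2 f2.
have r4 := ready_moved MoveRight (nth 0%N e j) py r3.
have := spec_Seq_det (W _ MoveRight i r0) (spec_Seq_det (W _ MoveLeft j r1)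
 (spec_Seq_det h3 (spec_Seq_det (W _ MoveRight j r3) (W _ MoveLeft i r4)))).
apply: spec_impl => [|s']; first by rewrite /feval_time; lia.
rewrite /s3 /moved !hd_sethd !sethd_sethd sethd_id //=.
by rewrite mul1r mulN1r; lia.
Qed.

Lemma spec_feval f e fl : (size e + form_depth f <= nv)%N ->
  (form_arity f <= nl)%N -> (form_rels f <= nr.+1)%N -> all (fun v => v < N)%N e ->
  spec (feval (size e) f) (eval_store e fl) (feval_time N f)
    (eq (eval_store e (fo_eval N x Y e f))).
Proof.
elim: f e fl => [s i|i j|k js|g IH|g IHg h IHh|g IH] e fl /= hdp ha hr lt_e.
- have le_e : (size e <= nv)%N by rewrite -(addn0 (size e)).
  apply: spec_impl (spec_probe_atom _ fl _ le_e lt_e _) => // s' /=.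
  rewrite ffunE /= muln0 addn0 C_input.
  by case: (onth x _) => [u|] //=; rewrite !(inj_eq Some_inj) (inj_eq inl_inj).
- by apply: spec_feval_less => //; rewrite -(addn0 (size e)).
- have le_e : (size e <= nv)%N by rewrite -(addn0 (size e)).
  apply: spec_impl (spec_probe_atom _ fl _ le_e lt_e ha) => // s' /=.
  have sz : size [seq nth 0%N e j | j <- js] = size js by rewrite size_map.
  have := C_rel (k := k) hr _ (all_lookup js lt_e); rewrite sz => /(_ ha) hC.
  by rewrite ffunE hd_sethd [ct _]/= hC; case: (Y _ _).
- apply: (spec_Seq_det (IH _ _ _ _ _ _)) => //.
  apply: spec_If; rewrite /flag_on (flag_nonblank (b := fo_eval N x Y e g)) //.
  have := @spec_set_flag (eval_store e (fo_eval N x Y e g)) (~~ fo_eval N x Y e g) _ erefl erefl.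
  have -> : sethd (eval_store e (fo_eval N x Y e g)) tflag (flag_pos (~~ fo_eval N x Y e g)) =
     eval_store e (~~ fo_eval N x Y e g).
    by congr Store; apply/funext => t /=; case: eqP => [->|].
  by case: (fo_eval _ _ _ _ _).
- move: hdp ha hr; rewrite addn_maxr !geq_max => /andP[d1 d2] /andP[a1 a2] /andP[r1 r2].
  apply: (spec_Seq_det (IHg _ _ _ _ _ _)) => //.
  apply: spec_If; rewrite /flag_on (flag_nonblank (b := fo_eval N x Y e g)) //.
  case: (fo_eval N x Y e g) => /=; first exact: IHh.
  exact: spec_impl (spec_Skip _).
have lt_d : (size e < nv)%N by apply: leq_trans hdp; rewrite addnS ltnS leq_addr.
pose P v := fo_eval N x Y (v :: e) g.
have mv v b : sethd (eval_store (v :: e) b) (tvar_of (size e))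
    (ssrint.Posz v + 1) = eval_store (v.+1 :: e) b.
  by rewrite !eval_store_cons // sethd_sethd; congr sethd; lia.
have hdv v b : hd (eval_store (v :: e) b) (tvar_of (size e)) = v%:Z.
  by rewrite eval_store_cons // hd_sethd.
have rv v b : ruler (eval_store (v :: e) b) (tvar_of (size e)) N.
  by apply: ruler_short => //; apply: tvar_of_short.
set W := While _ _; set t := feval_time N g.
(* [n] counts the values still to be tried; [w] is where the loop stops, either the first
   counterexample or [N]. *)
have loop n v : (v + n = N)%N -> exists2 w, (w <= N)%N &
    spec W (eval_store (v :: e) true) (n * (t + 3) + (t + 5))%N
      (eq (eval_store (w :: e) (all P (iota v n)))).
  elim: n v => [|n IHn] v vn.
    exists v; first by lia.
    apply: spec_impl (spec_While_stop _ _) => [//|//|]; first by lia.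
    by rewrite (nonblankE (rv _ _)) hdv negb_and; apply/orP; right; lia.
  have test : flag_on (reads (eval_store (v :: e) true)) &&
      nonblank (tvar_of (size e)) (reads (eval_store (v :: e) true)).
    by rewrite /flag_on (flag_nonblank (b := true)) // (nonblankE (rv _ _)) hdv; lia.
  have hg := IH (v :: e) true; rewrite /= addSnnS in hg.
  have {}hg := hg hdp ha hr; rewrite lt_e andbT -/t in hg.
  have {}hg := hg ltac:(lia).
  rewrite /= -/(P v); move: hg; rewrite -/(P v).
  case Pv : (P v) => hg.
    have [w le_w hw] := IHn v.+1 ltac:(lia).
    exists w => //; have := spec_While_step test (spec_Seq_det hg
      (spec_If (b := flag_on) (B := Skip S tape_name) (t := 1) _)) hw.
    rewrite /flag_on (flag_nonblank (b := true)) // => H.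
    apply: spec_impl (H _) => //; first by lia.
    apply: spec_impl (spec_move_tape _ _ _) => // s'.
    by rewrite hdv mv.
  exists v; first by lia.
  have stop : spec W (eval_store (v :: e) false) 1 (eq (eval_store (v :: e) false)).
    apply: spec_While_stop; rewrite /flag_on (flag_nonblank (b := false)) //.
  have := spec_While_step test (spec_Seq_det hg
      (spec_If (b := flag_on) (A := move_tape S (tvar_of (size e)) MoveRight)
       (B := Skip S tape_name) (t := 0) _)) stop.
  rewrite /flag_on (flag_nonblank (b := false)) // => H.
  apply: spec_impl (H _) => //; first by lia.
  exact: spec_Skip.
have [w le_w hw] := loop N 0%N (add0n N).
rewrite -/t; apply: (spec_Seq_det (s1 := eval_store (0%N :: e) true)).
  apply: spec_impl (spec_set_flag true (b' := fl) _ _) => // s'.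
  rewrite eval_store_0 // (_ : sethd _ _ _ = eval_store e true) //.
  by congr Store; apply/funext => u /=; case: eqP => [->|].
apply: spec_Seq_det hw _.
apply: spec_impl (spec_rewind (rv _ _) _) => // [s'|].
  by rewrite eval_store_cons // sethd_sethd -eval_store_cons // eval_store_0.
by rewrite hdv; lia.
Qed.

End Layout.

(** * Guessing relations *)

Section Initialisation.
Variables (S T' : finType).
Notation T := (option T').
Notation cel := (cell S bool).
Notation store := (store S T').
Notation frag := (frag S T').
Implicit Types (s : store) (U : pred T).

Definition one : cel := Some (inr true).

Definition writer U : frag :=
  Act (fun r y => y = [ffun t => if U t then (one, MoveRight) else (r t, Stay)]).

Definition written U (m : nat) s : store :=
  Store (fun t => if U t then hd s t + m%:Z else hd s t)
    (fun t p => if U t && (hd s t <= p < hd s t + m%:Z) then one else ct s t p).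

Lemma spec_writer U s : spec (writer U) s 1 (eq (written U 1 s)).
Proof.
have e : act s [ffun t => if U t then (one, MoveRight) else (reads s t, Stay)] =
    written U 1 s.
  case: s => h c; congr Store; apply/funext => t; rewrite !ffunE /=.
    by case: (U t) => //=; rewrite addr0.
  apply/funext => p; case: (U t) => /=; last by case: eqP => [->|].
  by rewrite (_ : (p == h t) = (h t <= p < h t + 1)) //; lia.
apply: spec_impl (leqnn _) _ (spec_Act _ s) => s'; rewrite -e.
by split=> [[_ -> ->]|<-] //; eexists.
Qed.

Lemma written0 U s : written U 0 s = s.
Proof.
case: s => h c; congr Store; apply/funext => t /=; first by case: ifP; rewrite ?addr0.
by apply/funext => p; rewrite ifF //; lia.
Qed.

Lemma writtenD U m n s : written U (m + n)%N s = written U n (written U m s).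
Proof.
case: s => h c; congr Store; apply/funext => t /=; first by case: ifP; lia.
apply/funext => p; case: (U t) => //=.
rewrite PoszD addrA; case: ifP => h1; case: ifP => h2 //; first by rewrite ifT //; lia.
  by lia.
by rewrite ifF //; lia.
Qed.

Lemma written_sethd U m s t p : ~~ U t ->
  written U m (sethd s t p) = sethd (written U m s) t p.
Proof.
move=> /negbTE Ut; congr Store; apply/funext => u /=.
  by case: eqP => [->|]; rewrite ?Ut.
by apply/funext => q; case: eqP => [->|]; rewrite ?Ut.
Qed.

Lemma written_hd U m s t : ~~ U t -> hd (written U m s) t = hd s t.
Proof. by move=> /negbTE /= ->. Qed.

Lemma written_ct U m s t : ~~ U t -> ct (written U m s) t = ct s t.
Proof. by move=> /negbTE Ut; apply/funext => p /=; rewrite Ut. Qed.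

Definition rewinds (ts : seq T) : frag :=
  foldr (fun t c => Seq (rewind S t) c) (Skip S T') ts.

Lemma spec_rewinds ts s n :
  (forall t, t \in ts -> ruler s t n /\ 0 <= hd s t <= n%:Z) ->
  spec (rewinds ts) s (size ts * (2 * n + 3))%N
    (eq (Store (fun t => if t \in ts then 0 else hd s t) (ct s))).
Proof.
elim: ts s => [|t ts IH] s h /=; first by case: s h => hs cs _; exact: spec_Skip.
have [rt ht] := h t (mem_head _ _); rewrite mulSn.
apply: spec_Seq_det (spec_rewind rt ht) _.
apply: spec_impl (IH _ _) => // [s'|u uts].
  rewrite (_ : Store _ _ = Store (fun u => if u \in t :: ts then 0 else hd s u) (ct s)) //.
  by congr Store; apply/funext => u /=; rewrite inE; case: eqP => //= _; case: ifP.
have [|ru hu] := h u; first by rewrite inE uts orbT.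
by split=> //=; case: eqP => //; lia.
Qed.

Definition filled U (n : nat) s : store :=
  Store (hd s) (fun t p => if U t && (0 <= p < n%:Z) then one else ct s t p).

Lemma spec_fill U c k n s :
  (forall t, U t -> hd s t = 0 /\ forall p, ct s t p = None) ->
  spec c s k (eq (written U n s)) ->
  spec (Seq c (rewinds (enum U))) s (k + #|{: T}| * (2 * n + 3))%N (eq (filled U n s)).
Proof.
move=> hU hc; apply: spec_Seq_det hc _.
apply: spec_impl (spec_rewinds (n := n) _) => [|s'|t].
- by rewrite leq_mul2r -cardE max_card orbT.
- rewrite (_ : Store _ _ = filled U n s) //; congr Store; apply/funext => t /=.
    by rewrite mem_enum unfold_in; case Ut: (U t) => //; have [-> _] := hU t Ut.
  apply/funext => p; case Ut: (U t) => //=.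
  by have [-> _] := hU t Ut; rewrite add0r.
rewrite mem_enum unfold_in => Ut; have [h0 hN] := hU t Ut.
split; last by rewrite /= Ut h0; lia.
by move=> p; rewrite /= Ut h0 add0r /=; case: ifP; rewrite ?hN.
Qed.

Lemma filled_ruler U n s t :
  (forall p, ct s t p = None) -> U t -> ruler (filled U n s) t n.
Proof. by move=> hN Ut p; rewrite /= Ut /=; case: ifP; rewrite ?hN. Qed.

Lemma filled_out U n s t : ~~ U t -> ct (filled U n s) t = ct s t.
Proof. by move=> /negbTE Ut; apply/funext => p /=; rewrite Ut. Qed.

Lemma spec_While_choice I b (A : frag) s t1 t2 (F : I -> store) (Q : I -> store -> Prop) :
  (b (reads s) : bool) -> spec A s t1 (fun s1 => exists i, s1 = F i) ->
  (forall i, spec (While b A) (F i) t2 (Q i)) ->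
  spec (While b A) s (t1 + t2).+1 (fun s2 => exists i, Q i s2).
Proof.
move=> bs hA h.
have h' s1 : (exists i, s1 = F i) ->
    spec (While b A) s1 t2 (fun s2 => exists2 i, s1 = F i & Q i s2).
  move=> [i ->]; split=> [|s2 [j -> Qj]]; last by have [_] := h j; apply.
  have [+ _] := h i; apply: inevitable_impl => // d [? ?]; split=> //; by exists i.
apply: spec_impl (leqnn _) _ (spec_While_loop bs hA h') => s2; split.
  by move=> [s1 _ [i _ Qi]]; exists i.
by move=> [i Qi]; exists (F i); [exists i|exists i].
Qed.

Lemma spec_Seq_choice I (A B : frag) s t1 t2 (F : I -> store) (Q : I -> store -> Prop) :
  spec A s t1 (fun s1 => exists i, s1 = F i) ->
  (forall i, spec B (F i) t2 (Q i)) ->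
  spec (Seq A B) s (t1 + t2)%N (fun s2 => exists i, Q i s2).
Proof.
move=> hA h.
have h' s1 : (exists i, s1 = F i) ->
    spec B s1 t2 (fun s2 => exists2 i, s1 = F i & Q i s2).
  move=> [i ->]; split=> [|s2 [j -> Qj]]; last by have [_] := h j; apply.
  have [+ _] := h i; apply: inevitable_impl => // d [? ?]; split=> //; by exists i.
apply: spec_impl (leqnn _) _ (spec_Seq hA h') => s2; split.
  by move=> [s1 _ [i _ Qi]]; exists i.
by move=> [i Qi]; exists (F i); [exists i|exists i].
Qed.

Section Guess.
Variables (U : pred T) (l : T) (M : nat) (s : store).
Hypothesis lU : ~~ U l.
Hypothesis rl : ruler s l M.

Definition guess : frag :=
  Act (fun r y => exists g : T -> bool,
    y = [ffun t => if U t then (Some (inr (g t)), MoveRight) else (r t, Stay)]).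

Definition guessed (B : T -> nat -> bool) (m : nat) : store :=
  Store (fun t => if U t || (t == l) then m%:Z else hd s t)
    (fun t p => if U t then
       (if p is Posz n then if (n < m)%N then Some (inr (B t n)) else None else None)
     else ct s t p).

Definition guess_loop := While (nonblank l) (Seq guess (move_tape S l MoveRight)).

(** The results are exactly the completions of the [m] columns written so far; induction on the
    number [n] of missing columns. *)
Lemma spec_guess_loop n B m : (m + n = M)%N ->
  spec guess_loop (guessed B m) (n * 3 + 1)%N
    (fun s' => exists2 B', forall t i, (i < m)%N -> B' t i = B t i & s' = guessed B' M).
Proof.
have rg B' m' : ruler (guessed B' m') l M by move=> p; rewrite /= (negbTE lU).
have hl B' m' : hd (guessed B' m') l = m'%:Z by rewrite /= eqxx orbT.
elim: n B m => [|n IH] B m mn.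
  rewrite addn0 in mn; subst M.
  apply: spec_impl (leqnn _) _ (spec_While_stop _ _) => [s'|]; last first.
    by rewrite (nonblankE (rg _ _)) hl; lia.
  split=> [<-|[B' BB' ->]]; first by exists B.
  congr Store; apply/funext => t /=; apply/funext => -[p|p] //.
  by case: ifP => // _; case: ifP => // /BB' ->.
pose ext (g : T -> bool) t i := if i == m then g t else B t i.
have h1 : spec (Seq guess (move_tape S l MoveRight)) (guessed B m) 2
   (fun s1 => exists g, s1 = guessed (ext g) m.+1).
  have ha : spec guess (guessed B m) 1
      (fun s1 => exists g, s1 = sethd (guessed (ext g) m.+1) l m%:Z).
    apply: spec_impl (leqnn _) _ (spec_Act _ _) => s1.
    have e g : act (guessed B m) [ffun t => if U t then (Some (inr (g t)), MoveRight)
        else (reads (guessed B m) t, Stay)] = sethd (guessed (ext g) m.+1) l m%:Z.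
      congr Store; apply/funext => t; rewrite !ffunE /=.
        case: eqP => [->|_]; first by rewrite (negbTE lU) orbT /= addr0.
        by rewrite !orbF; case: (U t); rewrite /= ?addr0 //; lia.
      apply/funext => p; case Ut: (U t) => /=; last by case: eqP => [->|].
      case: p => [p|p] /=; last by [].
      by rewrite /ext eqz_nat ltnS; case: ltngtP.
    by split=> [[y [g ->] ->]|[g ->]]; [exists g|rewrite -e; eexists; first by exists g].
  have := spec_Seq_choice ha (fun g => spec_move_tape l MoveRight _).
  apply: spec_impl => // s1.
  have e g : sethd (sethd (guessed (ext g) m.+1) l m%:Z) l
     (hd (sethd (guessed (ext g) m.+1) l m%:Z) l + offset MoveRight) = guessed (ext g) m.+1.
    by rewrite hd_sethd sethd_sethd sethd_id // hl /=; lia.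
  by split=> -[g]; [rewrite e => <-|move=> ->; exists g; rewrite e]; [exists g|].
have test : nonblank l (reads (guessed B m)).
  by rewrite (nonblankE (rg _ _)) hl; lia.
apply: spec_impl (spec_While_choice test h1 (fun g => IH (ext g) m.+1 _)) => [|s'|].
- by lia.
- split=> [[g [B' h ->]]|[B' h ->]].
    exists B' => // t i lt_i; rewrite h; last by lia.
    by rewrite /ext ifF //; lia.
  (* The column to guess in this round is read off the intended final table. *)
  exists (B' ^~ m), B' => // t i; rewrite ltnS /ext.
  by case: ltngtP => // [lt _|-> //]; apply: h.
by lia.
Qed.

End Guess.
End Initialisation.

(** * Polynomial running times *)

Definition poly_bounded (f : nat -> nat) :=
  exists p : {poly nat}, forall n, (f n <= p.[n])%N.

Lemma poly_bounded_const c : poly_bounded (fun=> c).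
Proof. by exists c%:P => n; rewrite hornerC. Qed.

Lemma poly_bounded_id : poly_bounded id.
Proof. by exists 'X => n; rewrite hornerX. Qed.

Lemma poly_boundedD f g : poly_bounded f -> poly_bounded g ->
  poly_bounded (fun n => f n + g n)%N.
Proof.
move=> [p hp] [q hq]; exists (p + q) => n.
by rewrite hornerD leq_add.
Qed.

Lemma poly_boundedM f g : poly_bounded f -> poly_bounded g ->
  poly_bounded (fun n => f n * g n)%N.
Proof.
move=> [p hp] [q hq]; exists (p * q) => n.
by rewrite hornerM leq_mul.
Qed.

Lemma poly_boundedX f k : poly_bounded f -> poly_bounded (fun n => f n ^ k)%N.
Proof.
move=> hf; elim: k => [|k IH]; first exact: poly_bounded_const.
have [p hp] := poly_boundedM hf IH; exists p => n; rewrite expnS; exact: hp.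
Qed.

Lemma poly_boundedS f : poly_bounded f -> poly_bounded (fun n => (f n).+1).
Proof.
by move=> [p hp]; exists (1%:P + p) => n; rewrite hornerD hornerC; apply: hp.
Qed.

Ltac poly_bounded := repeat first
  [ exact: poly_bounded_id | exact: poly_bounded_const | assumption
  | apply: poly_boundedS | apply: poly_boundedD | apply: poly_boundedM
  | apply: poly_boundedX ].

Lemma poly_bounded_loop_time f g k : poly_bounded f -> poly_bounded g ->
  poly_bounded (fun n => loop_time (f n) (g n) k).
Proof. by move=> hf hg; elim: k => [//|k IH] /=; poly_bounded. Qed.

Lemma poly_bounded_walk_time f j k : poly_bounded f ->
  poly_bounded (fun n => walk_time (f n) j k).
Proof.
move=> hf; elim: k j => [|k IH] j /=; poly_bounded; last exact: IH.
exact: poly_bounded_loop_time (poly_bounded_const 1).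
Qed.

Lemma poly_bounded_feval_time (S : finType) f (g : formula S) : poly_bounded f ->
  poly_bounded (fun n => feval_time (f n) g).
Proof.
move=> hf; have hw := poly_bounded_walk_time _ _ hf.
elim: g => [s i|i j|k js|g IH|g IHg h IHh|g IH] /=; poly_bounded; exact: hw.
Qed.

(** * The solver of an existential second-order formula *)

Section Solver.
Variables (S : finType) (k : nat) (f : formula S).

Let nv := form_depth f.
Let nl := (form_arity f).+1.
Let nr := form_rels f.
Let T' := tape_name k nv nl nr.
Notation T := (option T').

Definition bases : seq T := [seq tbase nv nl nr i | i <- enum 'I_k].

(* A false formula leads to [Act] without transitions, stuck in a state which is
   not the exit. *)
Definition solver : frag S T' :=
  Seq (Seq (Seq (loop_ruler None (writer S (@is_base k nv nl nr)))
             (Seq (writer S (@is_base k nv nl nr)) (writer S (@is_base k nv nl nr))))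
         (rewinds S (enum (@is_base k nv nl nr))))
 (Seq (Seq (loop_rulers bases (writer S (@is_short k nv nl nr)))
         (rewinds S (enum (@is_short k nv nl nr))))
 (Seq (Seq (loop_rulers (loops k nv nl nr) (writer S (@is_long k nv nl nr)))
         (rewinds S (enum (@is_long k nv nl nr))))
 (Seq (Seq (guess_loop S (@is_rel k nv nl nr) (tlong k nv nl nr))
        (Seq (rewinds S [:: tlong k nv nl nr]) (rewinds S (enum (@is_rel k nv nl nr)))))
 (Seq (feval k nv nl nr 0 f)
   (If (@flag_on S k nv nl nr) (Skip S T') (Act (fun _ _ => False))))))).

Definition solver_time (n : nat) : nat :=
  let c := #|{: T}| in let N := ((n + 2) ^ k)%N in
  (n * 3 + 1 + (2 * n + 3) + (1 + 1) + c * (2 * (n + 2) + 3)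
   + (loop_time (n + 2) 1 k + c * (2 * N + 3)
   + (loop_time N 1 nl + c * (2 * N ^ nl + 3)
   + (N ^ nl * 3 + 1 + (1 * (2 * N ^ nl + 3) + c * (2 * N ^ nl + 3))
   + (feval_time N f + 2)))))%N.

Lemma poly_bounded_solver_time : poly_bounded solver_time.
Proof.
rewrite /solver_time; have h : poly_bounded (fun n => (n + 2) ^ k)%N by poly_bounded.
poly_bounded; try exact: poly_bounded_feval_time.
  by apply: poly_bounded_loop_time; poly_bounded.
by apply: poly_bounded_loop_time; poly_bounded.
Qed.

Variable x : seq S.
Let N := ((size x + 2) ^ k)%N.

Fixpoint tuple_of_index (n a : nat) : seq nat :=
  if a is a'.+1 then (n %% N)%N :: tuple_of_index (n %/ N)%N a' else [::].

Lemma N_gt0 : (0 < N)%N. Proof. by rewrite expn_gt0 addn2. Qed.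

Lemma tuple_indexK a : all (fun v => v < N)%N a ->
  tuple_of_index (tuple_index N a) (size a) = a.
Proof.
elim: a => //= v a IH /andP[lt_v lt_a].
rewrite addnC mulnC modnMDl modn_small // divnMDl ?N_gt0 //.
by rewrite divn_small // addn0 IH.
Qed.

Definition guess_rel (B : T -> nat -> bool) (j : nat) (a : seq nat) : bool :=
  B (trel k nv (inord j, inord (size a))) (tuple_index N a).

Lemma spec_solver :
  exists final : (T -> nat -> bool) -> store S T',
  spec solver (init_store T' x) (solver_time (size x))
    (fun s => exists B, fo_eval N x (guess_rel B) [::] f /\ s = final B).
Proof.
set s0 := init_store T' x.
(* Lengths grow in three stages: the input is measured by rulers of length [size x + 2], [k] nested
   loops over these give length [N], and [nl] nested loops over rulers of length [N] give [N ^ nl],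
   enough for every table. *)
pose s1 := filled (@is_base k nv nl nr) (size x + 2) s0.
pose s2 := filled (@is_short k nv nl nr) N s1.
pose s3 := filled (@is_long k nv nl nr) (N ^ nl) s2.
have h1 : spec (Seq (Seq (loop_ruler None (writer S (@is_base k nv nl nr)))
             (Seq (writer S (@is_base k nv nl nr)) (writer S (@is_base k nv nl nr))))
         (rewinds S (enum (@is_base k nv nl nr)))) s0
     (size x * 3 + 1 + (2 * size x + 3) + (1 + 1) + #|{: T}| * (2 * (size x + 2) + 3))%N
     (eq s1).
  apply: spec_fill => [[t|]|] //.
  rewrite writtenD; apply: (spec_Seq_det (s1 := written (@is_base k nv nl nr) (size x) s0)).
    rewrite -[X in written _ X s0]muln1.
    apply: (spec_loop_ruler (L := predC (@is_base k nv nl nr))) => //.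
    - exact: written0.
    - exact: writtenD.
    - by move=> *; apply: written_sethd.
    - by move=> *; apply: written_hd.
    - by move=> *; apply: written_ct.
    - by move=> [p|p] //=; rewrite ltz_nat -onthTE; case: onth.
    by move=> i p; apply: spec_writer.
  rewrite (writtenD _ 1 1); apply: spec_Seq_det (spec_writer _ _) (spec_writer _ _).
have z1 t : hd s1 t = 0 by [].
have c1 t : ~~ is_base t -> ct s1 t = ct s0 t by apply: filled_out.
have h2 : spec (Seq (loop_rulers bases (writer S (@is_short k nv nl nr)))
         (rewinds S (enum (@is_short k nv nl nr)))) s1
     (loop_time (size x + 2) 1 k + #|{: T}| * (2 * N + 3))%N (eq s2).
  apply: spec_fill => [t st|].
    split=> // p; rewrite c1; first by case: t st => // -[].
    by case/and4P: st.
  have sb : size bases = k by rewrite size_map size_enum_ord.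
  have bb t : t \in bases -> is_base t by case/mapP=> i _ ->.
  have bs t : is_base t -> ~~ is_short t by move=> h; rewrite /is_short h.
  have : spec (loop_rulers bases (writer S (@is_short k nv nl nr))) s1
      (loop_time (size x + 2) 1 (size bases))
      (eq (written (@is_short k nv nl nr) ((size x + 2) ^ size bases * 1)%N s1)); last first.
    by rewrite sb muln1.
  apply: (spec_loop_rulers (L := predC (@is_short k nv nl nr))) => //.
  - exact: written0.
  - exact: writtenD.
  - by move=> *; apply: written_sethd.
  - by move=> *; apply: written_hd.
  - by move=> *; apply: written_ct.
  - by apply/allP => t /bb/bs.
  - by rewrite map_inj_uniq ?enum_uniq // => ? ? [].
  - move=> t /bb bt; split=> //; apply: filled_ruler => // p.
    by case: t bt.
  by move=> s'; apply: spec_writer.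
have z2 t : hd s2 t = 0 by [].
have c2 t : ~~ is_short t -> ct s2 t = ct s1 t by apply: filled_out.
have short2 t : is_short t -> ruler s2 t N.
  move=> st; apply: filled_ruler => // p; rewrite c1; first by case: t st => // -[].
  by case/and4P: st.
have h3 : spec (Seq (loop_rulers (loops k nv nl nr) (writer S (@is_long k nv nl nr)))
         (rewinds S (enum (@is_long k nv nl nr)))) s2
     (loop_time N 1 nl + #|{: T}| * (2 * N ^ nl + 3))%N (eq s3).
  apply: spec_fill => [t /eqP -> //|].
  have sb : size (loops k nv nl nr) = nl by rewrite size_map size_enum_ord.
  have bb t : t \in loops k nv nl nr -> ~~ is_long t by case/mapP=> i _ ->.
  have : spec (loop_rulers (loops k nv nl nr) (writer S (@is_long k nv nl nr))) s2
      (loop_time N 1 (size (loops k nv nl nr)))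
      (eq (written (@is_long k nv nl nr) (N ^ size (loops k nv nl nr) * 1)%N s2)); last first.
    by rewrite sb muln1.
  apply: (spec_loop_rulers (L := predC (@is_long k nv nl nr))) => //.
  - exact: written0.
  - exact: writtenD.
  - by move=> *; apply: written_sethd.
  - by move=> *; apply: written_hd.
  - by move=> *; apply: written_ct.
  - by apply/allP => t /bb.
  - by rewrite map_inj_uniq ?enum_uniq // => ? ? [].
  - by move=> t bt; split=> //; apply: short2; apply: loops_short bt.
  by move=> s'; apply: spec_writer.
have long3 : ruler s3 (tlong k nv nl nr) (N ^ nl).
  by apply: filled_ruler => [p|]; rewrite ?/is_long.
have c3 t : ~~ is_long t -> ct s3 t = ct s2 t by apply: filled_out.
pose U := @is_rel k nv nl nr; pose M := (N ^ nl)%N.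
have lU : ~~ U (tlong k nv nl nr) by [].
pose s4 B := Store (fun=> 0) (ct (guessed U (tlong k nv nl nr) s3 B M)).
have h4 : spec (Seq (guess_loop S U (tlong k nv nl nr))
        (Seq (rewinds S [:: tlong k nv nl nr]) (rewinds S (enum U)))) s3
     (M * 3 + 1 + (1 * (2 * M + 3) + #|{: T}| * (2 * M + 3)))%N
     (fun s => exists B, s4 B = s).
  have g0 : guessed U (tlong k nv nl nr) s3 (fun _ _ => false) 0 = s3.
    congr Store; apply/funext => t /=; first by case: ifP.
    apply/funext => p; case Ut: (U t); last by [].
    by case: t Ut => [[[[[?|?]|?]|?]|?]|] //; case: p.
  rewrite -{1}g0; have := spec_Seq_choice (F := fun B => guessed U (tlong k nv nl nr) s3 B M)
    (t2 := (1 * (2 * M + 3) + #|{: T}| * (2 * M + 3))%N) _ (Q := fun B s => s4 B = s).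
  apply.
    apply: spec_impl (spec_guess_loop lU long3 (n := M) _ _) => // s'.
    by split=> [[B _ ->]|[B ->]]; exists B.
  move=> B.
  have rl : ruler (guessed U (tlong k nv nl nr) s3 B M) (tlong k nv nl nr) M.
    by move=> p; rewrite /= long3.
  apply: spec_Seq_det (spec_rewinds (n := M) _) _.
    by move=> t; rewrite inE => /eqP ->; split=> //=; lia.
  apply: spec_impl (spec_rewinds (n := M) _) => [|s'|t].
  - by rewrite leq_mul2r -cardE max_card orbT.
  - rewrite (_ : Store _ _ = s4 B) //; congr Store; apply/funext => t.
    by case: t => [[[[[i|i]|i]|i]|i]|]; rewrite /= mem_enum unfold_in ?inE //=; case: eqP.
  rewrite mem_enum unfold_in; case: t => [[[[[i|i]|i]|i]|i]|] // _; split.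
    by move=> [p|p] //=; case: ifP.
  by rewrite /= ?inE /=; lia.
pose C B := ct (s4 B).
have shortC B t p : is_short t -> (C B t p != None) = (0 <= p < N%:Z).
  move=> st; have -> : C B t p = ct s3 t p.
    by case: t st => [[[[[i|i]|i]|i]|i]|].
  by rewrite c3 ?short2 //; case/and4P: st.
exists (fun B => eval_store (C B) [::] true).
have h5 B : spec (Seq (feval k nv nl nr 0 f)
     (If (@flag_on S k nv nl nr) (Skip S T') (Act (fun _ _ => False)))) (s4 B)
     (feval_time N f + 2)%N (fun s => fo_eval N x (guess_rel B) [::] f /\
                                s = eval_store (C B) [::] true).
  have e4 : s4 B = eval_store (C B) [::] true.
    congr Store; apply/funext => -[[[[[i|i]|i]|i]|i]|] //=; first by rewrite nth_nil.
    by case: ifP.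
  rewrite e4.
  have inC (n : nat) : C B None n%:Z = omap inl (onth x n) by [].
  have relC j a : (j <= nr)%N -> (size a <= nl)%N -> all (fun v => v < N)%N a ->
      C B (trel k nv (inord j, inord (size a))) (tuple_index N a)%:Z =
      Some (inr (guess_rel B j a)).
    move=> _ ha lt_a; have lt_M : (tuple_index N a < M)%N.
      have h := tuple_index_lt lt_a; apply: leq_trans h _.
      by rewrite leq_pexp2l ?N_gt0.
    have -> : C B (trel k nv (inord j, inord (size a))) (tuple_index N a)%:Z =
      if (tuple_index N a < M)%N then Some (inr (guess_rel B j a)) else None by [].
    by rewrite lt_M.
  apply: spec_Seq_det (spec_feval N_gt0 (shortC B) inC relC _ (e := [::]) true _ _ _ _) _.
  - by [].
  - by [].
  - exact: leqnSn.
  - exact: leqnSn.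
  - by [].
  apply: spec_If; rewrite /flag_on (flag_nonblank N_gt0 (shortC B) (b := fo_eval N x (guess_rel B) [::] f)) //.
  case: fo_eval.
    by apply: spec_impl (spec_Skip _) => // s'; split=> [<-|[]].
  apply: spec_impl (spec_Act _ _) => // s'; by split=> [[]|[]].
apply: spec_impl (leqnn _) _ (spec_Seq_det h1 (spec_Seq_det h2 (spec_Seq_det h3
  (spec_Seq_choice (F := s4) _ h5)))) => [s'|]; last first.
  by apply: spec_impl h4 => // s'; split=> -[B e]; exists B.
by [].
Qed.
End Solver.

(** The exponent [k] is free, so that the domain may be polynomially larger than the input. Although
    [Y] interprets infinitely many symbols and arities, [f] inspects only the part that the tables
    record. *)
Theorem eso_in_NP (S : finType) (k : nat) (f : formula S) (L : seq S -> Prop) :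
  (forall x, L x <-> exists Y, fo_eval ((size x + 2) ^ k) x Y [::] f) -> in_NP L.
Proof.
move=> hL; have [p hp] := poly_bounded_solver_time k f.
apply: (@spec_in_NP S _ (solver k f) L p) => x.
have [final h] := spec_solver k f x.
eexists; split; first exact: (spec_impl (hp _) (fun s => iff_refl _) h).
rewrite hL; split=> [[Y hY]|[s [B [hB _]]]]; last by exists (guess_rel x B).
(* The guess that records a given [Y], cell numbers being decoded into tuples. *)
pose B (t : option (tape_name k (form_depth f) (form_arity f).+1 (form_rels f))) n :=
  if t is Some (inr (j, a)) then Y (j : nat) (tuple_of_index k x n a) else false.
eexists; exists B; split; last by reflexivity.
rewrite (@fo_eval_ext _ _ _ _ Y) //; last exact: N_gt0.
move=> j a hj ha lt_a; rewrite /guess_rel /= !inordK ?ltnS //; last first.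
- exact: ltnW.
- exact: leqW.
by rewrite tuple_indexK.
Qed.

(** * Payoffs of ultimately periodic paths *)

Import numFieldNormedType.Exports.
Local Open Scope classical_set_scope.
Local Open Scope ring_scope.

Definition periodic_from (T : Type) (k p : nat) (pi : nat -> T) :=
  forall i, (k <= i)%N -> pi (i + p)%N = pi i.

Lemma periodic_fromM T k p (pi : nat -> T) i j : periodic_from k p pi ->
  (k <= i)%N -> pi (i + j * p)%N = pi i.
Proof.
move=> h le_i; elim: j => [|j IH]; first by rewrite addn0.
by rewrite mulSn addnCA addnC h ?IH // (leq_trans le_i) // leq_addr.
Qed.

Lemma periodic_from_mod T k p (pi : nat -> T) i : periodic_from k p pi ->
  pi (k + i)%N = pi (k + i %% p)%N.
Proof.
move=> h; rewrite {1}(divn_eq i p) addnCA addnC (periodic_fromM _ h) //.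
exact: leq_addr.
Qed.

Lemma ultimately_periodicP T (pi : nat -> T) :
  ultimately_periodic pi <-> exists k p, (0 < p)%N /\ periodic_from k p pi.
Proof.
split=> [[x0 [u [v [v0 h]]]]|[k [p [p0 h]]]].
  exists (size u), (size v); split=> // i le_i; rewrite !h !ifF; try by lia.
  by rewrite -addnBAC // modnDr.
exists (pi 0%N), (mkseq pi k), (mkseq (fun i => pi (k + i)%N) p).
rewrite !size_mkseq; split=> // i; case: ltnP => [lt_i|ge_i].
  by rewrite nth_mkseq.
by rewrite nth_mkseq ?ltn_pmod // -periodic_from_mod // subnKC.
Qed.

Section Average.
Variables (R : realType) (f : nat -> R) (k p : nat).
Hypotheses (p_gt0 : (0 < p)%N) (fp : periodic_from k p f).
Let W : R := \sum_(0 <= j < p) f (k + j)%N.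

Lemma sum_period n : (k <= n)%N -> \sum_(n <= j < n + p) f j = W.
Proof.
elim: n => [|n IH] le_n.
  by move: le_n fp; rewrite leqn0 => /eqP k0 _; rewrite /W k0; apply: eq_bigr.
move: le_n; rewrite leq_eqVlt => /orP[/eqP <-|le_n].
  rewrite /W -{1}[k]add0n big_addn addKn; apply: eq_bigr => j _.
  by rewrite addnC.
rewrite -(IH le_n) addSn big_nat_recr /=; last by lia.
rewrite fp // [RHS]big_ltn; last by lia.
by rewrite addrC.
Qed.

Let D n : R := \sum_(0 <= j < n) f j - n%:R * (W / p%:R).

(** The deviation [D] of the partial sums from linear growth is periodic from [k] on, so its first
    [k + p] values bound it. *)
Lemma average_error_bound : exists C : R, forall n, `|D n| <= C.
Proof.
have p0 : p%:R != 0 :> R by rewrite pnatr_eq0 -lt0n.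
have Dp n : (k <= n)%N -> D (n + p) = D n.
  move=> le_n; rewrite /D (big_cat_nat (n := n)) ?leq_addr //= sum_period // natrD mulrDl.
  by rewrite [p%:R * _]mulrC divfK //; ring.
exists (\sum_(j < k + p) `|D j|) => n.
elim/ltn_ind: n => n IH; have [lt_n|ge_n] := ltnP n (k + p)%N.
  rewrite (bigD1 (Ordinal lt_n)) //= lerDl sumr_ge0 // => i _; exact: normr_ge0.
have -> : D n = D (n - p)%N by rewrite -{1}(subnK (leq_trans (leq_addl k p) ge_n)) Dp //; lia.
by apply: IH; lia.
Qed.

Lemma cvg_average :
  (fun n : nat => n%:R^-1 * \sum_(0 <= j < n) f j) @ \oo --> W / p%:R.
Proof.
have [C hC] := average_error_bound.
(* The shift avoids the inverse of 0; the average then differs from its limit by at most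
   [C * harmonic n]. *)
rewrite -(cvg_shiftS (fun n : nat => n%:R^-1 * \sum_(0 <= j < n) f j)).
have cC : (fun n => C * harmonic n) @ \oo --> (0 : R).
  by rewrite -[X in _ --> X](mulr0 C); apply: cvgMr cvg_harmonic.
have lo : (fun n => W / p%:R - C * harmonic n) @ \oo --> W / p%:R.
  by rewrite -[X in _ --> X]subr0; apply: cvgB cC; apply: cvg_cst.
have hi : (fun n => W / p%:R + C * harmonic n) @ \oo --> W / p%:R.
  by rewrite -[X in _ --> X]addr0; apply: cvgD cC; apply: cvg_cst.
apply: squeeze_cvgr lo hi; apply: nearW => n.
have n0 : 0 < n.+1%:R :> R by rewrite ltr0n.
rewrite /harmonic /= -ler_distl.
have -> : n.+1%:R^-1 * \sum_(0 <= j < n.+1) f j - W / p%:R = n.+1%:R^-1 * D n.+1.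
  by rewrite /D mulrBr mulKf // gt_eqF.
by rewrite normrM [`|n.+1%:R^-1|]gtr0_norm ?invr_gt0 // mulrC ler_pM2r ?invr_gt0 //; apply: hC.
Qed.

End Average.

Section Payoff.
Variables (R : realType) (V A : finType) (G : mwgraph V A).
Variables (pi : nat -> V) (k p : nat).
Hypotheses (p_gt0 : (0 < p)%N) (pip : periodic_from k p pi).

Definition visits (u : V) : nat := \sum_(j < p) (pi (k + j)%N == u).

Lemma visits_gt0 u : (0 < visits u)%N <-> exists2 j, (j < p)%N & pi (k + j)%N = u.
Proof.
rewrite lt0n sum_nat_eq0 negb_forall; split=> [/existsP[j]|[j lt_j e]].
  by rewrite /= eqb0 negbK => /eqP e; exists j.
by apply/existsP; exists (Ordinal lt_j); rewrite /= e eqxx.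
Qed.

Lemma sum_visits (Z : zmodType) (f : V -> Z) :
  \sum_(0 <= j < p) f (pi (k + j)%N) = \sum_u f u *+ visits u.
Proof.
rewrite big_mkord; under [RHS]eq_bigr do rewrite /visits -sumrMnr.
rewrite exchange_big; apply: eq_bigr => j _ /=.
rewrite (bigD1 (pi (k + j)%N)) //= eqxx mulr1n big1 ?addr0 // => u ne_u.
by rewrite eq_sym (negbTE ne_u) mulr0n.
Qed.

Lemma infinitely_often_visits a c :
  infinitely_often (prio G a \o pi) c <-> exists2 u, (0 < visits u)%N & prio G a u = c.
Proof.
split=> [/(_ k)[n [le_n <-]]|[u /visits_gt0[j lt_j <-] <-] n].
  exists (pi n) => //; apply/visits_gt0; exists ((n - k) %% p)%N; rewrite ?ltn_pmod //.
  by rewrite -(periodic_from_mod _ pip) subnKC.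
exists (k + j + n * p)%N; split=> /=; last by rewrite (periodic_fromM _ pip) ?leq_addr.
by rewrite (leq_trans (leq_pmulr n p_gt0)) // leq_addl.
Qed.

(** Stated for arbitrary counts, so as to apply both to the visits of a path and to the outflow of a
    circulation. Only the support of [out] matters. *)
Definition top_even (out : V -> nat) (a : A) : bool :=
  [exists u, [&& (0 < out u)%N, (2 %| prio G a u)%Z &
    [forall u', (0 < out u')%N ==> (prio G a u' <= prio G a u)]]].

Lemma parity_visits a : parity G a pi = top_even visits a.
Proof.
apply/asboolP/existsP => [[c [/infinitely_often_visits[u u0 <-] h ev]]|[u /and3P[u0 ev /forallP h]]].
  exists u; rewrite u0 ev; apply/forallP => u'; apply/implyP => u0'.
  by apply: h; apply/infinitely_often_visits; exists u'.
exists (prio G a u); split=> //; first by apply/infinitely_often_visits; exists u.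
by move=> _ /infinitely_often_visits[u' u0' <-]; have := h u'; rewrite u0'.
Qed.

Lemma mean_payoff_visits a : mean_payoff R G a pi =
  (\sum_u weight G a u *+ visits u)%:~R / p%:R.
Proof.
rewrite /mean_payoff.
have fp : periodic_from k p (fun j => (weight G a (pi j))%:~R : R).
  by move=> i le_i /=; rewrite pip.
have [-> _] := cvg_limn_inf_sup (cvg_average p_gt0 fp).
by rewrite -sum_visits rmorph_sum.
Qed.

(** Multiplying by the period and the denominator turns the comparison of reals into one of
    integers. The period is itself the sum of all visits, so the threshold becomes linear in them
    too. *)
Lemma lex_lt_visits a b (q : int * nat) : (0 < q.2)%N ->
  lex_lt (b, q.1%:~R / q.2%:R) (pay R G a pi) =
  (~~ b && top_even visits a) ||
  ((b == top_even visits a) &&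
   (0 < \sum_u (weight G a u * q.2%:Z - q.1) * (visits u)%:Z)).
Proof.
move=> q0; rewrite /lex_lt /= parity_visits mean_payoff_visits; congr (_ || (_ && _)).
have ep : (\sum_u visits u = p)%N.
  rewrite exchange_big /= -[RHS]card_ord -sum1_card; apply: eq_bigr => j _.
  by rewrite (bigD1 (pi (k + j)%N)) //= eqxx big1 // => u ne_u; rewrite eq_sym (negbTE ne_u).
rewrite ltr_pdivrMr ?ltr0n // mulrAC ltr_pdivlMr ?ltr0n //.
rewrite -[p%:R]/(p%:R : R) (pmulrn _ p) (pmulrn _ q.2) -!rmorphM /= ltr_int -subr_gt0.
congr (0 < _).
have -> : p%:Z = \sum_u (visits u)%:Z.
  by rewrite -[in LHS]ep; apply: (big_morph Posz PoszD).
rewrite mulr_suml mulr_sumr -sumrB; apply: eq_bigr => u _.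
by rewrite -mulr_natr natz; ring.
Qed.

End Payoff.

(** * Small solutions of integral linear systems *)

Local Close Scope classical_set_scope.

Lemma det_bound k (M : 'M[int]_k) (C : int) : 0 <= C ->
  (forall i j, `|M i j| <= C) -> `|\det M| <= k`!%:R * C ^+ k.
Proof.
move=> C0 hM; rewrite /determinant; apply: le_trans (ler_norm_sum _ _ _) _.
have -> : k`!%:R * C ^+ k = \sum_(s : 'S_k) C ^+ k.
  by rewrite sumr_const card_Sn mulr_natl.
apply: ler_sum => s _; rewrite normrM normrX normrN1 expr1n mul1r normr_prod.
rewrite -[X in _ <= C ^+ X]card_ord -prodr_const; apply: ler_prod => i _.
by rewrite normr_ge0 hM.
Qed.

(** By Cramer's rule these entries are determinants of [M] with one column replaced by [v], whence
    the same bound as in [det_bound]; the proof expands along that column. *)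
Lemma adj_bound k (M : 'M[int]_k) (v : 'cV[int]_k) (C : int) : 0 <= C ->
  (forall i j, `|M i j| <= C) -> (forall i, `|v i 0| <= C) ->
  forall i, `|(\adj M *m v) i 0| <= k`!%:R * C ^+ k.
Proof.
case: k M v => [|k] M v C0 hM hv i; first by case: i.
rewrite mxE; apply: le_trans (ler_norm_sum _ _ _) _.
have -> : k.+1`!%:R * C ^+ k.+1 = \sum_(j < k.+1) (k`!%:R * C ^+ k * C).
  by rewrite sumr_const card_ord -mulr_natl factS natrM exprS; ring.
apply: ler_sum => j _; rewrite normrM ler_pM // mxE /cofactor normrM normrX normrN1 expr1n mul1r.
by apply: det_bound => // a b; rewrite !mxE.
Qed.

Section BasicSolution.
Variables (m n : nat) (A : 'M[rat]_(m, n)) (b : 'cV[rat]_m).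

Definition nonneg_solution (z : 'cV[rat]_n) := A *m z = b /\ forall j, 0 <= z j 0.

Definition support_of (z : 'cV[rat]_n) : {set 'I_n} := [set j | z j 0 != 0].

(** Moving [z] along the kernel direction [d], or [- d], keeps the equations and stays inside the
    support until a coordinate reaches 0. *)
Lemma shrink_support (z d : 'cV[rat]_n) : nonneg_solution z -> A *m d = 0 ->
  (forall j, z j 0 = 0 -> d j 0 = 0) -> d != 0 ->
  exists2 z', nonneg_solution z' & (#|support_of z'| < #|support_of z|)%N.
Proof.
move=> [Az z0] Ad sd nd.
have pos (d' : 'cV[rat]_n) j1 : 0 < d' j1 0 -> A *m d' = 0 ->
    (forall j, z j 0 = 0 -> d' j 0 = 0) ->
    exists2 z', nonneg_solution z' & (#|support_of z'| < #|support_of z|)%N.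
  move=> dj1 Ad' sd'.
  (* Ratio test: the minimal ratio is the largest multiple of [d'] that can be subtracted with all
     coordinates remaining nonnegative, and it annihilates coordinate [j0]. *)
  pose j0 := [arg min_(j < j1 | 0 < d' j 0) (z j 0 / d' j 0)]%O.
  have [dj0 min_j0] : 0 < d' j0 0 /\ forall j, 0 < d' j 0 -> z j0 0 / d' j0 0 <= z j 0 / d' j 0.
    by rewrite /j0; case: arg_minP.
  pose t := z j0 0 / d' j0 0.
  have t0 : 0 <= t by rewrite divr_ge0 // ltW.
  exists (z - t *: d').
    split=> [|j]; first by rewrite mulmxBr -scalemxAr Ad' scaler0 subr0.
    rewrite !mxE subr_ge0; have [dj|dj] := ltP 0 (d' j 0).
      by rewrite -ler_pdivlMr //; apply: min_j0.
    by apply: le_trans (z0 j); rewrite mulr_ge0_le0.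
  apply: proper_card; apply/fintype.properP; split.
    apply/fintype.subsetP => j; rewrite !inE !mxE; apply: contra => /eqP zj.
    by rewrite zj sd' // mulr0 subr0.
  exists j0; rewrite !inE ?mxE; last by rewrite negbK /t divfK ?subrr // gt_eqF.
  by apply: contraTneq dj0 => /sd' ->; rewrite ltxx.
have [j dj] : exists j, d j 0 != 0.
  apply/existsP; apply: contraR nd; rewrite negb_exists => /forallP h.
  by apply/eqP/matrixP => j k; rewrite (ord1 k) mxE; apply/eqP; rewrite -[_ == _]negbK h.
have [lt|gt|e] := ltgtP (d j 0) 0; last by rewrite e eqxx in dj.
  apply: (pos (- d) j); rewrite ?mxE ?oppr_gt0 // ?mulmxN ?Ad ?oppr0 // => i /sd.
  by rewrite mxE => ->; rewrite oppr0.
exact: (pos d j).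
Qed.

(** The conclusion says that the columns of [A] in the support of [z'] are linearly independent. A
    dependency among them would allow the support to shrink further. *)
Lemma basic_solution (z : 'cV[rat]_n) : nonneg_solution z ->
  exists2 z', nonneg_solution z' &
    forall d : 'cV_n, A *m d = 0 -> (forall j, z' j 0 = 0 -> d j 0 = 0) -> d = 0.
Proof.
have [k] := ubnP #|support_of z|; elim: k z => // k IH z lt_k sol.
have [h|h] := boolP `[< forall d : 'cV_n, A *m d = 0 -> (forall j, z j 0 = 0 -> d j 0 = 0) -> d = 0 >].
  by exists z => //; apply/asboolP.
have [d [Ad sd nd]] : exists d : 'cV_n, [/\ A *m d = 0, forall j, z j 0 = 0 -> d j 0 = 0 & d != 0].
  apply: contrapT => nex; case/negP: h; apply/asboolP => d Ad sd.
  by apply: contrapT => /eqP nd; apply: nex; exists d.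
have [z' sol' lt] := shrink_support sol Ad sd nd.
by apply: IH sol'; apply: leq_trans lt _; rewrite -ltnS.
Qed.

End BasicSolution.

(** The independent columns of a basic solution contain an invertible square submatrix [M], and
    Cramer's rule makes [\det M] times the solution integral. So [D] is the absolute value of
    [\det M], and [y] is [D] times the solution. *)
Lemma small_solution_ord (m n : nat) (A : 'M[int]_(m, n)) (b : 'cV[int]_m) (C : int)
    (z : 'cV[rat]_n) : 1 <= C -> (forall i j, `|A i j| <= C) -> (forall i, `|b i 0| <= C) ->
  nonneg_solution (map_mx intr A) (map_mx intr b) z ->
  exists (D : nat) (y : 'cV[int]_n), [/\ (0 < D)%N, D%:Z <= m`!%:R * C ^+ m,
    forall j, 0 <= y j 0 <= m`!%:R * C ^+ m & A *m y = D%:Z *: b].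
Proof.
move=> C1 hA hb /basic_solution[{}z [Az z0] indep].
have C0 : 0 <= C by apply: le_trans C1.
pose J := support_of z; pose k := #|J|; pose g : 'I_k -> 'I_n := enum_val.
pose AJ : 'M[int]_(m, k) := colsub g A.
pose AJq : 'M[rat]_(m, k) := map_mx intr AJ.
have zE (v : 'cV[rat]_n) : (forall j, z j 0 = 0 -> v j 0 = 0) ->
    map_mx intr A *m v = AJq *m rowsub g v.
  move=> sv; apply/matrixP => i c; rewrite !mxE (ord1 c) (bigID (mem J)) /=.
  rewrite [X in _ + X]big1 ?addr0 => [|j]; last first.
    by rewrite inE negbK => /eqP/sv ->; rewrite mulr0.
  by rewrite big_enum_val; apply: eq_bigr => j _; rewrite !mxE.
have spread (T : pzRingType) (v : 'I_k -> T) i : \sum_i' v i' *+ (g i' == g i) = v i.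
  rewrite (bigD1 i) //= eqxx mulr1n big1 ?addr0 // => i' ne.
  by rewrite (inj_eq enum_val_inj) (negbTE ne).
have spread0 (T : pzRingType) (v : 'I_k -> T) j : z j 0 = 0 -> \sum_i' v i' *+ (g i' == j) = 0.
  move=> zj; rewrite big1 // => i' _; case: eqP => // gj.
  by have := enum_valP i'; rewrite -/(g i') gj inE zj eqxx.
have full : row_full AJq.
  rewrite /row_full -mxrank_tr; apply: inj_row_free => v hv.
  (* A dependency of the selected columns, extended by zero, lies in the kernel of [A] and inside
     the support of [z]. *)
  pose d : 'cV[rat]_n := \col_j \sum_i v 0 i *+ (g i == j).
  have dg : rowsub g d = v^T by apply/matrixP => i c; rewrite !mxE spread (ord1 c).
  have sd j : z j 0 = 0 -> d j 0 = 0 by move=> zj; rewrite mxE spread0.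
  have Ad : map_mx intr A *m d = 0.
    by rewrite (zE d sd) dg -[AJq]trmxK -trmx_mul hv trmx0.
  have d0 := indep d Ad sd.
  by apply: trmx_inj; rewrite -dg d0; apply/matrixP => i c; rewrite !mxE.
pose f := fullrankfun full; pose M : 'M[int]_k := rowsub f AJ.
have eM : map_mx intr M = rowsub f AJq by apply/matrixP => i j; rewrite !mxE.
have det0 : \det M != 0.
  have := fullrowsub_unit full; rewrite -/f -eM unitmxE unitfE det_map_mx.
  by rewrite intr_eq0.
have le_km : (k <= m)%N by rewrite -(eqP full) rank_leq_row.
have bound : k`!%:R * C ^+ k <= m`!%:R * C ^+ m.
  rewrite ler_pM ?exprn_ge0 ?ler0n ?ler_nat ?leq_fact //; exact: ler_weXn2l.
have hM i j : `|M i j| <= C by rewrite !mxE.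
pose v := \adj M *m rowsub f b.
have vE i : (v i 0)%:~R = (\det M)%:~R * z (g i) 0 :> rat.
  have e : map_mx intr v = (\det M)%:~R *: rowsub g z.
    rewrite map_mxM map_mx_adj -mul_scalar_mx -det_map_mx -mul_adj_mx -mulmxA; congr (_ *m _).
    rewrite eM; have -> : map_mx intr (rowsub f b) = rowsub f (map_mx intr b) :> 'cV[rat]_k.
      by apply/matrixP => i' c; rewrite !mxE.
    by rewrite -Az zE // mul_rowsub_mx.
  by have := congr1 (fun X : 'cV[rat]_k => X i 0) e; rewrite !mxE.
(* As [z] is nonnegative, the entries of [v] all have the sign of [\det M] or vanish; absolute
   values remove it. *)
pose y : 'cV[int]_n := \col_j \sum_i `|v i 0| *+ (g i == j).
have yE j : (y j 0)%:~R = (`|\det M|%N)%:R * z j 0 :> rat.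
  rewrite mxE; have [zj|zj] := eqVneq (z j 0) 0; first by rewrite spread0 // zj mulr0.
  have jJ : j \in J by rewrite inE.
  have -> : j = g (enum_rank_in jJ j) by rewrite /g enum_rankK_in.
  rewrite spread intr_norm vE normrM [`|z _ 0|]ger0_norm // -intr_norm.
  by rewrite -natr_absz.
exists `|\det M|%N, y; split.
- by rewrite absz_gt0.
- by rewrite abszE; apply: le_trans bound; apply: det_bound.
- move=> j; rewrite mxE; have [zj|zj] := eqVneq (z j 0) 0.
    by rewrite spread0 // lexx mulr_ge0 ?ler0n ?exprn_ge0.
  have jJ : j \in J by rewrite inE.
  have -> : j = g (enum_rank_in jJ j) by rewrite /g enum_rankK_in.
  rewrite spread normr_ge0; apply: le_trans bound; apply: adj_bound => // i.
  by rewrite mxE.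
apply/matrixP => i c; rewrite (ord1 c) !mxE; apply: (@intr_inj rat).
rewrite rmorph_sum /= rmorphM /=; have := congr1 (fun X : 'cV[rat]_m => X i 0) Az.
rewrite !mxE => <-; rewrite mulr_sumr; apply: eq_bigr => j _.
by rewrite rmorphM /= yE mxE -pmulrn; ring.
Qed.

Lemma small_solution (I J : finType) (A : I -> J -> int) (b : I -> int) (C : int)
    (z : J -> rat) : 1 <= C -> (forall i j, `|A i j| <= C) -> (forall i, `|b i| <= C) ->
  (forall j, 0 <= z j) -> (forall i, \sum_j (A i j)%:~R * z j = (b i)%:~R) ->
  exists (D : nat) (y : J -> nat), [/\ (0 < D)%N, D%:Z <= (#|I|)`!%:R * C ^+ #|I|,
    forall j, (y j)%:Z <= (#|I|)`!%:R * C ^+ #|I| &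
    forall i, \sum_j A i j * (y j)%:Z = D%:Z * b i].
Proof.
move=> C1 hA hb z0 Az.
pose A' := \matrix_(i < #|I|, j < #|J|) A (enum_val i) (enum_val j).
pose b' := \col_(i < #|I|) b (enum_val i).
pose z' := \col_(j < #|J|) z (enum_val j).
have bij : {on predT, bijective (@enum_val J predT)} by exact: onW_bij (enum_val_bij J).
have [i j|i||D [y [D0 leD ley Ay]]] := @small_solution_ord _ _ A' b' C z' C1.
- by rewrite mxE.
- by rewrite mxE.
- by split=> [|j]; [apply/matrixP => i c; rewrite !mxE -Az (reindex _ bij) /=;
    apply: eq_bigr => j _; rewrite !mxE|rewrite mxE].
exists D, (fun j => `|y (enum_rank j) ord0|%N); split=> // [j|i].
  by have /andP[y0 le] := ley (enum_rank j); rewrite gez0_abs.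
have := congr1 (fun X : 'cV[int]_#|I| => X (enum_rank i) 0) Ay.
rewrite !mxE enum_rankK => <-; rewrite (reindex _ bij) /=; apply: eq_bigr => j _.
have /andP[y0 _] := ley j.
by rewrite mxE enum_rankK enum_valK gez0_abs.
Qed.

(** * Closed walks realising circulations *)

Local Open Scope nat_scope.

Section Euler.
Variable V : finType.
Implicit Types (s a u v : V) (c d : seq V) (y r : V -> V -> nat).

Definition walk_steps s c : seq (V * V) := zip (belast s c) c.

Lemma walk_steps_cat s c d :
  walk_steps s (c ++ d) = walk_steps s c ++ walk_steps (last s c) d.
Proof. by rewrite /walk_steps belast_cat zip_cat ?size_belast. Qed.

Definition uses s c u v : nat := count_mem (u, v) (walk_steps s c).

Lemma uses_cat s c d u v : uses s (c ++ d) u v = uses s c u v + uses (last s c) d u v.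
Proof. by rewrite /uses walk_steps_cat count_cat. Qed.

Lemma sum_count_fst (t : seq (V * V)) u :
  \sum_v count_mem (u, v) t = count_mem u (unzip1 t).
Proof.
elim: t => [|[a b] t IH] /=; first by rewrite big1.
rewrite big_split /= IH; congr (_ + _).
by rewrite (bigD1 b) //= xpair_eqE eqxx andbT big1 ?addn0 // => v /negbTE; rewrite eq_sym xpair_eqE andbC => ->.
Qed.

Lemma sum_count_snd (t : seq (V * V)) u :
  \sum_v count_mem (v, u) t = count_mem u (unzip2 t).
Proof.
elim: t => [|[a b] t IH] /=; first by rewrite big1.
rewrite big_split /= IH; congr (_ + _).
by rewrite (bigD1 a) //= xpair_eqE eqxx big1 ?addn0 // => v /negbTE; rewrite eq_sym xpair_eqE => ->.
Qed.

Lemma uses_out s c u : \sum_v uses s c u v = count_mem u (belast s c).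
Proof. by rewrite sum_count_fst unzip1_zip ?size_belast. Qed.

Lemma uses_in s c u : \sum_v uses s c v u = count_mem u c.
Proof. by rewrite sum_count_snd unzip2_zip ?size_belast. Qed.

Lemma uses_balance s c u :
  \sum_v uses s c u v + (last s c == u) = \sum_v uses s c v u + (s == u).
Proof.
rewrite uses_out uses_in; have := congr1 (count_mem u) (lastI s c).
by rewrite /= -cats1 count_cat /= addn0 addnC.
Qed.

Lemma sum_uses s c : \sum_u \sum_v uses s c u v = size c.
Proof.
rewrite -[RHS](size_belast s); under eq_bigr do rewrite uses_out.
elim: (belast s c) => [|a t IH] /=; first by rewrite big1.
rewrite big_split /= IH (bigD1 a) //= eqxx big1 ?addn0 // => u /negbTE.
by rewrite eq_sym => ->.
Qed.

Definition balanced y := forall u, \sum_v y u v = \sum_v y v u.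

Lemma sum_uses_le y s c : (forall u v, uses s c u v <= y u v) ->
  size c <= \sum_u \sum_v y u v.
Proof.
by move=> le_y; rewrite -(sum_uses s); apply: leq_sum => u _; apply: leq_sum.
Qed.

Lemma ltn_sum_ex (I : finType) (F G : I -> nat) :
  \sum_i F i < \sum_i G i -> exists i, F i < G i.
Proof.
move=> lt_FG; apply/existsP; apply: contraLR lt_FG; rewrite negb_exists => /forallP h.
by rewrite -leqNgt; apply: leq_sum => i _; rewrite leqNgt.
Qed.

(** An open trail has entered its end once more than it has left it, so by balance some edge of [y]
    leaving the end has not been used up. The empty trail continues because of the outflow at
    [a]. *)
Lemma trail_continues y a d (b := last a d) : balanced y -> 0 < \sum_v y a v ->
  (d == [::]) || (b != a) -> (forall u v, uses a d u v <= y u v) ->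
  exists v, uses a d b v < y b v.
Proof.
move=> bal out_a nd le_y; apply: ltn_sum_ex.
case/orP: nd => [/eqP d0|nb]; first by rewrite /b d0 /= big1.
have := uses_balance a d b; rewrite eqxx [a == b]eq_sym (negbTE nb) addn0 addn1 => ->.
by rewrite bal; apply: leq_sum.
Qed.

Lemma closed_trail y a : balanced y -> 0 < \sum_v y a v ->
  exists d, [/\ d != [::], last a d = a & forall u v, uses a d u v <= y u v].
Proof.
move=> bal out_a.
suff ext n d : \sum_u \sum_v y u v - size d <= n -> (d == [::]) || (last a d != a) ->
    (forall u v, uses a d u v <= y u v) ->
    exists d', [/\ d' != [::], last a d' = a & forall u v, uses a d' u v <= y u v].
  by apply: (ext _ [::]) => //; exact: leqnn.
elim: n d => [|n IH] d le_n nd le_y.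
all: have [b lt_b] := trail_continues bal out_a nd le_y.
all: have le_y' u v : uses a (rcons d b) u v <= y u v
  by (rewrite -cats1 uses_cat /uses /= addn0 xpair_eqE;
      case: eqP => [<-|_]; [case: eqP => [<-|_]|];
      rewrite /= ?addn0 ?addn1; first [exact: lt_b | exact: le_y]).
all: have := sum_uses_le le_y'; rewrite size_rcons => sz.
  by move: le_n; rewrite leqn0 subn_eq0 leqNgt sz.
have [eb|nb] := eqVneq b a.
  exists (rcons d b); split; rewrite ?last_rcons //; by case: (d).
apply: (IH (rcons d b)) => //; last by rewrite last_rcons nb orbT.
by rewrite size_rcons -ltnS; apply: leq_trans le_n; rewrite ltn_sub2l.
Qed.

Lemma path_exits (e : rel V) (W : pred V) a p :
  path e a p -> W a -> ~~ W (last a p) -> exists u v, [/\ W u, ~~ W v & e u v].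
Proof.
elim: p a => [|b p IH] a /=; first by move=> _ ->.
move=> /andP[eab pth] Wa nW; have [Wb|nWb] := boolP (W b); first exact: IH Wb nW.
by exists a, b.
Qed.

Lemma closed_walk_extend y s c : balanced y ->
  (forall u v, 0 < y u v -> connect (fun u v => 0 < y u v) s u) ->
  last s c = s -> (forall u v, uses s c u v <= y u v) ->
  size c < \sum_u \sum_v y u v ->
  exists c', [/\ last s c' = s, forall u v, uses s c' u v <= y u v & size c < size c'].
Proof.
move=> bal conn cl le_y lt_c; pose r u v := y u v - uses s c u v.
have bal_r : balanced r.
  move=> u; rewrite /r !sumnB //; congr (_ - _) => //.
  by have := uses_balance s c u; rewrite cl => /addIn.
have not_on u v : v \notin c -> uses s c u v = 0.
  move=> nv; have := uses_in s c v; rewrite (count_memPn nv) => /eqP.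
  by rewrite sum_nat_eq0 => /forallP/(_ u)/eqP.
have [a a_on out_a] : exists2 a, a \in s :: c & 0 < \sum_v r a v.
  have [u /ltn_sum_ex[v lt_uv]] : exists u, \sum_v uses s c u v < \sum_v y u v.
    by apply: ltn_sum_ex; rewrite sum_uses.
  have pos w v' : uses s c w v' < y w v' -> 0 < \sum_v r w v.
    by move=> lt; rewrite (bigD1 v') //= addn_gt0 subn_gt0 lt.
  have [u_on|u_off] := boolP (u \in s :: c); first by exists u => //; apply: pos lt_uv.
  have /connectP[p pth u_last] := conn u v (leq_ltn_trans (leq0n _) lt_uv).
  rewrite u_last in u_off.
  have [a [b [a_on b_off yab]]] := path_exits (W := mem (s :: c)) pth (mem_head s c) u_off.
  exists a => //; apply: (pos a b); rewrite not_on //.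
  by apply: contra b_off => b_on; rewrite /= inE b_on orbT.
have [d [nd ld le_r]] := closed_trail bal_r out_a.
have [c1 [c2 [ec la]]] : exists c1 c2, c = c1 ++ c2 /\ last s c1 = a.
  have := a_on; rewrite inE => /orP[/eqP ->|/splitPr[p1 p2]]; first by exists [::], c.
  by exists (rcons p1 a), p2; rewrite cat_rcons last_rcons.
exists (c1 ++ d ++ c2); split.
- by rewrite !last_cat la ld -la -last_cat -ec.
- move=> u v; rewrite !uses_cat la ld addnCA -la -uses_cat -ec la.
  by have := le_r u v; rewrite /r; have := le_y u v; lia.
by rewrite ec !size_cat; case: d nd {ld le_r} => //= b d _; lia.
Qed.

Lemma closed_walk_exists y s : balanced y ->
  (forall u v, 0 < y u v -> connect (fun u v => 0 < y u v) s u) ->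
  exists c, last s c = s /\ forall u v, uses s c u v = y u v.
Proof.
move=> bal conn; pose tot := \sum_u \sum_v y u v.
suff ext n c : tot - size c <= n -> last s c = s -> (forall u v, uses s c u v <= y u v) ->
    exists c, last s c = s /\ forall u v, uses s c u v = y u v.
  by apply: (ext tot [::]) => //; rewrite leq_subr.
elim: n c => [|n IH] c le_n cl le_y.
all: have := sum_uses_le le_y; rewrite leq_eqVlt => /orP[/eqP sz|lt_c].
(* Once the length equals the total of [y], the pointwise bound must be an equality. *)
1, 3: exists c; split=> // u v; apply/eqP; rewrite eqn_leq le_y leqNgt; apply/negP => lt_uv.
1, 2: suff : size c < \sum_u \sum_v y u v by rewrite sz ltnn.
1, 2: rewrite -(sum_uses s) [X in _ < X](bigD1 u) //= (bigD1 u) //= -addSn leq_add //;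
      last by apply: leq_sum => w _; apply: leq_sum.
1, 2: rewrite [X in _ < X](bigD1 v) //= (bigD1 v) //= -addSn leq_add //; by apply: leq_sum.
- by move: le_n; rewrite leqn0 subn_eq0 leqNgt lt_c.
have [c' [cl' le_y' lt]] := closed_walk_extend bal conn cl le_y lt_c.
apply: (IH c') => //; rewrite -ltnS; apply: leq_trans le_n.
by rewrite ltn_sub2l.
Qed.

Lemma uses_path (e : rel V) s c :
  (forall u v, 0 < uses s c u v -> e u v) -> path e s c.
Proof.
elim: c s => //= b c IH s h; rewrite h ?IH //; last by rewrite /uses /= eqxx.
by move=> u v p; apply: h; rewrite /uses /= addn_gt0 p orbT.
Qed.

End Euler.

(** * Definability with auxiliary relations *)

Fixpoint map_rels S (g : nat -> nat) (f : formula S) : formula S :=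
  match f with
  | FRel k js => FRel S (g k) js
  | FNot f1 => FNot (map_rels g f1)
  | FAnd f1 f2 => FAnd (map_rels g f1) (map_rels g f2)
  | FAll f1 => FAll (map_rels g f1)
  | _ => f
  end.

Lemma fo_eval_map_rels (S : eqType) n (x : seq S) Y e g f :
  fo_eval n x Y e (map_rels g f) = fo_eval n x (Y \o g) e f.
Proof.
elim: f e => //= [f IH|f1 IH1 f2 IH2|f IH] e; rewrite ?IH ?IH1 ?IH2 //.
exact: eq_all.
Qed.

Fixpoint map_vars S (g : nat -> nat) (f : formula S) : formula S :=
  match f with
  | FLetter s i => FLetter s (g i)
  | FLess i j => FLess S (g i) (g j)
  | FRel k js => FRel S k (map g js)
  | FNot f1 => FNot (map_vars g f1)
  | FAnd f1 f2 => FAnd (map_vars g f1) (map_vars g f2)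
  | FAll f1 => FAll (map_vars (fun i => if i is j.+1 then (g j).+1 else 0) f1)
  end.

Lemma fo_eval_map_vars (S : eqType) n (x : seq S) Y e e' g f :
  (forall i, nth 0 e (g i) = nth 0 e' i) ->
  fo_eval n x Y e (map_vars g f) = fo_eval n x Y e' f.
Proof.
elim: f e e' g => /= [s i|i j|k js|f IH|f1 IH1 f2 IH2|f IH] e e' g h.
- by rewrite h.
- by rewrite !h.
- by rewrite -map_comp; congr (Y _ _); apply: eq_map => j /=.
- by rewrite (IH _ e').
- by rewrite (IH1 _ e') ?(IH2 _ e').
by apply: eq_all => v; apply: IH => -[|i] /=.
Qed.

Section Definability.
Variables (S : finType) (N : seq S -> nat).

Definition rels := nat -> seq nat -> bool.

(* Even symbols denote the parameters [z], odd ones auxiliary relations. *)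
Definition mix (z Y : rels) : rels :=
  fun t => if odd t then Y t./2 else z t./2.

Definition in_dom (x : seq S) (d : nat) (e : seq nat) :=
  size e = d /\ all (fun v => v < N x) e.

(* The auxiliary relations exist and, on all their possible values, the defining
   formula takes the same value: [P] is both existentially and universally
   second-order definable. *)
Definition definable (d : nat) (P : seq S -> rels -> seq nat -> bool) :=
  exists c f : formula S, forall x z,
    (exists Y, fo_eval (N x) x (mix z Y) [::] c) /\
    forall Y, fo_eval (N x) x (mix z Y) [::] c ->
      forall e, in_dom x d e -> fo_eval (N x) x (mix z Y) e f = P x z e.

Lemma definable_ext d P Q :
  (forall x z e, in_dom x d e -> P x z e = Q x z e) ->
  definable d P -> definable d Q.
Proof.
move=> PQ [c [f h]]; exists c, f => x z; have [h1 h2] := h x z; split=> // Y cY e he.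
by rewrite h2 ?PQ.
Qed.

Definition FTrue := FNot (FLess S 0 0).

Lemma definable_formula d f P :
  (forall x z Y e, in_dom x d e -> fo_eval (N x) x (mix z Y) e f = P x z e) ->
  definable d P.
Proof.
move=> h; exists FTrue, f => x z; split=> [|Y _ e he]; last exact: h.
by exists (fun _ _ => false).
Qed.

(** Without function symbols the only terms are variables. Giving them as functions of the
    environment lets [definable] speak about ordinary expressions instead of syntax. *)
Definition vterm d (t : seq nat -> nat) :=
  exists2 i, i < d & forall e, size e = d -> t e = nth 0 e i.

Lemma vterm_head d : vterm d.+1 (head 0).
Proof. by exists 0 => // -[]. Qed.

Lemma vterm_behead d t : vterm d t -> vterm d.+1 (fun e => t (behead e)).
Proof. by case=> i lt_i h; exists i.+1 => // -[|v e] //= [/h ->]. Qed.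

Definition vlist d m (a : seq nat -> seq nat) :=
  exists js, [/\ size js = m, all (fun j => j < d) js &
    forall e, size e = d -> a e = [seq nth 0 e j | j <- js]].

Lemma vlist_nil d : vlist d 0 (fun=> [::]).
Proof. by exists [::]. Qed.

Lemma vlist_cons d m t a : vterm d t -> vlist d m a ->
  vlist d m.+1 (fun e => t e :: a e).
Proof.
move=> [i lt_i ht] [js [sz lt_js ha]]; exists (i :: js); split=> /=.
- by rewrite sz.
- by rewrite lt_i.
by move=> e se; rewrite ht ?ha.
Qed.

Lemma vlist_id d : vlist d d id.
Proof.
exists (iota 0 d); split; first exact: size_iota.
  by apply/allP => i; rewrite mem_iota.
by move=> e <-; rewrite map_nth_iota0 ?take_size.
Qed.

Lemma vlist_behead d m a : vlist d m a -> vlist d.+1 m (fun e => a (behead e)).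
Proof.
move=> [js [sz lt_js h]]; exists (map succn js); split; first by rewrite size_map.
  by rewrite all_map.
by move=> [|v e] //= [/h ->]; rewrite -map_comp.
Qed.

Lemma in_dom_vlist x d m a e : vlist d m a -> in_dom x d e -> in_dom x m (a e).
Proof.
move=> [js [<- lt_js h]] [se he]; rewrite h //; split; first exact: size_map.
apply/allP => _ /mapP[j /(allP lt_js) lt_j ->].
by apply: all_nthP he _ _; rewrite se.
Qed.

Lemma definable_letter d s t : vterm d t ->
  definable d (fun x z e => onth x (t e) == Some s).
Proof.
move=> [i lt_i h]; apply: (@definable_formula d (FLetter s i)) => x z Y e [/h -> _] //.
Qed.

Lemma definable_less d t u : vterm d t -> vterm d u ->
  definable d (fun x z e => t e < u e).
Proof.
move=> [i _ hi] [j _ hj].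
by apply: (@definable_formula d (FLess S i j)) => x z Y e [se _] /=; rewrite hi ?hj.
Qed.

Lemma definable_rel d m k a : vlist d m a -> definable d (fun x z e => z k (a e)).
Proof.
move=> [js [_ _ h]]; apply: (@definable_formula d (FRel S k.*2 js)) => x z Y e [se _].
by rewrite /= /mix odd_double doubleK h.
Qed.

Lemma definable_not d P : definable d P -> definable d (fun x z e => ~~ P x z e).
Proof.
move=> [c [f h]]; exists c, (FNot f) => x z; have [h1 h2] := h x z.
by split=> // Y cY e he /=; rewrite h2.
Qed.

Lemma definable_and d P Q : definable d P -> definable d Q ->
  definable d (fun x z e => P x z e && Q x z e).
Proof.
move=> [c [f h]] [c' [f' h']].
(* The auxiliary relations of the two formulas are kept apart at even and odd auxiliary indices; the
   parameters are shared. *)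
pose g t := if odd t then (t./2).*2.*2.+1 else t.
pose g' t := if odd t then (t./2).*2.+1.*2.+1 else t.
have mg z Y : mix z Y \o g = mix z (fun t => Y t.*2).
  apply/boolp.funext => t; rewrite /mix /g /=; case ot: (odd t); rewrite ?ot //.
  by rewrite /= !odd_double /= uphalf_double.
have mg' z Y : mix z Y \o g' = mix z (fun t => Y t.*2.+1).
  apply/boolp.funext => t; rewrite /mix /g' /=; case ot: (odd t); rewrite ?ot //.
  by rewrite /= !odd_double /= uphalf_double.
exists (FAnd (map_rels g c) (map_rels g' c')), (FAnd (map_rels g f) (map_rels g' f')).
move=> x z; have [[Y cY] h2] := h x z; have [[Y' cY'] h2'] := h' x z; split.
  exists (fun t => if odd t then Y' t./2 else Y t./2).
  rewrite /= !fo_eval_map_rels mg mg'; apply/andP; split.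
    rewrite [X in mix z X](_ : _ = Y) //; apply/boolp.funext => t.
    by rewrite odd_double doubleK.
  rewrite [X in mix z X](_ : _ = Y') //; apply/boolp.funext => t.
  by rewrite /= odd_double /= uphalf_double.
move=> Z /=; rewrite !fo_eval_map_rels mg mg' => /andP[cZ cZ'] e he.
by rewrite !fo_eval_map_rels mg mg' h2 ?h2'.
Qed.

(** The check formula is closed, so one choice of auxiliary relations serves all values of the
    quantified variable. *)
Lemma definable_all d (P : seq S -> rels -> nat -> seq nat -> bool) :
  definable d.+1 (fun x z e => P x z (head 0 e) (behead e)) ->
  definable d (fun x z e => all (fun v => P x z v e) (iota 0 (N x))).
Proof.
move=> [c [f h]]; exists c, (FAll f) => x z; have [h1 h2] := h x z.
split=> // Y cY e [se he] /=; apply: eq_in_all => v; rewrite mem_iota add0n /= => lt_v.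
by rewrite h2 //; split; rewrite /= ?se ?lt_v.
Qed.

Lemma definable_sub d m P a : definable m P -> vlist d m a ->
  definable d (fun x z e => P x z (a e)).
Proof.
move=> [c [f h]] va; have [js [sz lt_js ha]] := va.
exists c, (map_vars (nth d js) f) => x z; have [h1 h2] := h x z; split=> // Y cY e he.
rewrite (@fo_eval_map_vars _ _ _ _ _ (a e)) => [|i].
  by apply: h2 => //; apply: in_dom_vlist he.
rewrite ha; last by case: he.
have [lt_i|ge_i] := ltnP i (size js); first by rewrite (nth_map d).
by rewrite !nth_default ?size_map //; case: he => ->.
Qed.

Lemma definable_rename d P (g : nat -> nat) : definable d P ->
  definable d (fun x z e => P x (fun t => z (g t)) e).
Proof.
move=> [c [f h]]; pose g' t := if odd t then t else (g t./2).*2.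
have mg z Y : mix z Y \o g' = mix (fun t => z (g t)) Y.
  apply/boolp.funext => t; rewrite /mix /g' /=; case ot: (odd t); rewrite ?ot //.
  by rewrite odd_double doubleK.
exists (map_rels g' c), (map_rels g' f) => x z; have [[Y cY] h2] := h x (fun t => z (g t)).
split=> [|Z]; first by exists Y; rewrite fo_eval_map_rels mg.
by rewrite fo_eval_map_rels mg => cZ e he; rewrite fo_eval_map_rels mg h2.
Qed.

(** In a recursive definition the relation being defined enters its own defining formula as
    parameter 0. *)
Definition rels_cons (Q : seq nat -> bool) (z : rels) : rels :=
  fun t => if t is t'.+1 then z t' else Q.

Lemma fo_eval_iter_all x Y d f e0 :
  fo_eval (N x) x Y e0 (iter d (@FAll S) f) <->
  forall e, in_dom x d e -> fo_eval (N x) x Y (e ++ e0) f.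
Proof.
elim: d e0 => [|d IH] e0 /=.
  by split=> [h [|v e] []|h] //; apply: (h [::]).
split=> [/allP h e|h].
  case/lastP: e => [|e v] [//]; rewrite size_rcons all_rcons => -[se] /andP[lt_v he].
  have /IH : fo_eval (N x) x Y (v :: e0) (iter d (@FAll S) f).
    by apply: h; rewrite mem_iota.
  by move/(_ e (conj se he)); rewrite cat_rcons.
apply/allP => v; rewrite mem_iota add0n /= => lt_v; apply/IH => e [se he].
by rewrite -cat_rcons; apply: h; split; rewrite ?size_rcons ?se // all_rcons lt_v.
Qed.

(* Recursion along [mu]: the defining equation [R = F R] has exactly one
   solution, so it may serve as the check formula for a new auxiliary
   relation. *)
Lemma definable_rec d (mu : seq nat -> nat) (R F : seq S -> rels -> seq nat -> bool) :
  definable d F ->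
  (forall x z Q e, in_dom x d e ->
     (forall e', in_dom x d e' -> mu e' < mu e -> Q e' = R x z e') ->
     F x (rels_cons Q z) e = R x z e) ->
  definable d R.
Proof.
move=> [c [f h]] hR.
(* Parameter 0 of [F] becomes auxiliary relation 0, symbol 1; the other parameters move down by one
   and the auxiliary relations of [F] move up by one. *)
pose g t := if odd t then (t./2).+1.*2.+1 else if t./2 is k.+1 then k.*2 else 1.
have mg z Y : mix z Y \o g = mix (rels_cons (Y 0) z) (fun t => Y t.+1).
  apply/boolp.funext => t; rewrite /mix /g /=; case ot: (odd t).
    by rewrite /= !odd_double /= uphalf_double.
  by case: t./2 => [|k] //=; rewrite odd_double doubleK.
exists (FAnd (map_rels g c) (iter d (@FAll S)
  (FAnd (FNot (FAnd (FRel S 1 (iota 0 d)) (FNot (map_rels g f))))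
        (FNot (FAnd (FNot (FRel S 1 (iota 0 d))) (map_rels g f)))))), (FRel S 1 (iota 0 d)).
have e1 x z (Y : rels) e : in_dom x d e ->
    fo_eval (N x) x (mix z Y) e (FRel S 1 (iota 0 d)) = Y 0 e.
  by case=> <- _; rewrite /= map_nth_iota0 ?take_size.
have iff_eq (a b : bool) : ~~ (a && ~~ b) && ~~ (~~ a && b) = (a == b).
  by case: a b => -[].
move=> x z; split=> [|Z /=].
  have [[Y cY] h2] := h x (rels_cons (R x z) z).
  exists (fun t => if t is t'.+1 then Y t' else R x z).
  rewrite /=; apply/andP; split; first by rewrite fo_eval_map_rels mg.
  apply/fo_eval_iter_all => e he; rewrite cats0 /=.
  rewrite iff_eq fo_eval_map_rels mg; apply/eqP; rewrite h2 // hR //.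
  exact: (e1 x z (fun t => if t is t'.+1 then Y t' else R x z) e he).
rewrite fo_eval_map_rels mg => /andP[cZ /fo_eval_iter_all hZ].
have [_ h2] := h x (rels_cons (Z 0) z).
have fixp e : in_dom x d e -> Z 0 e = F x (rels_cons (Z 0) z) e.
  move=> he; have := hZ e he; rewrite cats0 /= iff_eq fo_eval_map_rels mg h2 // => /eqP <-.
  exact: esym (e1 x z Z e he).
suff ZR n e : mu e < n -> in_dom x d e -> Z 0 e = R x z e.
  by move=> e he; rewrite -(ZR (mu e).+1 e) //; exact: (e1 x z Z e he).
elim: n e => // n IH e lt_n he; rewrite fixp // hR // => e' he' lt_e'.
by apply: IH => //; apply: leq_trans lt_e' _.
Qed.

End Definability.

(** * Binary digits, carries and comparison *)

Definition bit (n i : nat) : bool := odd (n %/ 2 ^ i).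

Definition nval (n : nat) (b : nat -> bool) : nat := \sum_(i < n) b i * 2 ^ i.

Lemma nval_recr n b : nval n.+1 b = nval n b + b n * 2 ^ n.
Proof. by rewrite /nval big_ord_recr. Qed.

Lemma nval_lt n b : nval n b < 2 ^ n.
Proof.
elim: n => [|n IH]; first by rewrite /nval big_ord0.
by rewrite nval_recr expnS; case: (b n) => /=; lia.
Qed.

Lemma eq_nval n b c : (forall i, i < n -> b i = c i) -> nval n b = nval n c.
Proof. by move=> h; apply: eq_bigr => i _; rewrite h. Qed.

Lemma modn_expS m i : m %% 2 ^ i.+1 = m %% 2 ^ i + bit m i * 2 ^ i.
Proof.
have p0 : 0 < 2 ^ i by rewrite expn_gt0.
rewrite {1}(divn_eq m (2 ^ i)) {1}(divn_eq (m %/ 2 ^ i) 2) modn2 -/(bit m i).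
rewrite mulnDl -mulnA -addnA -expnS modnMDl modn_small; first exact: addnC.
by rewrite expnS; have := ltn_pmod m p0; case: (bit m i) => /=; lia.
Qed.

Lemma nval_bit n m : nval n (bit m) = m %% 2 ^ n.
Proof.
elim: n => [|n IH]; first by rewrite /nval big_ord0 modn1.
by rewrite nval_recr IH modn_expS.
Qed.

Lemma bit_small m n i : m < 2 ^ n -> n <= i -> bit m i = false.
Proof.
move=> lt_m le_n; rewrite /bit divn_small //; apply: leq_trans lt_m _.
by rewrite leq_pexp2l.
Qed.

Lemma bit_modn m n i : i < n -> bit (m %% 2 ^ n) i = bit m i.
Proof.
move=> lt_i; rewrite /bit {2}(divn_eq m (2 ^ n)) -(subnK lt_i) addnS -addSn.
rewrite expnD expnS !mulnA divnMDl ?expn_gt0 // oddD mulnC oddM /=.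
by rewrite oddM /= andbF.
Qed.

Lemma bit_nval n b i : i < n -> bit (nval n b) i = b i.
Proof.
elim: n => // n IH; rewrite ltnS leq_eqVlt => /orP[/eqP ->|lt_i].
  rewrite nval_recr /bit addnC divnMDl ?expn_gt0 // divn_small ?nval_lt //.
  by rewrite addn0; case: (b n).
rewrite -(IH lt_i) -(bit_modn (nval n b) lt_i) -(bit_modn (nval n.+1 b) lt_i).
by rewrite nval_recr addnC modnMDl.
Qed.

Lemma eqmod_bit m m' n i : m = m' %[mod 2 ^ n] -> i < n -> bit m i = bit m' i.
Proof. by move=> e lt_i; rewrite -(bit_modn m lt_i) e bit_modn. Qed.

Definition carry (m n i : nat) : bool := 2 ^ i <= m %% 2 ^ i + n %% 2 ^ i.

Lemma bit_addn m n i : bit (m + n) i = bit m i (+) bit n i (+) carry m n i.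
Proof.
rewrite /bit divnD ?expn_gt0 // !oddD -/(bit m i) -/(bit n i) /carry.
by case: (2 ^ i <= _).
Qed.

Lemma carryS m n i : carry m n i.+1 =
  (bit m i && bit n i) || ((bit m i || bit n i) && carry m n i).
Proof.
rewrite /carry !modn_expS expnS.
have := ltn_pmod m (expn_gt0 2 i : 0 < 2 ^ i); have := ltn_pmod n (expn_gt0 2 i : 0 < 2 ^ i).
by case: (bit m i); case: (bit n i) => /=; lia.
Qed.

(** Carry look-ahead: a carry into [i] is generated at some lower position [j] and propagated by all
    positions in between. This makes binary addition first-order, without recursion. *)
Lemma carryE m n i : carry m n i = has (fun j => [&& bit m j, bit n j &
  all (fun k => (j < k) ==> (bit m k || bit n k)) (iota 0 i)]) (iota 0 i).
Proof.
elim: i => [|i IH]; first by rewrite /carry !modn1.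
rewrite carryS IH -addn1 iotaD has_cat /= orbF add0n.
have tail : all (fun k => (i < k) ==> (bit m k || bit n k)) (iota 0 i ++ [:: i]).
  by apply/allP => k; rewrite mem_cat mem_iota inE => h; apply/implyP; lia.
rewrite tail andbT; set h := has _ (iota 0 i); set h' := has _ (iota 0 i).
have eh : bit m i || bit n i -> h' = h.
  move=> e; apply: eq_in_has => j; rewrite mem_iota => lt_j.
  by rewrite all_cat /= e implybT !andbT.
have nh : ~~ (bit m i || bit n i) -> h' = false.
  move=> ne; apply: negbTE; apply/negP => /hasP[j]; rewrite mem_iota add0n => lt_j.
  by rewrite all_cat /= (negbTE ne) (_ : i > j) ?andbF //; lia.
by case: (bit m i) (bit n i) eh nh => -[] /= eh nh; rewrite ?orbT ?orbF //; first [by rewrite eh|by rewrite nh].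
Qed.

(** The most significant position where the two numbers differ decides. *)
Lemma ltn_bits m n k : (m %% 2 ^ k < n %% 2 ^ k) =
  has (fun i => [&& bit n i, ~~ bit m i &
    all (fun j => (i < j) ==> (bit m j == bit n j)) (iota 0 k)]) (iota 0 k).
Proof.
elim: k => [|k IH]; first by rewrite !modn1.
rewrite !modn_expS -(addn1 k) iotaD has_cat /= orbF add0n.
have := ltn_pmod m (expn_gt0 2 k : 0 < 2 ^ k); have := ltn_pmod n (expn_gt0 2 k : 0 < 2 ^ k).
have tail : all (fun j => (k < j) ==> (bit m j == bit n j)) (iota 0 k ++ [:: k]).
  by apply/allP => j; rewrite mem_cat mem_iota inE => h; apply/implyP; lia.
rewrite tail andbT.
set h := has _ _.
have eh : bit m k = bit n k -> h = (m %% 2 ^ k < n %% 2 ^ k).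
  move=> e; rewrite IH; apply: eq_in_has => j; rewrite mem_iota => lt_j.
  by rewrite all_cat /= e eqxx implybT !andbT.
have nh : bit m k != bit n k -> h = false.
  move=> ne; apply: negbTE; apply/negP => /hasP[j]; rewrite mem_iota add0n => lt_j.
  by rewrite all_cat /= (negbTE ne) (_ : k > j) ?andbF //; lia.
case: (bit m k) (bit n k) eh nh => -[] eh nh; first [by rewrite eh //=; lia|by rewrite nh //=; lia].
Qed.

Lemma bit_mul_exp m t i : bit (m * 2 ^ t) i = (t <= i) && bit m (i - t).
Proof.
have [le_t|lt_i] := leqP t i; rewrite /bit /=.
  by rewrite -{1}(subnK le_t) expnD divnMr ?expn_gt0.
by rewrite -(subnK lt_i) addnS -addSn expnD mulnA mulnK ?expn_gt0 // oddM expnS oddM andbF.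
Qed.

Lemma muln_bits m n k :
  m * n = \sum_(0 <= t < k) (if bit n t then m * 2 ^ t else 0) %[mod 2 ^ k].
Proof.
have -> : \sum_(0 <= t < k) (if bit n t then m * 2 ^ t else 0) = m * (n %% 2 ^ k).
  rewrite -nval_bit /nval big_distrr /= big_mkord; apply: eq_bigr => i _.
  by case: (bit n i); rewrite ?muln0 //= mul1n.
by rewrite modnMmr.
Qed.

Ltac vterm_at i :=
  exists i; [by [] | let e := fresh in intros e _;
    do 12 (try (destruct e as [|? e]; [reflexivity | simpl; try reflexivity]));
    reflexivity].
Ltac vterm := first [assumption
  | vterm_at 0 | vterm_at 1 | vterm_at 2 | vterm_at 3 | vterm_at 4 | vterm_at 5
  | vterm_at 6 | vterm_at 7 | vterm_at 8 | vterm_at 9 | vterm_at 10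
  | apply: vterm_behead; assumption
  | (apply: (vterm_behead (vterm_behead _)); assumption)].

Lemma vlist_behead1 d : vlist d.+1 d behead.
Proof. exact: vlist_behead (vlist_id d). Qed.

Lemma vlist_behead2 d : vlist d.+2 d (fun e => behead (behead e)).
Proof. exact: vlist_behead (vlist_behead1 d). Qed.

Lemma vlist_behead3 d : vlist d.+3 d (fun e => behead (behead (behead e))).
Proof. exact: vlist_behead (vlist_behead2 d). Qed.

Lemma vlist_behead4 d :
  vlist d.+4 d (fun e => behead (behead (behead (behead e)))).
Proof. exact: vlist_behead (vlist_behead3 d). Qed.

Lemma vlist_behead5 d :
  vlist d.+1.+4 d (fun e => behead (behead (behead (behead (behead e))))).
Proof. exact: vlist_behead (vlist_behead4 d). Qed.

Ltac vlist := repeat first [assumption | exact: vlist_nil | exact: vlist_id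
  | exact: vlist_behead1 | exact: vlist_behead2 | exact: vlist_behead3
  | exact: vlist_behead4 | exact: vlist_behead5
  | apply: vlist_cons; [vterm|]].

(** * Bounded quantifiers and elementary definable relations *)

Definition alln (n : nat) (P : pred nat) := all P (iota 0 n).
Definition exn (n : nat) (P : pred nat) := has P (iota 0 n).

Lemma allnP n (P : pred nat) : reflect (forall v, v < n -> P v) (alln n P).
Proof.
by apply: (iffP allP) => h v; [move=> lt_v; apply: h; rewrite mem_iota|
  rewrite mem_iota; apply: h].
Qed.

Lemma exnP n (P : pred nat) : reflect (exists2 v, v < n & P v) (exn n P).
Proof.
by apply: (iffP hasP) => -[v]; [rewrite mem_iota => lt_v Pv; exists v|
  move=> lt_v Pv; exists v => //; rewrite mem_iota].
Qed.

Lemma eq_exn n (P Q : pred nat) : (forall v, v < n -> P v = Q v) -> exn n P = exn n Q.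
Proof. by move=> h; apply: eq_in_has => v; rewrite mem_iota; apply: h. Qed.

Lemma eq_alln n (P Q : pred nat) : (forall v, v < n -> P v = Q v) -> alln n P = alln n Q.
Proof. by move=> h; apply: eq_in_all => v; rewrite mem_iota; apply: h. Qed.

Section Derived.
Variables (S : finType) (N : seq S -> nat).
Hypothesis N0 : forall x, 0 < N x.
Implicit Types (x : seq S) (z : rels) (e : seq nat).
Notation definable := (definable N).

Lemma definable_alln d (P : seq S -> rels -> nat -> seq nat -> bool) :
  definable d.+1 (fun x z e => P x z (head 0 e) (behead e)) ->
  definable d (fun x z e => alln (N x) (fun v => P x z v e)).
Proof. exact: definable_all. Qed.

Lemma definable_exn d (P : seq S -> rels -> nat -> seq nat -> bool) :
  definable d.+1 (fun x z e => P x z (head 0 e) (behead e)) ->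
  definable d (fun x z e => exn (N x) (fun v => P x z v e)).
Proof.
move=> /definable_not h.
have /definable_not := definable_all (P := fun x z v e => ~~ P x z v e) h.
by apply: definable_ext => x z e _; rewrite /exn -has_predC; apply: eq_has => v /=; rewrite negbK.
Qed.

Lemma definable_true d : definable d (fun _ _ _ => true).
Proof. by apply: (@definable_formula _ _ d (FTrue S)) => x z Y e _ /=; rewrite ltnn. Qed.

Lemma definable_false d : definable d (fun _ _ _ => false).
Proof. exact: definable_not (definable_true d). Qed.

Lemma definable_bool d b : definable d (fun _ _ _ => b).
Proof. by case: b; [apply: definable_true|apply: definable_false]. Qed.

Lemma definable_or d P Q : definable d P -> definable d Q ->
  definable d (fun x z e => P x z e || Q x z e).
Proof.
move=> /definable_not hP /definable_not hQ.
apply: definable_ext (definable_not (definable_and hP hQ)) => x z e _.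
by rewrite -negb_or negbK.
Qed.

Lemma definable_imp d P Q : definable d P -> definable d Q ->
  definable d (fun x z e => P x z e ==> Q x z e).
Proof.
move=> /definable_not hP hQ; apply: definable_ext (definable_or hP hQ) => x z e _.
by rewrite implybE.
Qed.

Lemma definable_eqb d P Q : definable d P -> definable d Q ->
  definable d (fun x z e => P x z e == Q x z e).
Proof.
move=> hP hQ; apply: definable_ext
  (definable_and (definable_imp hP hQ) (definable_imp hQ hP)) => x z e _.
by case: (P _ _ _) (Q _ _ _) => -[].
Qed.

Lemma definable_addb d P Q : definable d P -> definable d Q ->
  definable d (fun x z e => P x z e (+) Q x z e).
Proof.
move=> hP hQ; apply: definable_ext (definable_not (definable_eqb hP hQ)) => x z e _.
by case: (P _ _ _) (Q _ _ _) => -[].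
Qed.

Lemma definable_leq d t u : vterm d t -> vterm d u ->
  definable d (fun x z e => t e <= u e).
Proof.
move=> ht hu; apply: definable_ext (definable_not (definable_less N hu ht)) => x z e _.
by rewrite -leqNgt.
Qed.

Lemma definable_eqn d t u : vterm d t -> vterm d u ->
  definable d (fun x z e => t e == u e).
Proof.
move=> ht hu; apply: definable_ext
  (definable_and (definable_leq ht hu) (definable_leq hu ht)) => x z e _.
by rewrite eqn_leq.
Qed.

Lemma in_dom_vterm x d t e : vterm d t -> in_dom N x d e -> t e < N x.
Proof.
move=> [i lt_i h] [se he]; rewrite h //; apply: all_nthP he _ _; by rewrite se.
Qed.

Lemma definable_succ d t u : vterm d t -> vterm d u ->
  definable d (fun x z e => (t e).+1 == u e).
Proof.
move=> ht hu; refine (definable_ext _ (definable_and (definable_less N ht hu)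
  (definable_alln (P := fun x z v e => ~~ ((t e < v) && (v < u e))) _))).
  move=> x z e he; have lu := in_dom_vterm hu he; apply/andP/eqP => [[lt_tu /allnP h']|eu].
    have [lt|//|->] := ltngtP (t e).+1 (u e).
    - by have := h' (t e).+1; rewrite (ltn_trans lt lu) ltnSn lt => /(_ isT).
    - by rewrite ltnNge lt_tu.
    by [].
  by split; [lia|apply/allnP => v _; lia].
cbv beta; apply: definable_not; apply: definable_and; apply: definable_less;
  by [vterm|apply: vterm_behead].
Qed.

Lemma definable_eq0 d t : vterm d t -> definable d (fun x z e => t e == 0).
Proof.
move=> ht; refine (definable_ext _ (definable_alln (P := fun x z v e => t e <= v) _)).
  move=> x z e he; apply/allnP/eqP => [/(_ 0 (N0 x))|-> //]; by rewrite leqn0 => /eqP.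
by cbv beta; apply: definable_leq; [apply: vterm_behead|vterm].
Qed.

Lemma definable_const d c t : vterm d t -> definable d (fun x z e => t e == c).
Proof.
elim: c d t => [|c IH] d t ht; first exact: definable_eq0.
refine (definable_ext _ (definable_exn (P := fun x z v e => (v == c) && (v.+1 == t e)) _)).
  move=> x z e he; apply/exnP/eqP => [[v _ /andP[/eqP -> /eqP]]//|et].
  by exists c; rewrite ?et ?eqxx //; have := in_dom_vterm ht he; lia.
cbv beta; apply: definable_and; first by apply: IH; vterm.
by apply: definable_succ; [vterm|apply: vterm_behead].
Qed.

End Derived.

Ltac dfn1 := cbv beta; first
  [ assumption
  | apply: definable_and | apply: definable_or | apply: definable_not
  | apply: definable_imp | apply: definable_alln | apply: definable_exn
  | apply: definable_eqb | apply: definable_addb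
  | (apply: definable_succ; [vterm|vterm])
  | (apply: definable_const; [assumption|vterm])
  | (apply: definable_less; [vterm|vterm])
  | (apply: definable_leq; [vterm|vterm])
  | (apply: definable_eqn; [vterm|vterm])
  | (apply: definable_rel; vlist)
  | (apply: definable_letter; vterm)
  | exact: definable_bool ].
Ltac dfn := repeat dfn1.

(** * Arithmetic on elements of the domain *)

Section Arithmetic.
Variables (S : finType) (N : seq S -> nat).
Hypothesis N0 : forall x, 0 < N x.
Notation definable := (definable N).

(** Recursion on the first summand. As the sum is compared with a domain element, the smaller sums
    met on the way stay in the domain. *)
Lemma definable_add d t u w : vterm d t -> vterm d u -> vterm d w ->
  definable d (fun x z e => t e + u e == w e).
Proof.
move=> ht hu hw.
suff h : definable 3 (fun x z e => nth 0 e 0 + nth 0 e 1 == nth 0 e 2).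
  by apply: (definable_sub (a := fun e => [:: t e; u e; w e]) h); vlist.
apply: (@definable_rec _ _ 3 (head 0) _ (fun x z e =>
  ((nth 0 e 0 == 0) && (nth 0 e 1 == nth 0 e 2)) ||
  exn (N x) (fun i => exn (N x) (fun k => [&& i.+1 == nth 0 e 0, k.+1 == nth 0 e 2 &
    z 0 [:: i; nth 0 e 1; k]])))).
  by dfn.
move=> x z Q e [se he] hQ; case: e se he hQ => [|i [|j [|k [|? ?]]]] //= _ /and4P[li lj lk _] hQ.
case: i li hQ => [|i] li hQ.
  by rewrite add0n eqxx /=; case: eqP => //= _; apply/exnP => -[i _ /exnP[k' _]].
apply/exnP/eqP => [[i' li' /exnP[k' lk' /and3P[/eqP[e1] /eqP e2]]]|e].
  by rewrite /= hQ ?e1 //= => [/eqP|]; [lia|rewrite /in_dom /= -e1 li' lj lk'].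
exists i; first by lia.
apply/exnP; exists (i + j); first by lia.
rewrite /= eqxx -e addSn eqxx /= hQ //=.
by rewrite /in_dom /= lj !andbT (ltnW li) /=; split=> //; lia.
Qed.

Lemma definable_mul d t u w : vterm d t -> vterm d u -> vterm d w ->
  definable d (fun x z e => t e * u e == w e).
Proof.
move=> ht hu hw.
suff h : definable 3 (fun x z e => nth 0 e 0 * nth 0 e 1 == nth 0 e 2).
  by apply: (definable_sub (a := fun e => [:: t e; u e; w e]) h); vlist.
apply: (@definable_rec _ _ 3 (head 0) _ (fun x z e =>
  ((nth 0 e 0 == 0) && (nth 0 e 2 == 0)) ||
  exn (N x) (fun i => exn (N x) (fun k => [&& i.+1 == nth 0 e 0, k + nth 0 e 1 == nth 0 e 2 &
    z 0 [:: i; nth 0 e 1; k]])))).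
  dfn; apply: definable_add; vterm.
move=> x z Q e [se he] hQ; case: e se he hQ => [|i [|j [|k [|? ?]]]] //= _ /and4P[li lj lk _] hQ.
case: i li hQ => [|i] li hQ.
  rewrite mul0n eqxx /= eq_sym; case: eqP => //= _.
  by apply/exnP => -[i _ /exnP[k' _]].
apply/exnP/eqP => [[i' li' /exnP[k' lk' /and3P[/eqP[e1] /eqP e2]]]|e].
  by rewrite /= hQ ?e1 //= => [/eqP|]; [lia|rewrite /in_dom /= -e1 li' lj lk'].
exists i; first by lia.
apply/exnP; exists (i * j); first by rewrite mulSn in e; lia.
rewrite /= eqxx -e mulSn addnC eqxx /= hQ //=.
by rewrite /in_dom /= lj !andbT (ltnW li) /=; split=> //; rewrite mulSn in e; lia.
Qed.

(** Values of [g] may exceed the domain and are then equal to no element of it; this is the reason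
    for the side condition in [definable_graph]. *)
Definition graph d (g : seq S -> rels -> seq nat -> nat) :=
  definable d.+1 (fun x z e => g x z (behead e) == head 0 e).

Lemma definable_graph d g (Q : seq S -> rels -> nat -> seq nat -> bool) :
  graph d g ->
  (forall x z e, in_dom N x d e -> g x z e < N x \/ Q x z (g x z e) e = false) ->
  definable d.+1 (fun x z e => Q x z (head 0 e) (behead e)) ->
  definable d (fun x z e => Q x z (g x z e) e).
Proof.
move=> hg h hQ; refine (definable_ext _
  (definable_exn (P := fun x z v e => (g x z e == v) && Q x z v e) _)).
  move=> x z e he; apply/exnP/idP => [[v _ /andP[/eqP -> //]]|Qg].
  by have [lt_g|] := h x z e he; [exists (g x z e); rewrite ?eqxx|rewrite Qg].
cbv beta; exact: definable_and.
Qed.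

Lemma graph_vterm d t : vterm d t -> graph d (fun x z e => t e).
Proof. by move=> ht; apply: definable_eqn; [apply: vterm_behead|vterm]. Qed.

Lemma graph_const d c : graph d (fun _ _ _ => c).
Proof.
rewrite /graph; apply: definable_ext (definable_const N0 c (vterm_head d)) => x z e _.
by rewrite eq_sym.
Qed.

Lemma graph_add d g h : graph d g -> graph d h ->
  graph d (fun x z e => g x z e + h x z e).
Proof.
move=> hg hh; rewrite /graph.
refine (definable_ext _ (definable_exn (P := fun x z v e =>
   exn (N x) (fun w => [&& g x z (behead e) == v, h x z (behead e) == w & v + w == head 0 e])) _)).
  move=> x z e he; have lt_e := in_dom_vterm (vterm_head d) he.
  apply/exnP/eqP => [[v _ /exnP[w _ /and3P[/eqP -> /eqP -> /eqP //]]]|eq_e].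
  exists (g x z (behead e)); first by lia.
  by apply/exnP; exists (h x z (behead e)); rewrite ?eqxx ?eq_e ?eqxx //; lia.
dfn; last by apply: definable_add; vterm.
  have va : vlist d.+3 d.+1 (fun e => head 0 (behead e) :: behead (behead (behead e))).
    by vlist.
  exact: (definable_sub hg va).
have va : vlist d.+3 d.+1 (fun e => head 0 e :: behead (behead (behead e))) by vlist.
exact: (definable_sub hh va).
Qed.

(** A nonzero product bounds its factors. If one factor is 0, the other may lie outside the domain,
    so this case has to be treated apart. *)
Lemma graph_mul d g h : graph d g -> graph d h ->
  graph d (fun x z e => g x z e * h x z e).
Proof.
move=> hg hh; rewrite /graph.
refine (definable_ext _ (definable_or (definable_and
  (definable_or (P := fun x z e => g x z (behead e) == 0)
     (Q := fun x z e => h x z (behead e) == 0) _ _)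
  (definable_const N0 0 (vterm_head d)))
  (definable_exn (P := fun x z v e =>
   exn (N x) (fun w => [&& g x z (behead e) == v, h x z (behead e) == w & v * w == head 0 e])) _))).
- move=> x z e he; have lt_e := in_dom_vterm (vterm_head d) he.
  apply/orP/eqP => [[/andP[/orP[]/eqP -> /eqP ->]|]|eq_e]; rewrite ?mul0n ?muln0 //.
    by move=> /exnP[v _ /exnP[w _ /and3P[/eqP -> /eqP -> /eqP //]]].
  case: (posnP (head 0 e)) => [e0|pos].
    by left; have := eq_e; rewrite e0 => /eqP; rewrite muln_eq0 => ->.
  have [g0 h0] : 0 < g x z (behead e) /\ 0 < h x z (behead e).
    by apply/andP; rewrite -muln_gt0 eq_e.
  right; apply/exnP; exists (g x z (behead e)).
    by apply: leq_ltn_trans lt_e; rewrite -eq_e leq_pmulr.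
  apply/exnP; exists (h x z (behead e)); last by rewrite !eqxx eq_e eqxx.
  by apply: leq_ltn_trans lt_e; rewrite -eq_e leq_pmull.
- apply: (definable_graph (g := fun x z e => g x z (behead e)) (Q := fun x z v e => v == 0)).
  + have va : vlist d.+2 d.+1 (fun e => head 0 e :: behead (behead e)) by vlist.
    exact: (definable_sub hg va).
  + by move=> x z e _; case: (posnP (g x z (behead e))) => [->|]; [left|right; lia].
  by dfn.
- apply: (definable_graph (g := fun x z e => h x z (behead e)) (Q := fun x z v e => v == 0)).
  + have va : vlist d.+2 d.+1 (fun e => head 0 e :: behead (behead e)) by vlist.
    exact: (definable_sub hh va).
  + by move=> x z e _; case: (posnP (h x z (behead e))) => [->|]; [left|right; lia].
  by dfn.
dfn; last by apply: definable_mul; vterm.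
  have va : vlist d.+3 d.+1 (fun e => head 0 (behead e) :: behead (behead (behead e))).
    by vlist.
  exact: (definable_sub hg va).
have va : vlist d.+3 d.+1 (fun e => head 0 e :: behead (behead (behead e))) by vlist.
exact: (definable_sub hh va).
Qed.

End Arithmetic.

(** * Arithmetic on numbers with [N x] bits *)

Lemma carry_exn m p i n : i <= n -> carry m p i = exn n (fun j => [&& j < i, bit m j, bit p j &
  alln n (fun k => (j < k) ==> (k < i) ==> (bit m k || bit p k))]).
Proof.
move=> le_i; rewrite carryE; apply/hasP/exnP => [[j]|[j lt_j /and4P[lt_ji mj pj /allnP h]]].
  rewrite mem_iota add0n => /andP[_ lt_j] /and3P[mj pj /allP h].
  exists j; first exact: leq_trans le_i.
  rewrite lt_j mj pj; apply/allnP => k lt_k; apply/implyP => lt_jk; apply/implyP => lt_ki.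
  by have := h k; rewrite mem_iota lt_ki lt_jk; apply.
exists j; first by rewrite mem_iota.
rewrite mj pj; apply/allP => k; rewrite mem_iota add0n => /andP[_ lt_k].
by apply/implyP => lt_jk; have := h k (leq_trans lt_k le_i); rewrite lt_jk lt_k.
Qed.

Section Numbers.
Variables (S : finType) (N : seq S -> nat).
Hypothesis N0 : forall x, 0 < N x.
Notation definable := (definable N).

(* Only the values modulo [2 ^ N x] matter. *)
Definition number d (F : seq S -> rels -> seq nat -> nat) :=
  definable d.+1 (fun x z e => bit (F x z (behead e)) (head 0 e)).

Lemma definable_bit d m F a t : number m F -> vlist d m a -> vterm d t ->
  definable d (fun x z e => bit (F x z (a e)) (t e)).
Proof.
move=> hF va vt; have va' : vlist d m.+1 (fun e => t e :: a e) by vlist.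
exact: (definable_sub hF va').
Qed.

Lemma in_dom_behead x d e : in_dom N x d.+1 e -> in_dom N x d (behead e).
Proof. by case: e => [|v e] [] //= [se] /andP[_ he]. Qed.

Lemma in_dom_head x d e : in_dom N x d.+1 e -> head 0 e < N x.
Proof. by case: e => [|v e] [] //= _ /andP[]. Qed.

Lemma number_eqmod d F G :
  (forall x z e, in_dom N x d e -> F x z e = G x z e %[mod 2 ^ N x]) ->
  number d F -> number d G.
Proof.
move=> h; apply: definable_ext => x z e he.
by apply: eqmod_bit (h _ _ _ (in_dom_behead he)) (in_dom_head he).
Qed.

Lemma number_sub d m F a : number m F -> vlist d m a ->
  number d (fun x z e => F x z (a e)).
Proof.
by move=> hF va; apply: (definable_bit hF); [apply: vlist_behead|vterm].
Qed.

Lemma number_nval d (P : seq S -> rels -> nat -> seq nat -> bool) :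
  definable d.+1 (fun x z e => P x z (head 0 e) (behead e)) ->
  number d (fun x z e => nval (N x) (fun i => P x z i e)).
Proof.
by apply: definable_ext => x z e he; rewrite bit_nval // (in_dom_head he).
Qed.

Lemma number_if d (P : seq S -> rels -> seq nat -> bool) F : definable d P -> number d F ->
  number d (fun x z e => if P x z e then F x z e else 0).
Proof.
move=> hP hF; rewrite /number.
refine (definable_ext _ (definable_and (P := fun x z e => P x z (behead e)) _ hF)).
  by move=> x z e _; case: (P _ _ _) => //=; rewrite /bit div0n.
exact: (definable_sub hP (vlist_behead1 d)).
Qed.

Lemma definable_carry d A B t : number d A -> number d B -> vterm d t ->
  definable d (fun x z e => carry (A x z e) (B x z e) (t e)).
Proof.
move=> hA hB vt.
refine (definable_ext _ (definable_exn (P := fun x z j e =>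
   [&& j < t e, bit (A x z e) j, bit (B x z e) j & alln (N x) (fun k =>
     (j < k) ==> (k < t e) ==> (bit (A x z e) k || bit (B x z e) k))]) _)).
  by move=> x z e he; rewrite -carry_exn // ltnW // (in_dom_vterm vt he).
dfn; by [apply: (definable_bit (a := behead) hA); [vlist|vterm] |
 apply: (definable_bit (a := behead) hB); [vlist|vterm] |
 apply: (definable_bit (a := fun e => behead (behead e)) hA); [vlist|vterm] |
 apply: (definable_bit (a := fun e => behead (behead e)) hB); [vlist|vterm] ].
Qed.

Lemma number_add d F G : number d F -> number d G ->
  number d (fun x z e => F x z e + G x z e).
Proof.
move=> hF hG; rewrite /number; refine (definable_ext _ (definable_addb (definable_addb hF hG)
   (definable_carry (d := d.+1) (t := head 0) (number_sub hF (vlist_behead1 d))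
      (number_sub hG (vlist_behead1 d)) (vterm_head d)))).
by move=> x z e _; rewrite bit_addn.
Qed.

Lemma number_shift d F t : number d F -> vterm d t ->
  number d (fun x z e => F x z e * 2 ^ t e).
Proof.
move=> hF vt; rewrite /number.
refine (definable_ext _ (definable_exn (P := fun x z j e =>
   (j + t (behead e) == head 0 e) && bit (F x z (behead e)) j) _)).
  move=> x z e he; have lt_e := in_dom_head he; rewrite bit_mul_exp.
  apply/exnP/andP => [[j _ /andP[/eqP <- bj]]|[le_t bj]].
    by rewrite leq_addl addnK.
  by exists (head 0 e - t (behead e)); rewrite ?subnK ?eqxx //; lia.
dfn; first by apply: definable_add => //; vterm.
by apply: (definable_bit (a := fun e => behead (behead e)) hF); [vlist|vterm].
Qed.

(** Iterated addition needs recursion. The bits of the partial sums form a relation in the bit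
    position and the last index [t], and recursion along [t] adds one term at a time by carry
    look-ahead. *)
Lemma number_sum d (F : seq S -> rels -> nat -> seq nat -> nat) :
  number d.+1 (fun x z e => F x z (head 0 e) (behead e)) ->
  number d (fun x z e => \sum_(0 <= t < N x) F x z t e).
Proof.
move=> hF.
pose R x (z : rels) e := bit (\sum_(0 <= t < (nth 0 e 1).+1) F x z t (behead (behead e))) (nth 0 e 0).
have hR : definable d.+2 R.
  (* Within the recursion parameter 0 is the relation being defined, so [F] has to be evaluated with
     its parameters shifted. *)
  pose F' x (z : rels) e i :=
    bit (F x (fun k => z k.+1) (head 0 (behead e)) (behead (behead e))) i.
  have hF1 : number d.+1 (fun x z e => F x (fun k => z k.+1) (head 0 e) (behead e)).
    by apply: (definable_rename succn) hF.
  apply: (definable_rec (mu := fun e => nth 0 e 1) (F := fun x z e =>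
    ((nth 0 e 1 == 0) && F' x z e (head 0 e)) ||
    exn (N x) (fun t => (t.+1 == nth 0 e 1) &&
      (z 0 [:: nth 0 e 0, t & behead (behead e)] (+) F' x z e (head 0 e) (+)
       exn (N x) (fun j => [&& j < nth 0 e 0, z 0 [:: j, t & behead (behead e)], F' x z e j &
         alln (N x) (fun k => (j < k) ==> (k < nth 0 e 0) ==>
            (z 0 [:: k, t & behead (behead e)] || F' x z e k))]))))).
    rewrite /F'; dfn; by [apply: (definable_bit (a := behead) hF1); [vlist|vterm]
    | apply: (definable_bit (a := fun e => behead (behead e)) hF1); [vlist|vterm]
    | apply: (definable_bit (a := fun e => behead (behead (behead e))) hF1); [vlist|vterm]
    | apply: (definable_bit (a := fun e => behead (behead (behead (behead e)))) hF1); [vlist|vterm]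
    | apply: (definable_bit (a := fun e => behead (behead (behead (behead (behead e))))) hF1); [vlist|vterm]].
  move=> x z Q e he hQ; rewrite /F' /R /=.
  have -> : (fun k => rels_cons Q z k.+1) = z by [].
  case: e he hQ => [[]//|i [[]//|t e]] he hQ.
  have [se /= /and3P[lt_i lt_t lt_e]] := he.
  case: t he hQ se lt_t => [|t] he hQ se lt_t /=.
    rewrite big_nat1 orbC; case: exnP => //= -[t' _] //.
  rewrite big_nat_recr //= bit_addn.
  have Qt k : k < N x -> Q (k :: t :: e) = bit (\sum_(0 <= s < t.+1) F x z s e) k.
    by move=> lt_k; rewrite hQ //; split; rewrite //= lt_k (ltnW lt_t).
  have eqc : exn (N x) (fun j => [&& j < i, Q (j :: t :: e), bit (F x z t.+1 e) j &
         alln (N x) (fun k => (j < k) ==> (k < i) ==>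
            (Q (k :: t :: e) || bit (F x z t.+1 e) k))]) =
      carry (\sum_(0 <= s < t.+1) F x z s e) (F x z t.+1 e) i.
    rewrite (carry_exn _ _ (ltnW lt_i)); apply: eq_exn => j lt_j; rewrite Qt //.
    congr [&& _, _, _ & _]; apply: eq_alln => k lt_k; rewrite Qt //.
  rewrite -eqc -Qt //; apply/exnP/idP => [[t' _ /andP[/eqP[->]]]//|h].
  by exists t; [exact: ltnW|rewrite eqxx].
(* The full sum is the partial sum at the largest element of the domain, which is definable; [N x]
   itself is not an element. *)
rewrite /number; refine (definable_ext _ (definable_exn (P := fun x z t e =>
   alln (N x) (fun s => s <= t) && R x z [:: head 0 e, t & behead e]) _)).
  move=> x z e he; have N1 := N0 x.
  have lastE t : t < N x -> alln (N x) (fun s => s <= t) -> t.+1 = N x.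
    by move=> lt_t /allnP h; apply/eqP; rewrite eqn_leq lt_t /=; have := h (N x).-1; lia.
  apply/exnP/idP => [[t lt_t /andP[/lastE h]]|h].
    by rewrite /R /= (h lt_t).
  exists (N x).-1; first by lia.
  by rewrite /R /= prednK // h andbT; apply/allnP => s; lia.
dfn; have va : vlist d.+2 d.+2 (fun e => [:: head 0 (behead e), head 0 e & behead (behead e)]).
  by vlist.
exact: (definable_sub hR va).
Qed.

Lemma number_mul d F G : number d F -> number d G ->
  number d (fun x z e => F x z e * G x z e).
Proof.
move=> hF hG; refine (number_eqmod _ (number_sum (F := fun x z t e =>
   if bit (G x z e) t then F x z e * 2 ^ t else 0) _)).
  by move=> x z e _; rewrite (muln_bits _ _ (N x)).
apply: number_if; first by apply: (definable_bit hG); [vlist|vterm].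
by apply: number_shift; [apply: (number_sub hF); vlist|vterm].
Qed.

Lemma definable_ltnum d F G : number d F -> number d G ->
  definable d (fun x z e => F x z e %% 2 ^ N x < G x z e %% 2 ^ N x).
Proof.
move=> hF hG; refine (definable_ext _ (definable_exn (P := fun x z i e =>
  [&& bit (G x z e) i, ~~ bit (F x z e) i & alln (N x) (fun j => (i < j) ==>
      (bit (F x z e) j == bit (G x z e) j))]) _)).
  by move=> x z e _; rewrite ltn_bits.
dfn; by [apply: (definable_bit (a := behead) hF); [vlist|vterm] |
 apply: (definable_bit (a := behead) hG); [vlist|vterm] |
 apply: (definable_bit (a := fun e => behead (behead e)) hF); [vlist|vterm] |
 apply: (definable_bit (a := fun e => behead (behead e)) hG); [vlist|vterm] ].
Qed.

Lemma definable_eqnum d F G : number d F -> number d G ->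
  definable d (fun x z e => F x z e == G x z e %[mod 2 ^ N x]).
Proof.
move=> hF hG; apply: definable_ext (definable_and (definable_not (definable_ltnum hF hG))
  (definable_not (definable_ltnum hG hF))) => x z e _.
by rewrite -!leqNgt andbC -eqn_leq.
Qed.

Lemma definable_odd d F : number d F -> definable d (fun x z e => odd (F x z e)).
Proof.
move=> hF; refine (definable_ext _ (definable_exn (P := fun x z i e =>
  (i == 0) && bit (F x z e) i) _)).
  move=> x z e _; apply/exnP/idP => [[i _ /andP[/eqP ->]]|h].
    by rewrite /bit divn1.
  by exists 0; rewrite ?N0 //= /bit divn1.
dfn; by apply: (definable_bit hF); [vlist|vterm].
Qed.

End Numbers.

(** * Parsing words *)

Notation sigma := (option bool).

Fixpoint parse (x : seq sigma) : seq (seq bool) :=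
  match x with
  | [::] => [::]
  | None :: x' => [::] :: parse x'
  | Some b :: x' => if parse x' is w :: ws then (b :: w) :: ws else [:: [:: b]]
  end.

(** The state of a scan from the left: index of the current word and offset in it. *)
Definition pos_step (p : nat * nat) (c : sigma) : nat * nat :=
  if c is Some _ then (p.1, p.2.+1) else (p.1.+1, 0).

Definition pos (x : seq sigma) (i : nat) : nat * nat := foldl pos_step (0, 0) (take i x).

(** Composition of two scans, [q] being the result of a scan started afresh: the offset in [p] is
    forgotten once [q] has met a terminator. *)
Definition pos_shift (p q : nat * nat) := (p.1 + q.1, if q.1 == 0 then p.2 + q.2 else q.2).

Lemma foldl_pos_step p s : foldl pos_step p s = pos_shift p (foldl pos_step (0, 0) s).
Proof.
elim/last_ind: s => [|s c IH]; first by case: p => a b; rewrite /pos_shift /= !addn0.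
rewrite -!cats1 !foldl_cat /= IH; case: c => [b|]; rewrite /pos_shift /=.
  by case: eqP => // _; rewrite addnS.
by rewrite addnS.
Qed.

Lemma pos_cons c x i : pos (c :: x) i.+1 = pos_shift (pos_step (0, 0) c) (pos x i).
Proof. by rewrite /pos /= foldl_pos_step. Qed.

Lemma posS x i : pos x i.+1 =
  if onth x i is Some c then pos_step (pos x i) c else pos x i.
Proof.
elim: x i => [|c x IH] [|i] //.
- by rewrite /pos /= take0.
- rewrite pos_cons IH /=; case: (onth x i) => [d|]; last by rewrite -pos_cons.
  by rewrite pos_cons; case: d c => [d|] [c|]; rewrite /pos_shift /pos_step /= ?addnS //; case: eqP.
Qed.

Lemma pos_oversize x i : size x <= i -> pos x i = pos x (size x).
Proof. by move=> le_i; rewrite /pos take_oversize // take_size. Qed.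

Lemma pos_le x i : ((pos x i).1 <= size x) && ((pos x i).2 <= size x).
Proof.
suff h : ((pos x i).1 <= minn i (size x)) && ((pos x i).2 <= minn i (size x)).
  by move: h; rewrite !leq_min -andbA => /and4P[_ -> _ ->].
elim: i => [|i]; first by rewrite /pos take0.
rewrite posS; case E: (onth x i) => [c|]; last by lia.
have : i < size x by rewrite -onthTE E.
by case: c {E} => [c|] /=; lia.
Qed.

Lemma pos_consS c x i : pos (Some c :: x) i.+1 =
  ((pos x i).1, if (pos x i).1 == 0 then (pos x i).2.+1 else (pos x i).2).
Proof. by rewrite pos_cons. Qed.

Lemma pos_consN x i : pos (None :: x) i.+1 = ((pos x i).1.+1, (pos x i).2).
Proof. by rewrite pos_cons /pos_shift /= add0n add1n; case: eqP. Qed.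

Lemma pos0 x : pos x 0 = (0, 0).
Proof. by rewrite /pos take0. Qed.

Lemma parseP x j k b :
  (k < size (nth [::] (parse x) j) /\ nth false (nth [::] (parse x) j) k = b) <->
  exists i, pos x i = (j, k) /\ onth x i = Some (Some b).
Proof.
elim: x j k => [|[c|] x IH] j k /=.
- by rewrite nth_nil; split=> [[]|[i []]] //; case: i.
- have -> : (if parse x is w :: ws then (c :: w) :: ws else [:: [:: c]]) =
     (c :: head [::] (parse x)) :: behead (parse x) by case: (parse x).
  case: j => [|j] /=.
    case: k => [|k] /=.
      split=> [[_ ->]|[[|i] []]]; first by exists 0.
        by move=> _ [->].
      by rewrite pos_consS => -[]; case: eqP.
    have := IH 0 k; rewrite nth0 => ->; split=> -[i [e1 e2]].
      by exists i.+1; rewrite pos_consS e1.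
    case: i e1 e2 => [|i]; first by rewrite pos0.
    rewrite pos_consS => -[e0]; rewrite e0 => -[e1] e2; exists i.
    by rewrite -e0 -e1; case: (pos x i).
  rewrite nth_behead; have -> := IH j.+1 k; split=> -[i [e1 e2]].
    by exists i.+1; rewrite pos_consS e1.
  case: i e1 e2 => [|i]; first by rewrite pos0.
  rewrite pos_consS => -[e0]; rewrite e0 => e1 e2; exists i.
  by rewrite -e0 -e1; case: (pos x i).
case: j => [|j] /=.
  by split=> [[]//|[[|i] []]] //; rewrite pos_consN.
have -> := IH j k; split=> -[i [e1 e2]].
  by exists i.+1; rewrite pos_consN e1.
case: i e1 e2 => [|i]; first by rewrite pos0.
rewrite pos_consN => -[<- <-] e2; exists i.
by case: (pos x i).
Qed.

Lemma parse_flatten ws : parse (flatten [seq word w | w <- ws]) = ws.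
Proof.
elim: ws => //= w ws IH; elim: w => [|b w IHw] /=; first by rewrite IH.
by rewrite IHw.
Qed.

(** Offset 0 at the end means that the last word is terminated; exactly then can [x] be recovered
    from [parse x]. *)
Lemma pos_end x j : pos x (size x) = (j, 0) <->
  x = flatten [seq word w | w <- parse x] /\ size (parse x) = j.
Proof.
elim: x j => [|[c|] x IH] j /=; first by rewrite pos0; split=> [[<-]|[_ <-]].
  rewrite pos_consS; case e: (pos x (size x)) => [a b] /=; split.
    case: eqP => [//|a0] [<- b0]; have [+ _] := IH a; rewrite e b0 => /(_ erefl)[ex sz].
    by rewrite {1}ex; case: (parse x) sz a0 => [<- //|w ws] /= <- _; split.
  case E: (parse x) => [|w ws] /= [ex sz]; first by case: ex => ex; move: E; rewrite ex.
  have [_ h] := IH j; have : pos x (size x) = (j, 0).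
    by apply: h; rewrite E /= sz; split=> //; case: ex.
  by rewrite e => -[-> ->]; rewrite -sz.
rewrite pos_consN; case e: (pos x (size x)) => [a b] /=; split=> [[<- b0]|[ex <-]].
  by have [+ _] := IH a; rewrite e b0 => /(_ erefl) [ex sz]; rewrite -ex sz.
have [_ h] := IH (size (parse x)); rewrite e in h.
have {}h : (a, b) = (size (parse x), 0) by apply: h; split=> //; case: ex.
by case: h => -> ->.
Qed.

Lemma pos_end_flatten ws :
  let x := flatten [seq word w | w <- ws] in pos x (size x) = (size ws, 0).
Proof. by apply/pos_end; rewrite parse_flatten. Qed.

Section ParseDefinable.
Variable N : seq sigma -> nat.
Hypothesis N_size : forall x, size x < N x.
Let N0 x : 0 < N x. Proof. exact: leq_ltn_trans (N_size x). Qed.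
Notation definable := (definable N).

Lemma definable_pos d t u w : vterm d t -> vterm d u -> vterm d w ->
  definable d (fun x z e => pos x (t e) == (u e, w e)).
Proof.
move=> ht hu hw.
suff h : definable 3 (fun x z e => pos x (nth 0 e 0) == (nth 0 e 1, nth 0 e 2)).
  by apply: (definable_sub (a := fun e => [:: t e; u e; w e]) h); vlist.
(* [blank] marks the positions that carry a bit. In the recursion below, a terminator forgets the
   offset, a bit increments it, and beyond the input nothing changes. *)
pose blank x i := (onth x i == Some (Some true)) || (onth x i == Some (Some false)).
apply: (@definable_rec _ _ 3 (head 0) _ (fun x z e =>
  [&& nth 0 e 0 == 0, nth 0 e 1 == 0 & nth 0 e 2 == 0] ||
  exn (N x) (fun i => (i.+1 == nth 0 e 0) &&
    [|| [&& onth x i == Some None, nth 0 e 2 == 0 & exn (N x) (fun j => (j.+1 == nth 0 e 1) &&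
             exn (N x) (fun k => z 0 [:: i; j; k]))],
        blank x i && exn (N x) (fun k => (k.+1 == nth 0 e 2) && z 0 [:: i; nth 0 e 1; k]) |
        ~~ ((onth x i == Some None) || blank x i) && z 0 [:: i; nth 0 e 1; nth 0 e 2]]))).
  by rewrite /blank; dfn.
move=> x z Q e [se he] hQ; case: e se he hQ => [|i [|j [|k [|? ?]]]] //= _ /and4P[li lj lk _] hQ.
case: i li hQ => [|i] li hQ.
  by rewrite pos0 xpair_eqE (eq_sym 0 j) (eq_sym 0 k) orbC; case: exnP => // -[v _].
have Qi j' k' : j' < N x -> k' < N x -> Q [:: i; j'; k'] = (pos x i == (j', k')).
  by move=> lj' lk'; rewrite hQ //; split=> //=; rewrite lj' lk' (ltnW li).
have /andP[p1 p2] := pos_le x i.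
have l1 := leq_ltn_trans p1 (N_size x); have l2 := leq_ltn_trans p2 (N_size x).
pose B := [|| [&& onth x i == Some None, k == 0 & exn (N x) (fun j' => (j'.+1 == j) &&
             exn (N x) (fun k' => Q [:: i; j'; k']))],
        blank x i && exn (N x) (fun k' => (k'.+1 == k) && Q [:: i; j; k']) |
        ~~ ((onth x i == Some None) || blank x i) && Q [:: i; j; k]].
have eB : B = ((if onth x i is Some c then pos_step (pos x i) c else pos x i) == (j, k)).
  rewrite /B /blank; case: (onth x i) => [[[]|]|] /=; rewrite ?orbF ?Qi //.
  - apply/exnP/eqP => [[k' lk' /andP[/eqP <-]]|[<- <-]].
      by rewrite Qi // => /eqP ->.
    exists (pos x i).2; first by [].
    by rewrite eqxx Qi //= -surjective_pairing eqxx.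
  - apply/exnP/eqP => [[k' lk' /andP[/eqP <-]]|[<- <-]].
      by rewrite Qi // => /eqP ->.
    exists (pos x i).2; first by [].
    by rewrite eqxx Qi //= -surjective_pairing eqxx.
  apply/andP/eqP => [[/eqP -> /exnP[j' lj' /andP[/eqP <-] /exnP[k' lk']]]|[<- <-]].
    by rewrite Qi // => /eqP ->.
  split=> //; apply/exnP; exists (pos x i).1; first by [].
  rewrite eqxx; apply/exnP; exists (pos x i).2; first by [].
  by rewrite Qi //= -surjective_pairing eqxx.
rewrite posS -eB; apply/exnP/idP => [[i' _ /andP[/eqP[->]]]//|h].
by exists i; [exact: ltnW|rewrite eqxx].
Qed.

Ltac dfnp := repeat first [cbv beta; apply: definable_pos; vterm | dfn1].

Definition wbit (x : seq sigma) (j k : nat) : bool := nth false (nth [::] (parse x) j) k.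
Definition wlen (x : seq sigma) (j : nat) : nat := size (nth [::] (parse x) j).

Lemma pos_size_lt x i j k b : pos x i = (j, k) -> onth x i = Some (Some b) -> i < N x.
Proof. by move=> _ e; apply: leq_trans (N_size x); rewrite ltnW // ltnS -onthTE e. Qed.

Lemma definable_wbit d t u : vterm d t -> vterm d u ->
  definable d (fun x z e => wbit x (t e) (u e)).
Proof.
move=> ht hu; refine (definable_ext _ (definable_exn (P := fun x z i e =>
   (pos x i == (t e, u e)) && (onth x i == Some (Some true))) _)).
  move=> x z e _; apply/exnP/idP => [[i _ /andP[/eqP h1 /eqP h2]]|h].
    by case: ((parseP x (t e) (u e) true).2 (ex_intro _ i (conj h1 h2))).
  have h0 : u e < size (nth [::] (parse x) (t e)).
    by rewrite ltnNge; apply/negP => le; move: h; rewrite /wbit nth_default.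
  have [i [h1 h2]] := (parseP x (t e) (u e) true).1 (conj h0 h).
  by exists i; rewrite ?h1 ?h2 ?eqxx // (pos_size_lt h1 h2).
dfnp.
Qed.

Lemma definable_wlen d t u : vterm d t -> vterm d u ->
  definable d (fun x z e => u e < wlen x (t e)).
Proof.
move=> ht hu; refine (definable_ext _ (definable_exn (P := fun x z i e =>
   (pos x i == (t e, u e)) && ((onth x i == Some (Some true)) || (onth x i == Some (Some false)))) _)).
  move=> x z e _; apply/exnP/idP => [[i _ /andP[/eqP h1 /orP[]/eqP h2]]|h].
  - by case: ((parseP x (t e) (u e) true).2 (ex_intro _ i (conj h1 h2))).
  - by case: ((parseP x (t e) (u e) false).2 (ex_intro _ i (conj h1 h2))).
  have [i [h1 h2]] := (parseP x (t e) (u e) (wbit x (t e) (u e))).1 (conj h erefl).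
  exists i; rewrite ?h1 ?h2 ?eqxx ?(pos_size_lt h1 h2) //=.
  by case: (wbit _ _ _).
dfnp.
Qed.

(* [x] is a sequence of exactly [j] words. *)
Definition wcount (x : seq sigma) (j : nat) : bool := pos x (size x) == (j, 0).

(** Any position without a letter can stand for the end, [pos] being constant from there on; one
    exists in the domain since [size x < N x]. *)
Lemma definable_wcount d t : vterm d t -> definable d (fun x z e => wcount x (t e)).
Proof.
move=> ht; refine (definable_ext _ (definable_exn (P := fun x z i e =>
   alln (N x) (fun k => (k == 0) ==> (pos x i == (t e, k))) &&
   ~~ [|| onth x i == Some None, onth x i == Some (Some true) | onth x i == Some (Some false)]) _)).
  move=> x z e _; apply/exnP/idP => [[i _ /andP[/allnP/(_ 0 (N0 x)) h1 h2]]|h].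
    move: h1; rewrite /= pos_oversize // -onthNE.
    by move: h2; case: (onth x i) => [[[]|]|].
  exists (size x) => //; apply/andP; split.
    by apply/allnP => k _; apply/implyP => /eqP ->.
  by rewrite onth_default.
dfnp.
Qed.

End ParseDefinable.

(** * Decoding instances *)

Definition natval (s : seq bool) : nat := nval (size s) (nth false s).
Definition intval (s : seq bool) : int :=
  if head false s then (- Posz (natval (behead s)))%R else Posz (natval (behead s)).
Definition nat_word (s : seq bool) := last false s || (s == [:: false]).
Definition int_word (s : seq bool) :=
  (1 < size s) && (last false s || (s == [:: false; false])).

Lemma nat_bits_bit n : nat_bits n = [seq bit n i | i <- iota 0 (trunc_log 2 n).+1].
Proof. by []. Qed.

Lemma nat_bitsK n : natval (nat_bits n) = n.
Proof.
rewrite /natval size_map size_iota (@eq_nval _ _ (bit n)) => [|i lt_i].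
  by rewrite nval_bit modn_small // trunc_log_ltn.
by rewrite (nth_map 0) ?size_iota // nth_iota.
Qed.

Lemma last_nat_bits n : last false (nat_bits n) = (0 < n).
Proof.
rewrite /nat_bits -nth_last size_map size_iota succnK (nth_map 0) ?size_iota //.
rewrite nth_iota // add0n; case: n => [|n] //.
have /andP[le lt] : (2 ^ trunc_log 2 n.+1 <= n.+1) && (n.+1 < 2 ^ (trunc_log 2 n.+1).+1).
  by rewrite trunc_logP // trunc_log_ltn.
rewrite (_ : n.+1 %/ _ = 1) //; apply/eqP; rewrite eqn_leq -ltnS ltn_divLR ?expn_gt0 //.
by rewrite -expnS lt leq_divRL ?expn_gt0 // mul1n.
Qed.

Lemma natval_gt0 s : last false s -> 2 ^ (size s).-1 <= natval s.
Proof.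
case/lastP: s => // s b; rewrite last_rcons => b1.
rewrite /natval size_rcons nval_recr nth_rcons ltnn eqxx b1 mul1n leq_addl //.
Qed.

Lemma natvalK s : nat_word s -> nat_bits (natval s) = s.
Proof.
case/orP=> [l|/eqP ->]; last first.
  by rewrite /natval /nval big_ord_recl big_ord0.
have s0 : 0 < size s by case: s l.
have e : trunc_log 2 (natval s) = (size s).-1.
  by apply: trunc_log_eq => //; rewrite natval_gt0 // prednK // nval_lt.
apply: (@eq_from_nth _ false) => [|i]; rewrite size_map size_iota e prednK // => lt_i.
rewrite nat_bits_bit e prednK // (nth_map 0) ?size_iota // nth_iota // bit_nval //.
Qed.

Lemma int_bitsK z : intval (int_bits z) = z.
Proof. by rewrite /intval /= nat_bitsK; case: ifP; lia. Qed.

Lemma int_word_bits z : int_word (int_bits z).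
Proof.
rewrite /int_word /int_bits.
have [->|z0] := eqVneq z 0%R; first by [].
have := last_nat_bits `|z|; rewrite absz_gt0 z0; case E: (nat_bits `|z|) => [|b t] //= l.
by rewrite l.
Qed.

Lemma intvalK s : int_word s -> int_bits (intval s) = s.
Proof.
case: s => [|sg t] // /andP[/= t0 h]; have wt : nat_word t.
  case/orP: h => [l|/eqP[_ ->]] //; rewrite /nat_word; case: t t0 l => //= b t _ -> //.
have sg_pos : sg -> 0 < natval t.
  move=> sg1; have l : last false t.
    by case/orP: h => [|/eqP[]]; [case: t t0 wt|rewrite sg1].
  by apply: leq_trans (natval_gt0 l); rewrite expn_gt0.
rewrite /intval /int_bits /=; case: sg sg_pos {h} => [/(_ isT)|_].
  by move=> p; rewrite abszN absz_nat natvalK // oppr_lt0 ltz_nat p.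
by rewrite absz_nat natvalK.
Qed.

Lemma nth_flatten_uniform (T : Type) (x0 : T) k (ss : seq (seq T)) i r :
  all (fun s => size s == k) ss -> r < k ->
  nth x0 (flatten ss) (i * k + r) = nth x0 (nth [::] ss i) r.
Proof.
elim: ss i => [|s ss IH] i /=; first by rewrite !nth_nil.
move=> /andP[/eqP ss_k hk] lt_r; rewrite nth_cat ss_k.
case: i => [|i]; first by rewrite mul0n add0n lt_r.
by rewrite mulSn -addnA ltnNge leq_addr /= addKn IH.
Qed.

Lemma size_flatten_uniform (T : Type) k (ss : seq (seq T)) :
  all (fun s => size s == k) ss -> size (flatten ss) = size ss * k.
Proof.
elim: ss => //= s ss IH /andP[/eqP sk /IH e].
by rewrite size_cat sk e mulSn.
Qed.

Definition enc_words (V A : finType) (G : mwgraph V A) (i0 : V) (b : A -> bool)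
    (q : A -> int * nat) : seq (seq bool) :=
  [seq [seq (u, v) \in edges G | v <- enum V] | u <- enum V]
  ++ [seq v == i0 | v <- enum V]
  :: flatten [seq flatten [seq [:: int_bits (weight G a v); int_bits (prio G a v)]
                          | v <- enum V]
             ++ [:: [:: b a]; int_bits (q a).1; nat_bits (q a).2] | a <- enum A].

Lemma encodeE (V A : finType) (G : mwgraph V A) i0 b q :
  encode G i0 b q = flatten [seq word w | w <- enc_words G i0 b q].
Proof.
rewrite /encode /enc_words map_cat flatten_cat -map_comp /=; congr (_ ++ (_ ++ _)).
rewrite map_flatten -map_comp /=; elim: (enum A) => //= a s ->.
rewrite map_cat !flatten_cat /= cats0 -!catA; congr (_ ++ _).
by rewrite map_flatten -map_comp; elim: (enum V) => //= v t <-; rewrite -!catA.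
Qed.

(* Word [r] of the block of index [a]: weights and priorities alternate for
   [r < 2 * n]. *)
Definition widx (n a r : nat) : nat := n.+1 + (a * (2 * n + 3) + r).

Section NthWord.
Variables (V A : finType) (G : mwgraph V A) (i0 : V) (b : A -> bool) (q : A -> int * nat).
Let ws := enc_words G i0 b q.
Let n := #|V|.

Lemma size_block (a : A) :
  size (flatten [seq [:: int_bits (weight G a v); int_bits (prio G a v)] | v <- enum V]) = 2 * n.
Proof.
rewrite (@size_flatten_uniform _ 2) => [|]; last by apply/allP => _ /mapP[v _ ->].
by rewrite size_map -cardE mulnC.
Qed.

Lemma all_size_blocks : all (fun s : seq (seq bool) => size s == 2 * n + 3)
  [seq flatten [seq [:: int_bits (weight G a v); int_bits (prio G a v)] | v <- enum V]
             ++ [:: [:: b a]; int_bits (q a).1; nat_bits (q a).2] | a <- enum A].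
Proof. by apply/allP => _ /mapP[a _ ->]; rewrite size_cat size_block. Qed.

Lemma size_enc_words : size ws = n.+1 + #|A| * (2 * n + 3).
Proof.
rewrite size_cat /= size_map -cardE (size_flatten_uniform all_size_blocks).
by rewrite size_map -cardE addnS addSn.
Qed.

Lemma nth_row (u : V) (i := enum_rank u) : nth [::] ws i = [seq (u, v) \in edges G | v <- enum V].
Proof.
rewrite nth_cat size_map -cardE ltn_ord (nth_map u) -?cardE ?ltn_ord //.
by rewrite nth_enum_rank.
Qed.

Lemma nth_start : nth [::] ws n = [seq v == i0 | v <- enum V].
Proof. by rewrite nth_cat size_map -cardE ltnn subnn. Qed.

Lemma nth_widx (a : A) r : r < 2 * n + 3 -> nth [::] ws (widx n (enum_rank a) r) =
  nth [::] (flatten [seq [:: int_bits (weight G a v); int_bits (prio G a v)] | v <- enum V]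
             ++ [:: [:: b a]; int_bits (q a).1; nat_bits (q a).2]) r.
Proof.
move=> lt_r; rewrite [LHS]nth_cat size_map -cardE -/n /widx ltnNge addSn leqW ?leq_addr //=.
rewrite subSn ?leq_addr // addKn /= (nth_flatten_uniform _ _ all_size_blocks) //.
by rewrite (nth_map a) -?cardE ?ltn_ord // nth_enum_rank.
Qed.

Lemma nth_weight a v : nth [::] ws (widx n (enum_rank a) (2 * enum_rank v)) =
  int_bits (weight G a v).
Proof.
have lt_v : enum_rank v < n by apply: ltn_ord.
rewrite nth_widx; last by lia.
rewrite nth_cat size_block ifT ?ltn_pmul2l // -[2 * _]addn0 mulnC.
rewrite (@nth_flatten_uniform _ _ 2) //; last by apply/allP => _ /mapP[? _ ->].
by rewrite (nth_map v) -?cardE // nth_enum_rank.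
Qed.

Lemma nth_prio a v : nth [::] ws (widx n (enum_rank a) (2 * enum_rank v).+1) =
  int_bits (prio G a v).
Proof.
have lt_v : enum_rank v < n by apply: ltn_ord.
rewrite nth_widx; last by lia.
rewrite nth_cat size_block ifT; last by lia.
rewrite -addn1 mulnC (@nth_flatten_uniform _ _ 2) //; last by apply/allP => _ /mapP[? _ ->].
by rewrite (nth_map v) -?cardE // nth_enum_rank.
Qed.

Lemma nth_tail a r : r < 3 -> nth [::] ws (widx n (enum_rank a) (2 * n + r)) =
  nth [::] [:: [:: b a]; int_bits (q a).1; nat_bits (q a).2] r.
Proof.
move=> lt_r; rewrite nth_widx; last by rewrite ltn_add2l.
by rewrite nth_cat size_block ltnNge leq_addr /= addKn.
Qed.

End NthWord.

(* The condition [last false] excludes leading zeros and the value 0. *)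
Definition valid_words (w : nat -> seq bool) (n m v0 : nat) : Prop :=
  [/\ v0 < n, forall u, u <= n -> size (w u) = n,
      forall v, v < n -> nth false (w n) v = (v == v0) &
      forall a, a < m ->
        [/\ forall r, r < 2 * n -> int_word (w (widx n a r)),
            size (w (widx n a (2 * n + 0))) = 1,
            int_word (w (widx n a (2 * n + 1))) &
            last false (w (widx n a (2 * n + 2)))]].

Section Decode.
Variables (w : nat -> seq bool) (n m : nat).

Definition dec_graph : mwgraph 'I_n 'I_m :=
  MWGraph [set e : 'I_n * 'I_n | nth false (w e.1) e.2]
    (fun (a : 'I_m) (v : 'I_n) => intval (w (widx n a (2 * v))))
    (fun (a : 'I_m) (v : 'I_n) => intval (w (widx n a (2 * v).+1))).

Definition dec_bot (a : nat) : bool := nth false (w (widx n a (2 * n + 0))) 0.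
Definition dec_num (a : nat) : int := intval (w (widx n a (2 * n + 1))).
Definition dec_den (a : nat) : nat := natval (w (widx n a (2 * n + 2))).

End Decode.

Definition good_path (R : realType) (V A : finType) (G : mwgraph V A) (v0 : V)
    (b : A -> bool) (q : A -> int * nat) (pi : nat -> V) : Prop :=
  [/\ is_path G pi, ultimately_periodic pi, pi 0 = v0 &
    forall a, lex_lt (b a, (q a).1%:~R / (q a).2%:R)%R (pay R G a pi)].

Lemma up_comp (V W : Type) (f : V -> W) pi :
  ultimately_periodic pi -> ultimately_periodic (f \o pi).
Proof.
move=> [x0 [u [v [sv h]]]]; exists (f x0), (map f u), (map f v).
rewrite !size_map; split=> // i; rewrite /= h; case: ifP => lt_i; first by rewrite (nth_map x0).
by rewrite (nth_map x0) // ltn_pmod.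
Qed.

Lemma enc_words_valid (V A : finType) (G : mwgraph V A) (i0 : V) b q
    (ws := enc_words G i0 b q) : (forall a, 0 < (q a).2) ->
  valid_words (nth [::] ws) #|V| #|A| (enum_rank i0).
Proof.
move=> q0; split=> [|u|v lt_v|a lt_a]; first exact: ltn_ord.
- rewrite leq_eqVlt => /orP[/eqP ->|lt_u]; first by rewrite nth_start size_map -cardE.
  have -> : u = enum_rank (enum_val (Ordinal lt_u)) by rewrite enum_valK.
  by rewrite /ws nth_row size_map -cardE.
- have -> : v = enum_rank (enum_val (Ordinal lt_v)) by rewrite enum_valK.
  rewrite nth_start (nth_map i0) -?cardE ?ltn_ord //.
  by rewrite nth_enum_rank val_eqE (inj_eq enum_rank_inj).
have -> : a = enum_rank (enum_val (Ordinal lt_a)) by rewrite enum_valK.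
split=> [r lt_r|||]; try by rewrite nth_tail ?int_word_bits ?last_nat_bits.
have lt_v : r./2 < #|V| by rewrite -divn2; lia.
have := odd_double_half r; rewrite -mul2n.
have -> : r./2 = enum_rank (enum_val (Ordinal lt_v)) by rewrite enum_valK.
by case: (odd r) => <-; rewrite ?add0n ?add1n ?nth_prio ?nth_weight int_word_bits.
Qed.

(** The code forgets the names of vertices and indices. Decoding yields a copy of the instance on
    ordinals, to which the path is transported by [enum_rank]. *)
Lemma dec_enc_path (R : realType) (V A : finType) (G : mwgraph V A) (i0 : V) b q pi
    (w := nth [::] (enc_words G i0 b q)) :
  good_path R G i0 b q pi ->
  good_path R (dec_graph w #|V| #|A|) (enum_rank i0) (dec_bot w #|V|)
    (fun a => (dec_num w #|V| a, dec_den w #|V| a)) (@enum_rank V \o pi).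
Proof.
move=> [pth up pi0 lt_pay]; split=> [i||/=|a].
- rewrite inE /= /w nth_row (nth_map (pi 0)) -?cardE ?ltn_ord //.
  by rewrite nth_enum_rank; apply: pth.
- exact: up_comp.
- by rewrite pi0.
rewrite /dec_bot /dec_num /dec_den -(enum_valK a) /w !nth_tail //= nat_bitsK int_bitsK.
have := lt_pay (enum_val a).
have -> // : pay R G (enum_val a) pi =
   pay R (dec_graph w #|V| #|A|) (enum_rank (enum_val a)) (@enum_rank V \o pi).
congr (_, _).
  rewrite /parity (_ : prio _ _ \o (_ \o _) = prio G (enum_val a) \o pi) //.
  by apply/funext => i /=; rewrite /w nth_prio int_bitsK.
rewrite /mean_payoff; congr limn_inf; apply/funext => k; congr (_ * _)%R.
by apply: eq_bigr => j _ /=; rewrite /w nth_weight int_bitsK.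
Qed.

(** Here canonicity of the number codes matters: the words themselves have to be recovered, not
    merely their values. *)
Lemma enc_dec_words (ws : seq (seq bool)) n m (i0 : 'I_n)
    (w := nth [::] ws) (G := dec_graph w n m) :
  size ws = n.+1 + m * (2 * n + 3) -> valid_words w n m i0 ->
  enc_words G i0 (dec_bot w n) (fun a : 'I_m => (dec_num w n a, dec_den w n a)) = ws.
Proof.
move=> sz [_ szw w0 wa]; set E := enc_words _ _ _ _.
have szE : size E = n.+1 + m * (2 * n + 3) by rewrite size_enc_words !card_ord.
have rk k (u : 'I_k) : enum_rank u = u :> nat by rewrite enum_rank_ord.
apply: (@eq_from_nth _ [::]) => [|j]; first by rewrite szE.
rewrite szE => lt_j; rewrite -/(w j).
have [lt_jn|lt_nj|->] := ltngtP j n; first 1 last.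
- pose a := (j - n.+1) %/ (2 * n + 3); pose r := (j - n.+1) %% (2 * n + 3).
  have ej : j = widx n a r by rewrite /widx /a /r -divn_eq subnKC.
  have lt_r : r < 2 * n + 3 by apply: ltn_pmod; lia.
  have lt_a : a < m by rewrite /a ltn_divLR; lia.
  have [h1 h2 h3 h4] := wa a lt_a.
  have nE t : nth [::] E (widx n a t) = nth [::] E (widx #|'I_n| (enum_rank (Ordinal lt_a)) t).
    by rewrite rk card_ord.
  rewrite ej nE; have [lt_r2|ge_r2] := ltnP r (2 * n).
    have lt_v : r./2 < n by rewrite -divn2; lia.
    have := odd_double_half r; rewrite -mul2n.
    have hr := h1 r lt_r2.
    case: (odd r) => er; rewrite -er ?add0n ?add1n in hr *.
      have -> : (2 * r./2).+1 = (2 * enum_rank (Ordinal lt_v)).+1 by rewrite rk.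
      by rewrite nth_prio /= intvalK // rk.
    have -> : 2 * r./2 = 2 * enum_rank (Ordinal lt_v) by rewrite rk.
    by rewrite nth_weight /= intvalK // rk.
  have er : r = 2 * #|'I_n| + (r - 2 * n) by rewrite card_ord; lia.
  rewrite {1}er nth_tail; last by lia.
  have : r - 2 * n < 3 by lia.
  rewrite (_ : w _ = w (widx n a (2 * n + (r - 2 * n)))); last by rewrite subnKC.
  case: (r - 2 * n) => [|[|[|?]]] //= _.
  + by rewrite /dec_bot /=; case: (w _) h2 => [|c []].
  + by rewrite /dec_num /= intvalK.
  by rewrite /dec_den /= natvalK // /nat_word h4.
- have -> : n = #|'I_n| by rewrite card_ord.
  rewrite nth_start card_ord; apply: (@eq_from_nth _ false).
    by rewrite size_map size_enum_ord szw.
  move=> i; rewrite size_map size_enum_ord => lt_i.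
  by rewrite (nth_map i0) ?size_enum_ord // w0 // -val_eqE /= nth_enum_ord.
have -> : j = enum_rank (Ordinal lt_jn) by rewrite rk.
rewrite nth_row rk; apply: (@eq_from_nth _ false).
  by rewrite size_map size_enum_ord szw //= ltnW.
move=> i; rewrite size_map size_enum_ord => lt_i.
by rewrite (nth_map i0) ?size_enum_ord // inE /= nth_enum_ord.
Qed.

Definition word_of (x : seq sigma) (j : nat) : seq bool := nth [::] (parse x) j.

(** Since instances can be replaced by their copies on ordinals, the quantifiers over types and data
    become quantifiers over two numbers and a vertex, the rest being read off [x]. *)
Lemma language_words (R : realType) (x : seq sigma) :
  (exists (V A : finType) (G : mwgraph V A) (iota : V) (f : A -> omega R)
           (q : A -> int * nat),
      [/\ forall a, 0 < (q a).2 /\ ((f a).2 = (q a).1%:~R / (q a).2%:R)%R,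
          x = encode G iota (fun a => (f a).1) q
        & exists pi : nat -> V,
            [/\ is_path G pi, ultimately_periodic pi, pi 0 = iota
              & forall a, lex_lt (f a) (pay R G a pi)]]) <->
  exists n m (v0 : 'I_n), let w := word_of x in
    [/\ wcount x (n.+1 + m * (2 * n + 3)), valid_words w n m v0 &
      exists pi, good_path R (dec_graph w n m) v0 (dec_bot w n)
        (fun a : 'I_m => (dec_num w n a, dec_den w n a)) pi].
Proof.
split=> [[V [A [G [i0 [f [q [fq xE [pi [pth up pi0 lt_pay]]]]]]]]]|].
  exists #|V|, #|A|, (enum_rank i0).
  have gp : good_path R G i0 (fun a => (f a).1) q pi.
    split=> // a; have := lt_pay a; have [_ <-] := fq a; by case: (f a).
  rewrite /word_of xE encodeE parse_flatten; split.
  - by rewrite /wcount pos_end_flatten size_enc_words.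
  - by apply: enc_words_valid => a; have [] := fq a.
  by exists (@enum_rank V \o pi); apply: dec_enc_path.
move=> [n [m [v0 [/eqP/pos_end[xE sz] val [pi [pth up pi0 lt_pay]]]]]].
set w := word_of x in val pth lt_pay *.
exists 'I_n, 'I_m, (dec_graph w n m), v0.
exists (fun a : 'I_m => (dec_bot w n a, (dec_num w n a)%:~R / (dec_den w n a)%:R)%R).
exists (fun a : 'I_m => (dec_num w n a, dec_den w n a)); split=> [a|/=|].
- split=> //=; have [_ _ _ /(_ a (ltn_ord a))[_ _ _ h]] := val.
  by apply: leq_trans (natval_gt0 h); rewrite expn_gt0.
- by rewrite encodeE enc_dec_words.
by exists pi.
Qed.

(** * Circulations as certificates *)

Local Open Scope ring_scope.

Section Flows.
Variables (R : realType) (V A : finType) (G : mwgraph V A) (v0 : V).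
Variables (b : A -> bool) (q : A -> int * nat).
Hypothesis q_gt0 : forall a, (0 < (q a).2)%N.

(* Along a cycle the gains add up to a positive number iff the mean weight
   exceeds the threshold [q a]. *)
Definition gain a u : int := weight G a u * (q a).2%:Z - (q a).1.

Definition out (y : V -> V -> nat) u : nat := (\sum_v y u v)%N.

Definition edge_rel : rel V := fun u v => (u, v) \in edges G.

Definition index_ok (o : V -> nat) (a : A) : bool :=
  (~~ b a && top_even G o a) ||
  ((b a == top_even G o a) && (0 < \sum_u gain a u * (o u)%:Z)).

(* [y u v] is the number of traversals of the edge [(u, v)] by the cycle. *)
Definition flow_ok (y : V -> V -> nat) : Prop :=
  [/\ forall u v, (0 < y u v)%N -> edge_rel u v, balanced y,
    exists s, [/\ (0 < out y s)%N, connect edge_rel v0 s &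
      forall u, (0 < out y u)%N -> connect (fun u v => 0 < y u v)%N s u] &
    forall a, index_ok (out y) a].

Lemma out_gt0 (y : V -> V -> nat) u v : (0 < y u v)%N -> (0 < out y u)%N.
Proof. by move=> p; rewrite /out (bigD1 v) //= addn_gt0 p. Qed.

Lemma flow_of_path pi : good_path R G v0 b q pi -> exists y, flow_ok y.
Proof.
move=> [pth /ultimately_periodicP[k [p [p0 per]]] pi0 lt_pay].
(* Edges are counted over one period, which starts and ends at [pi k]. *)
pose y u v := (\sum_(j < p) ((pi (k + j) == u) && (pi (k + j).+1 == v)))%N.
have sum_eq (x : V) (c : bool) : (\sum_v (c && (x == v)) = c)%N.
  by rewrite (bigD1 x) //= eqxx andbT big1 ?addn0 // => v /negbTE; rewrite eq_sym => ->; rewrite andbF.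
have outE u : out y u = visits pi k p u.
  by rewrite /out /y exchange_big; apply: eq_bigr => j _; rewrite sum_eq.
have inE' u : (\sum_v y v u = visits pi k p u)%N.
  rewrite /y exchange_big /=.
  have -> : (\sum_(j < p) \sum_v ((pi (k + j) == v) && (pi (k + j).+1 == u)) =
     \sum_(j < p) (pi (k + j).+1 == u))%N.
    by apply: eq_bigr => j _; rewrite -[RHS](sum_eq (pi (k + j)%N)); apply: eq_bigr => v _; rewrite andbC.
  rewrite /visits -(big_mkord predT (fun j => nat_of_bool (pi (k + j).+1 == u))).
  rewrite -(big_mkord predT (fun j => nat_of_bool (pi (k + j)%N == u))).
  (* Inflow is a sum shifted by one position; its last term equals the first term of the outflow by
     periodicity. *)
  have [p' ep] : exists p', p = p'.+1 by exists p.-1; rewrite prednK.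
  rewrite ep big_nat_recr //= [RHS]big_nat_recl //= addn0 -addnS -ep per // addnC.
  by congr (_ + _)%N; apply: eq_bigr => j _; rewrite addnS.
have y_gt0 j : (j < p)%N -> (0 < y (pi (k + j)%N) (pi (k + j).+1))%N.
  by move=> lt_j; rewrite /y (bigD1 (Ordinal lt_j)) //= !eqxx.
have y_ex u v : (0 < y u v)%N -> exists2 j, pi (k + j)%N = u & pi (k + j).+1 = v.
  rewrite lt0n sum_nat_eq0 negb_forall => /existsP[j] /=.
  by rewrite eqb0 negbK => /andP[/eqP e1 /eqP e2]; exists j.
exists y; split.
- by move=> u v /y_ex[j <- <-]; apply: pth.
- by move=> u; rewrite [LHS]outE inE'.
- exists (pi k); split.
  + by rewrite outE; apply/visits_gt0; exists 0%N; rewrite ?addn0.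
  + rewrite -pi0; elim: k {per y sum_eq outE inE' y_gt0 y_ex} => [|k IH] //.
    by apply: connect_trans IH (connect1 (pth k)).
  move=> u; rewrite outE => /visits_gt0[j lt_j <-]; elim: j lt_j => [|j IH] lt_j.
    by rewrite addn0.
  rewrite addnS; apply: connect_trans (IH (ltnW lt_j)) (connect1 _).
  by apply: y_gt0; apply: ltnW.
move=> a; have := lt_pay a; rewrite (lex_lt_visits _ _ p0 per) //= /index_ok.
by have -> : out y = visits pi k p by apply/funext.
Qed.

Lemma path_of_flow y : flow_ok y -> exists pi, good_path R G v0 b q pi.
Proof.
move=> [ye bal [s [os /connectP[p pth es] conn]] idx].
have conn' u v : (0 < y u v)%N -> connect (fun u v => 0 < y u v)%N s u.
  by move=> /out_gt0; apply: conn.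
have [c [cl usesE]] := closed_walk_exists bal conn'.
have pthc : path edge_rel s c by apply: uses_path => u v; rewrite usesE; apply: ye.
have outE u : out y u = count_mem u (belast s c).
  by rewrite -uses_out; apply: eq_bigr => v _; rewrite usesE.
have c0 : (0 < size c)%N by case: (c) (outE s) os => [|? ?] //= ->.
pose w j := nth s (s :: c) j.
have wl : w (size c) = w 0%N by have := nth_last s (s :: c); rewrite /w /= cl.
have we j : (j < size c)%N -> edge_rel (w j) (w j.+1).
  by move=> lt_j; move/pathP: pthc; apply.
(* The path [p] from [v0] to [s] followed by endless rounds of [c]. Position [size p] already
   belongs to the cycle; [piS] says that both descriptions give the same vertex there. *)
pose pi i := if (i < size p)%N then nth s (v0 :: p) i else w ((i - size p) %% size c)%N.
have pik : periodic_from (size p) (size c) pi.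
  move=> i le_i; rewrite /pi !ifF; try by lia.
  by rewrite -addnBAC // modnDr.
have piS : pi (size p) = nth s (v0 :: p) (size p).
  by have := nth_last s (v0 :: p); rewrite /pi ltnn subnn mod0n /w /= -es => ->.
exists pi; split.
- move=> i; rewrite -/(edge_rel _ _); case: (ltnP i (size p)) => [lt_i|ge_i].
    have -> : pi i.+1 = nth s (v0 :: p) i.+1.
      by move: lt_i; rewrite leq_eqVlt => /orP[/eqP -> //|lt]; rewrite /pi lt.
    by rewrite {1}/pi lt_i; move/pathP: pth; apply.
  rewrite /pi !ifF; try by lia.
  set j := (i - size p)%N; have -> : (i.+1 - size p = j.+1)%N by rewrite subSn.
  have lt_j : (j %% size c < size c)%N by apply: ltn_pmod.
  suff -> : w (j.+1 %% size c)%N = w (j %% size c).+1 by apply: we.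
  rewrite -addn1 -modnDml addn1.
  move: lt_j; rewrite leq_eqVlt => /orP[/eqP ->|lt]; first by rewrite modnn wl.
  by rewrite modn_small.
- by apply/ultimately_periodicP; exists (size p), (size c).
- by have [p0|p0] := posnP (size p); [move: piS; rewrite p0|rewrite /pi p0].
move=> a; rewrite (lex_lt_visits _ _ c0 pik) //.
have -> : visits pi (size p) (size c) = out y.
  apply/funext => u; rewrite outE /visits.
  rewrite -sum1_count [RHS]big_mkcond [RHS](big_nth s) size_belast [RHS]big_mkord; apply: eq_bigr => j _.
  rewrite /pi ltnNge leq_addr /= addKn modn_small //.
  by rewrite /w lastI nth_rcons size_belast ltn_ord; case: eqP.
exact: idx.
Qed.

Lemma top_even_supp (o o' : V -> nat) a : (forall u, (0 < o u)%N = (0 < o' u)%N) ->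
  top_even G o a = top_even G o' a.
Proof.
move=> h; apply: eq_existsb => u; rewrite h; congr [&& _, _ & _].
by apply: eq_forallb => u'; rewrite h.
Qed.

Section SmallFlow.
Variables (y0 : V -> V -> nat) (C : int).
Hypotheses (ok0 : flow_ok y0) (C1 : 1 <= C) (gainC : forall a u, `|gain a u| <= C).

Let E (e : V * V) : bool := (0 < y0 e.1 e.2)%N.
(** The mean-payoff constraints to be preserved; an index outside [pos] meets its threshold by
    parity alone. *)
Let pos a : bool := 0 < \sum_u gain a u * (out y0 u)%:Z.

(* One conservation equation per vertex; for each index with positive total gain
   a slack variable turns positivity into an equation with right-hand side 1.
   The unknowns are [y - 1] on the edges with [0 < y0], which preserves the
   support. *)
Let coefE (i : V + A) (e : V * V) : int :=
  if E e then
    match i with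
    | inl u => (e.1 == u)%:R - (e.2 == u)%:R
    | inr a => gain a e.1 *+ pos a
    end
  else 0.

Let coef (i : V + A) (j : V * V + A) : int :=
  match j with
  | inl e => coefE i e
  | inr a => if i is inr a' then - (pos a && (a == a'))%:R else 0
  end.

Let rhs (i : V + A) : int :=
  (if i is inr a then (pos a)%:R else 0) - \sum_e coefE i e.

Lemma sum_coefE (y : V -> V -> nat) i : (forall u v, ~~ E (u, v) -> y u v = 0%N) ->
  \sum_e coefE i e * (y e.1 e.2)%:Z =
  match i with
  | inl u => (out y u)%:Z - (\sum_v y v u)%N%:Z
  | inr a => (\sum_u gain a u * (out y u)%:Z) *+ pos a
  end.
Proof.
move=> sy; have sumZ (I : finType) (F : I -> nat) : (\sum_i F i)%N%:Z = \sum_i (F i)%:Z.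
  exact: (big_morph Posz PoszD).
have -> : \sum_e coefE i e * (y e.1 e.2)%:Z = \sum_u \sum_v match i with
    | inl w => (u == w)%:R - (v == w)%:R
    | inr a => gain a u *+ pos a
    end * (y u v)%:Z.
  rewrite pair_bigA; apply: eq_bigr => -[u v] _; rewrite /coefE /=.
  by case: ifP => // /negbT/sy ->; rewrite !mulr0.
case: i => [w|a].
  transitivity (\sum_u \sum_v (u == w)%:R * (y u v)%:Z - \sum_u \sum_v (v == w)%:R * (y u v)%:Z).
    by rewrite -sumrB; apply: eq_bigr => u _; rewrite -sumrB; apply: eq_bigr => v _; rewrite mulrBl.
  congr (_ - _).
    rewrite (bigD1 w) //= [X in _ + X]big1 ?addr0 => [|u /negbTE ->].
      by rewrite sumZ; apply: eq_bigr => v _; rewrite eqxx mul1r.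
    by rewrite big1 // => v _; rewrite mul0r.
  rewrite exchange_big (bigD1 w) //= [X in _ + X]big1 ?addr0 => [|u /negbTE ->].
    by rewrite sumZ; apply: eq_bigr => v _; rewrite eqxx mul1r.
  by rewrite big1 // => v _; rewrite mul0r.
rewrite -sumrMnl; apply: eq_bigr => u _; rewrite sumZ mulr_sumr -sumrMnl.
by apply: eq_bigr => v _; rewrite mulrnAl.
Qed.

(** The passage to [y - 1] puts a sum of coefficients over all pairs of vertices into the right-hand
    side; the summand 1 is for the slack equations. *)
Let K : int := 1 + C * (#|V| * #|V|)%:R.

Lemma coefE_le i e : `|coefE i e| <= C.
Proof.
rewrite /coefE; case: ifP => _; last by rewrite normr0; lia.
case: i => [u|a]; first by apply: le_trans C1; case: eqP; case: eqP.
by case: (pos a); rewrite ?mulr1n ?mulr0n ?normr0 //; lia.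
Qed.

Lemma le_C_K : C <= K.
Proof.
have : (0 < #|V| * #|V|)%N by rewrite muln_gt0 andbb; apply/card_gt0P; exists v0.
by rewrite /K -(ltr_nat int) => h; have := C1; nia.
Qed.

Lemma coef_le i j : `|coef i j| <= K.
Proof.
apply: le_trans le_C_K; case: j => [e|a]; first exact: coefE_le.
by apply: le_trans C1; case: i => [u|a'] //=; case: (_ && _).
Qed.

Lemma rhs_le i : `|rhs i| <= K.
Proof.
rewrite /rhs; apply: le_trans (ler_normB _ _) _; apply: lerD.
  by case: i => [u|a] //; case: (pos a).
apply: le_trans (ler_norm_sum _ _ _) _.
have -> : C * (#|V| * #|V|)%:R = \sum_(e : V * V) C by rewrite sumr_const card_prod mulr_natr.
by apply: ler_sum => e _; apply: coefE_le.
Qed.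

Lemma small_flow : exists2 y, flow_ok y &
  forall u v, (y u v)%:Z <= 2 * ((#|V| + #|A|)`!%:R * K ^+ (#|V| + #|A|)).
Proof.
have [ye bal [s [os cs conn]] idx] := ok0.
(* The given flow, however large, shows that the system is solvable; each slack variable takes the
   excess of its total gain over 1. *)
pose z (j : V * V + A) : int := match j with
  | inl e => (y0 e.1 e.2).-1%:Z
  | inr a => if pos a then \sum_u gain a u * (out y0 u)%:Z - 1 else 0 end.
have K1 : 1 <= K by apply: le_trans C1 le_C_K.
have z0 j : 0 <= (z j)%:~R :> rat.
  rewrite ler0z; case: j => [e|a] //=; case: ifP => // p; by rewrite subr_ge0 -gtz0_ge1; exact: p.
have coefA (x : V * V + A -> int) i : \sum_j coef i j * x j = \sum_e coefE i e * x (inl e) -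
    (if i is inr a then x (inr a) *+ pos a else 0).
  rewrite big_sumType /=; congr (_ + _); case: i => [u|a].
    by rewrite big1 ?oppr0 // => a _; rewrite mul0r.
  rewrite (bigD1 a) //= eqxx andbT [X in _ + X]big1 ?addr0 => [|a' /negbTE ->].
    by case: (pos a); rewrite ?mulr1n ?mulr0n; ring.
  by rewrite andbF oppr0 mul0r.
have zsol i : \sum_j (coef i j)%:~R * (z j)%:~R = (rhs i)%:~R :> rat.
  under eq_bigr do rewrite -rmorphM; rewrite -rmorph_sum /= coefA; congr (_%:~R).
  have -> : \sum_e coefE i e * z (inl e) = \sum_e coefE i e * (y0 e.1 e.2)%:Z - \sum_e coefE i e.
    rewrite -sumrB; apply: eq_bigr => e _; rewrite /coefE /z.
    case: ifP => [Ee|_]; last by rewrite !mul0r subr0.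
    by rewrite -[X in _ = _ - X]mulr1 -mulrBr; congr (_ * _); move: Ee; rewrite /E; lia.
  rewrite sum_coefE => [|u v]; last by rewrite /E /= -eqn0Ngt => /eqP.
  rewrite /rhs; case: i => [u|a]; first by rewrite /out bal subrr; ring.
  by rewrite /z; case: (pos a); rewrite ?mulr1n ?mulr0n; ring.
have [D [x [D0 leD lex sol]]] := small_solution K1 coef_le rhs_le z0 zsol.
(* The rational flow on the support is 1 plus [x] divided by [D]; multiplied by [D] it is integral
   with unchanged support. *)
pose y u v := if E (u, v) then (D + x (inl (u, v)))%N else 0%N.
have yS u v : ~~ E (u, v) -> y u v = 0%N by rewrite /y => /negbTE ->.
have y_gt0 u v : (0 < y u v)%N = (0 < y0 u v)%N.
  by rewrite /y /E /=; case: ifP => //; rewrite addn_gt0 D0.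
have out_pos u : (0 < out y u)%N = (0 < out y0 u)%N.
  rewrite !lt0n !sum_nat_eq0; congr (~~ _); apply: eq_forallb => v /=.
  by rewrite !eqn0Ngt y_gt0.
have sum_y i : \sum_e coefE i e * (y e.1 e.2)%:Z =
    (if i is inr a then (D%:Z + (x (inr a))%:Z) *+ pos a else 0).
  have -> : \sum_e coefE i e * (y e.1 e.2)%:Z =
      D%:Z * \sum_e coefE i e + \sum_e coefE i e * (x (inl e))%:Z.
    rewrite mulr_sumr -big_split; apply: eq_bigr => -[u v] _ /=; rewrite /y /coefE.
    by case: ifP => _; rewrite ?mul0r ?mulr0 ?addr0 // PoszD; ring.
  have := sol i; rewrite coefA /rhs; case: i => [u|a] h.
    by move: h; rewrite subr0 => ->; ring.
  move/eqP: h; rewrite subr_eq => /eqP ->.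
  by case: (pos a); rewrite ?mulr1n ?mulr0n; ring.
exists y.
  split.
  - by move=> u v; rewrite y_gt0; apply: ye.
  - move=> u; have := sum_y (inl u); rewrite sum_coefE // => /eqP.
    by rewrite subr_eq0 => /eqP[].
  - exists s; split=> //; first by rewrite out_pos.
    move=> u; rewrite out_pos => /conn; congr is_true.
    by apply: eq_connect => u' v'; rewrite y_gt0.
  move=> a; have := idx a; rewrite /index_ok (top_even_supp (o' := out y0)) //.
  (* Parity is inherited with the support. For an index in [pos] the total gain of [y] is [D] plus a
     nonnegative slack, hence positive. *)
  case/orP=> [->//|/andP[-> /= p]]; apply/orP; right.
  have := sum_y (inr a); rewrite sum_coefE // /pos p !mulr1n => ->.
  by rewrite ltr_wpDr.
move=> u v; rewrite /y -card_sum mulrDl mul1r; case: ifP => _.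
  by rewrite PoszD lerD.
by rewrite addr_ge0 // mulr_ge0 ?ler0n // exprn_ge0 //; apply: le_trans K1.
Qed.

End SmallFlow.
End Flows.

(** * Definability of the certificate check *)

Local Open Scope nat_scope.

Section Check.
Variable N : seq sigma -> nat.
Hypothesis N_size : forall x, size x < N x.
Let N0 x : 0 < N x. Proof. exact: leq_ltn_trans (N_size x). Qed.
Notation definable := (definable N).
Notation graph := (graph N).
Notation number := (number N).
Implicit Types (x : seq sigma) (z : rels).

Lemma size_parse x : size (parse x) <= size x.
Proof.
elim: x => [|[c|] x IH] //=; case: (parse x) IH => [|w ws] //=.
by move/leqW.
Qed.

Lemma size_parse_word x j : size (nth [::] (parse x) j) <= size x.
Proof.
elim: x j => [|[c|] x IH] j /=; first by rewrite nth_nil.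
  case E: (parse x) IH => [|w ws] IH; case: j => [|j] //=; rewrite ?nth_nil //.
    by have := IH 0.
  by apply: leqW; have := IH j.+1.
by case: j => [|j] //=; apply: leqW.
Qed.

Lemma word_oversize x j : N x <= j -> nth [::] (parse x) j = [::].
Proof.
by move=> le; rewrite nth_default // (leq_trans (size_parse x)) // ltnW // (leq_trans (N_size x)).
Qed.

Lemma graph_behead d g : graph d g -> graph d.+1 (fun x z e => g x z (behead e)).
Proof.
move=> hg; have va : vlist d.+2 d.+1 (fun e => head 0 e :: behead (behead e)) by vlist.
exact: (definable_sub hg va).
Qed.

Lemma definable_wbit_graph d g t : graph d g -> vterm d t ->
  definable d (fun x z e => wbit x (g x z e) (t e)).
Proof.
move=> hg ht; apply: (definable_graph (Q := fun x z j e => wbit x j (t e)) hg).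
  move=> x z e _; case: (ltnP (g x z e) (N x)) => [|le]; [by left|right].
  by rewrite /wbit word_oversize // nth_nil.
by apply: definable_wbit => //; [vterm|apply: vterm_behead].
Qed.

Lemma definable_wlen_graph d g t : graph d g -> vterm d t ->
  definable d (fun x z e => t e < wlen x (g x z e)).
Proof.
move=> hg ht; apply: (definable_graph (Q := fun x z j e => t e < wlen x j) hg).
  move=> x z e _; case: (ltnP (g x z e) (N x)) => [|le]; [by left|right].
  by rewrite /wlen word_oversize.
by apply: definable_wlen => //; [vterm|apply: vterm_behead].
Qed.

Lemma wlen_lt x j : wlen x j < N x.
Proof. exact: leq_ltn_trans (size_parse_word x j) (N_size x). Qed.

Lemma wbitE x j k : wbit x j k -> k < wlen x j.
Proof. by rewrite ltnNge => h; apply/negP => le; move: h; rewrite /wbit nth_default. Qed.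

Lemma definable_wlast d g : graph d g ->
  definable d (fun x z e => last false (nth [::] (parse x) (g x z e))).
Proof.
move=> hg; refine (definable_ext _ (definable_exn (P := fun x z k e =>
  wbit x (g x z e) k && alln (N x) (fun i => (i < wlen x (g x z e)) ==> (i <= k))) _)).
  move=> x z e _; set s := nth _ _ _.
  apply/exnP/idP => [[k _ /andP[sk /allnP h]]|l].
    have lt_k := wbitE sk; have := h (size s).-1; rewrite /wlen -/s in lt_k *.
    have lt_s : (size s).-1 < N x by apply: leq_ltn_trans (wlen_lt x (g x z e)); rewrite leq_pred.
    rewrite lt_s prednK ?(leq_ltn_trans _ lt_k) // leqnn /= => /(_ isT) le.
    rewrite -nth_last (_ : (size s).-1 = k) //; lia.
  have s0 : 0 < size s by case: (s) l.
  exists (size s).-1.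
    by apply: leq_ltn_trans (wlen_lt x (g x z e)); rewrite leq_pred.
  rewrite /wbit -/s nth_last l; apply/allnP => i _; apply/implyP.
  by rewrite /wlen -/s; lia.
by dfn; [apply: definable_wbit_graph; [apply: graph_behead|vterm]|
  apply: definable_wlen_graph; [exact: (graph_behead (graph_behead hg))|vterm]].
Qed.

Lemma definable_intw d g : graph d g ->
  definable d (fun x z e => int_word (nth [::] (parse x) (g x z e))).
Proof.
move=> hg; refine (definable_ext _ (definable_and (definable_exn (P := fun x z i e =>
    (i == 1) && (i < wlen x (g x z e))) _)
  (definable_or (definable_wlast hg) (definable_and (definable_alln (P := fun x z i e =>
     (i < wlen x (g x z e)) ==> ((i == 0) || (i == 1))) _)
     (definable_alln (P := fun x z i e => ~~ wbit x (g x z e) i) _))))).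
  move=> x z e _; rewrite /int_word /wlen /wbit; set s := nth _ _ _.
  have lt_s := wlen_lt x (g x z e); rewrite /wlen -/s in lt_s.
  have -> : exn (N x) (fun i => (i == 1) && (i < size s)) = (1 < size s).
    apply/exnP/idP => [[i _ /andP[/eqP ->]]//|s1].
    by exists 1 => //; apply: leq_trans lt_s; apply: ltnW.
  case s1: (1 < size s) => //=; congr (_ || _).
  apply/andP/eqP => [[/allnP h1 /allnP h2]|->]; last first.
    by split; apply/allnP => -[|[|i]] _ //=; rewrite nth_nil.
  have sz : size s = 2.
    apply/eqP; rewrite eqn_leq s1 andbT leqNgt; apply/negP => s2.
    by have := h1 2 (ltn_trans s2 lt_s); rewrite s2.
  have l2 : 2 < N x by rewrite -sz.
  case: (s) sz h2 => [|a [|b [|? ?]]] //= _ h2.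
  by have := h2 0 (N0 x); have := h2 1 (ltnW l2); rewrite /=; case: a {h2}; case: b.
all: dfn.
- by apply: definable_wlen_graph; [apply: graph_behead|vterm].
- by apply: definable_wlen_graph; [apply: graph_behead|vterm].
by apply: definable_wbit_graph; [apply: graph_behead|vterm].
Qed.

Definition mag x j := nval (N x) (fun i => wbit x j i.+1).
Definition natmag x j := nval (N x) (wbit x j).

Lemma number_natmag d g : graph d g -> number d (fun x z e => natmag x (g x z e)).
Proof.
move=> hg; apply: (number_nval N0 (P := fun x z i e => wbit x (g x z e) i)).
by apply: definable_wbit_graph; [apply: graph_behead|vterm].
Qed.

Lemma definable_wbitS d g t : graph d g -> vterm d t ->
  definable d (fun x z e => wbit x (g x z e) (t e).+1).
Proof.
move=> hg ht; refine (definable_ext _ (definable_exn (P := fun x z k e =>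
  ((t e).+1 == k) && wbit x (g x z e) k) _)).
  move=> x z e _; apply/exnP/idP => [[k _ /andP[/eqP ->]]//|h].
  exists (t e).+1; last by rewrite eqxx.
  by apply: ltn_trans (wbitE h) (wlen_lt _ _).
by dfn; apply: definable_wbit_graph; [apply: graph_behead|vterm].
Qed.

Lemma number_mag d g : graph d g -> number d (fun x z e => mag x (g x z e)).
Proof.
move=> hg; apply: (number_nval N0 (P := fun x z i e => wbit x (g x z e) i.+1)).
by apply: definable_wbitS; [apply: graph_behead|vterm].
Qed.

Definition wneg x j := wbit x j 0.

Lemma definable_wneg d g : graph d g -> definable d (fun x z e => wneg x (g x z e)).
Proof.
move=> hg; refine (definable_ext _ (definable_exn (P := fun x z k e =>
  (k == 0) && wbit x (g x z e) k) _)).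
  move=> x z e _; apply/exnP/idP => [[k _ /andP[/eqP ->]]//|h].
  by exists 0; rewrite ?eqxx.
by dfn; apply: definable_wbit_graph; [apply: graph_behead|vterm].
Qed.

Lemma graph_ext d g h : (forall x z e, in_dom N x d e -> g x z e = h x z e) -> graph d g -> graph d h.
Proof. by move=> gh; apply: definable_ext => x z e he; rewrite (gh _ _ _ (in_dom_behead he)). Qed.

Lemma graph_widx d n a g : vterm d n -> vterm d a -> graph d g ->
  graph d (fun x z e => widx (n e) (a e) (g x z e)).
Proof.
move=> hn ha hg; refine (graph_ext _ (graph_add N0 (graph_add N0 (graph_vterm N hn) (graph_const N0 d 1))
  (graph_add N0 (graph_mul N0 (graph_vterm N ha) (graph_add N0
     (graph_mul N0 (graph_const N0 d 2) (graph_vterm N hn)) (graph_const N0 d 3))) hg))).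
by move=> x z e _; rewrite addn1.
Qed.

(* The relation [z 0] lists the bits of a circulation; only those at positions
   [i] with [2 * i < N x] count, so that no total exceeds [2 ^ N x]. *)
Definition flow_bit x z n u v i :=
  [&& u < n, v < n, exn (N x) (fun k => i + i == k) & z 0 [:: u; v; i]].
Definition flow x z n u v := nval (N x) (flow_bit x z n u v).
Definition flow_supp x z n u v := exn (N x) (flow_bit x z n u v).
Definition flow_out x z n u := \sum_(0 <= v < N x) flow x z n u v.
Definition flow_in x z n u := \sum_(0 <= v < N x) flow x z n v u.
Definition visited x z n u := exn (N x) (flow_supp x z n u).

Lemma definable_flow_bit d n u v i : vterm d n -> vterm d u -> vterm d v -> vterm d i ->
  definable d (fun x z e => flow_bit x z (n e) (u e) (v e) (i e)).
Proof.
move=> hn hu hv hi; rewrite /flow_bit; dfn.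
by apply: definable_add => //; vterm.
Qed.

Lemma number_flow d n u v : vterm d n -> vterm d u -> vterm d v ->
  number d (fun x z e => flow x z (n e) (u e) (v e)).
Proof.
move=> hn hu hv; apply: (number_nval N0 (P := fun x z i e => flow_bit x z (n e) (u e) (v e) i)).
by apply: definable_flow_bit; vterm.
Qed.

Lemma definable_flow_supp d n u v : vterm d n -> vterm d u -> vterm d v ->
  definable d (fun x z e => flow_supp x z (n e) (u e) (v e)).
Proof.
by move=> hn hu hv; apply: definable_exn; apply: definable_flow_bit; vterm.
Qed.

Lemma definable_visited d n u : vterm d n -> vterm d u ->
  definable d (fun x z e => visited x z (n e) (u e)).
Proof.
by move=> hn hu; apply: definable_exn; apply: definable_flow_supp; vterm.
Qed.

Lemma number_flow_out d n u : vterm d n -> vterm d u ->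
  number d (fun x z e => flow_out x z (n e) (u e)).
Proof.
move=> hn hu; apply: (number_sum N0 (F := fun x z v e => flow x z (n e) (u e) v)).
by apply: number_flow; vterm.
Qed.

Lemma number_flow_in d n u : vterm d n -> vterm d u ->
  number d (fun x z e => flow_in x z (n e) (u e)).
Proof.
move=> hn hu; apply: (number_sum N0 (F := fun x z v e => flow x z (n e) v (u e))).
by apply: number_flow; vterm.
Qed.

Section Reach.
Variable Ed : seq sigma -> rels -> nat -> nat -> nat -> bool.
Hypothesis hEd : forall d n u v, vterm d n -> vterm d u -> vterm d v ->
  definable d (fun x z e => Ed x z (n e) (u e) (v e)).
Hypothesis Ed_rels : forall x z Q n u v, Ed x (fun k => rels_cons Q z k.+1) n u v = Ed x z n u v.

(** Counting the steps makes reachability recursive along [t]. The bare closure equation could have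
    several solutions on cycles and would not qualify as an auxiliary definition. *)
Fixpoint walk_of x z n t s v : bool :=
  if t is t'.+1 then exn (N x) (fun v' => walk_of x z n t' s v' && Ed x z n v' v)
  else s == v.

Definition reaches x z n s v := exn (N x) (fun t => walk_of x z n t s v).

Lemma definable_reaches d n s v : vterm d n -> vterm d s -> vterm d v ->
  definable d (fun x z e => reaches x z (n e) (s e) (v e)).
Proof.
move=> hn hs hv.
have h : definable 4 (fun x z e => walk_of x z (nth 0 e 3) (nth 0 e 0) (nth 0 e 2) (nth 0 e 1)).
  apply: (definable_rec (mu := head 0) (F := fun x z e =>
    ((nth 0 e 0 == 0) && (nth 0 e 2 == nth 0 e 1)) ||
    exn (N x) (fun t => (t.+1 == nth 0 e 0) && exn (N x) (fun v' =>
       z 0 [:: t; v'; nth 0 e 2; nth 0 e 3] && Ed x (fun k => z k.+1) (nth 0 e 3) v' (nth 0 e 1))))).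
    dfn.
    have hE : definable 3 (fun x z e => Ed x z (nth 0 e 0) (nth 0 e 1) (nth 0 e 2)).
      by apply: hEd; vterm.
    have va : vlist 6 3 (fun e => [:: nth 0 (behead (behead e)) 3; head 0 e; nth 0 (behead (behead e)) 1]).
      by vlist.
    exact: (definable_sub (definable_rename succn hE) va).
  move=> x z Q e [se he] hQ; case: e se he hQ => [|t [|v' [|s' [|n' [|? ?]]]]] //= _.
  move=> /and5P[lt lv ls ln _] hQ; case: t lt hQ => [|t] lt hQ /=.
    by rewrite orbC; case: exnP => // -[t _].
  have eqE : exn (N x) (fun v1 => Q [:: t; v1; s'; n'] && Ed x (fun k => rels_cons Q z k.+1) n' v1 v') =
      exn (N x) (fun v1 => walk_of x z n' t s' v1 && Ed x z n' v1 v').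
    apply: eq_exn => v1 lt1; rewrite Ed_rels hQ //; split=> //=.
    by rewrite (ltnW lt) lt1 ls ln.
  rewrite -eqE; apply/exnP/idP => [[t' _ /andP[/eqP[->]]]//|h].
  by exists t; rewrite ?eqxx // ltnW.
apply: definable_exn.
have va : vlist d.+1 4 (fun e => [:: head 0 e; v (behead e); s (behead e); n (behead e)]) by vlist.
exact: (definable_sub h va).
Qed.

End Reach.
End Check.

Section Check.
Variable N : seq sigma -> nat.
Hypothesis N_size : forall x, size x < N x.
Let N0 x : 0 < N x. Proof. exact: leq_ltn_trans (N_size x). Qed.
Notation definable := (definable N).
Notation graph := (graph N).
Notation number := (number N).
Notation mag := (mag N).
Notation natmag := (natmag N).
Notation flow_out := (flow_out N).
Notation flow_in := (flow_in N).
Notation visited := (visited N).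
Implicit Types (x : seq sigma) (z : rels).

Definition int_le x j' j := if wneg x j' then ~~ wneg x j || (mag x j <= mag x j')
  else ~~ wneg x j && (mag x j' <= mag x j).

Lemma definable_mag_le d g h : graph d g -> graph d h ->
  definable d (fun x z e => mag x (g x z e) <= mag x (h x z e)).
Proof.
move=> hg hh; apply: definable_ext (definable_not (definable_ltnum
  (number_mag N_size hh) (number_mag N_size hg))) => x z e _.
by rewrite !modn_small ?nval_lt // -leqNgt.
Qed.

Lemma definable_int_le d g h : graph d g -> graph d h ->
  definable d (fun x z e => int_le x (g x z e) (h x z e)).
Proof.
move=> hg hh; have dg := definable_wneg N_size hg; have dh := definable_wneg N_size hh.
apply: definable_ext (definable_or
  (definable_and dg (definable_or (definable_not dh) (definable_mag_le hh hg)))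
  (definable_and (definable_not dg) (definable_and (definable_not dh) (definable_mag_le hg hh))))
  => x z e _.
by rewrite /int_le; case: (wneg x (g x z e)); rewrite ?orbF.
Qed.

Definition wweight n a u := widx n a (2 * u).
Definition wprio n a u := widx n a (2 * u).+1.
Definition wtail n a r := widx n a (2 * n + r).

Lemma graph_double d u : vterm d u -> graph d (fun x z e => 2 * u e).
Proof. by move=> hu; apply: graph_mul => //; [apply: graph_const|apply: graph_vterm]. Qed.

Lemma graph_wweight d n a u : vterm d n -> vterm d a -> vterm d u ->
  graph d (fun x z e => wweight (n e) (a e) (u e)).
Proof. by move=> hn ha hu; apply: graph_widx => //; apply: graph_double. Qed.

Lemma graph_wprio d n a u : vterm d n -> vterm d a -> vterm d u ->
  graph d (fun x z e => wprio (n e) (a e) (u e)).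
Proof.
move=> hn ha hu; refine (graph_ext _ (graph_widx N_size hn ha
  (graph_add N0 (graph_double hu) (graph_const N0 d 1)))).
by move=> x z e _; rewrite addn1.
Qed.

Lemma graph_wtail d n a r : vterm d n -> vterm d a ->
  graph d (fun x z e => wtail (n e) (a e) r).
Proof.
move=> hn ha; apply: graph_widx => //.
exact: (graph_add N0 (graph_double hn) (graph_const N0 d r)).
Qed.

Definition top_prio x z n a u := [&& visited x z n u, ~~ odd (mag x (wprio n a u)) &
  alln (N x) (fun u' => visited x z n u' ==> int_le x (wprio n a u') (wprio n a u))].
Definition parity_ok x z n a := exn (N x) (top_prio x z n a).

Lemma definable_parity_ok d n a : vterm d n -> vterm d a ->
  definable d (fun x z e => parity_ok x z (n e) (a e)).
Proof.
move=> hn ha; rewrite /parity_ok /top_prio; apply: definable_exn.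
apply: definable_and; first by apply: definable_visited; vterm.
apply: definable_and.
  apply: definable_not; apply: definable_odd => //; apply: number_mag => //.
  by apply: graph_wprio; vterm.
apply: definable_alln; apply: definable_imp; first by apply: definable_visited; vterm.
by apply: definable_int_le; apply: graph_wprio; vterm.
Qed.

(* [gain] is [gain_pos - gain_neg]; the arithmetic of [number] is that of [nat]. *)
Definition gain_pos x n a u :=
  (if ~~ wneg x (wweight n a u) then mag x (wweight n a u) * natmag x (wtail n a 2) else 0) +
  (if wneg x (wtail n a 1) then mag x (wtail n a 1) else 0).
Definition gain_neg x n a u :=
  (if wneg x (wweight n a u) then mag x (wweight n a u) * natmag x (wtail n a 2) else 0) +
  (if ~~ wneg x (wtail n a 1) then mag x (wtail n a 1) else 0).

Lemma number_gains d n a u : vterm d n -> vterm d a -> vterm d u ->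
  number d (fun x z e => gain_pos x (n e) (a e) (u e)) /\
  number d (fun x z e => gain_neg x (n e) (a e) (u e)).
Proof.
move=> hn ha hu; have gw := graph_wweight hn ha hu.
have g1 := graph_wtail 1 hn ha; have g2 := graph_wtail 2 hn ha.
have hp := number_mul N0 (number_mag N_size gw) (number_natmag N_size g2).
have hq := number_mag N_size g1.
have dw := definable_wneg N_size gw; have dq := definable_wneg N_size g1.
split; apply: number_add; apply: number_if => //; exact: definable_not.
Qed.

Definition total_pos x z n a := \sum_(0 <= u < N x) flow_out x z n u * gain_pos x n a u.
Definition total_neg x z n a := \sum_(0 <= u < N x) flow_out x z n u * gain_neg x n a u.

(** On the word [wtail n a 0], [wneg] reads the single bit that is the parity component of the
    threshold. *)
Definition index_check x z n a :=
  (~~ wneg x (wtail n a 0) && parity_ok x z n a) ||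
  ((wneg x (wtail n a 0) == parity_ok x z n a) &&
   (total_neg x z n a %% 2 ^ N x < total_pos x z n a %% 2 ^ N x)).

Lemma definable_index_check d n a : vterm d n -> vterm d a ->
  definable d (fun x z e => index_check x z (n e) (a e)).
Proof.
move=> hn ha; have dp := definable_parity_ok hn ha.
have db := definable_wneg N_size (graph_wtail 0 hn ha).
have hn' := vterm_behead hn; have ha' := vterm_behead ha.
have [hp hg] := number_gains hn' ha' (vterm_head d).
have ho := number_flow_out N_size hn' (vterm_head d).
have np : number d (fun x z e => total_pos x z (n e) (a e)).
  apply: (number_sum N0 (F := fun x z u e => flow_out x z (n e) u * gain_pos x (n e) (a e) u)).
  exact: (number_mul N0 ho hp).
have nn : number d (fun x z e => total_neg x z (n e) (a e)).
  apply: (number_sum N0 (F := fun x z u e => flow_out x z (n e) u * gain_neg x (n e) (a e) u)).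
  exact: (number_mul N0 ho hg).
exact: definable_or (definable_and (definable_not db) dp)
  (definable_and (definable_eqb db dp) (definable_ltnum nn np)).
Qed.

Definition block_check x n a :=
  [&& alln (N x) (fun r => exn (N x) (fun t => (2 * n == t) && (r < t)) ==>
        int_word (nth [::] (parse x) (widx n a r))),
      alln (N x) (fun i => (i < wlen x (wtail n a 0)) == (i == 0)),
      int_word (nth [::] (parse x) (wtail n a 1)) &
      last false (nth [::] (parse x) (wtail n a 2))].

Definition valid_check x n m v0 :=
  [&& wcount x (n.+1 + m * (2 * n + 3)), v0 < n,
      alln (N x) (fun u => (u <= n) ==> alln (N x) (fun i => (i < wlen x u) == (i < n))),
      alln (N x) (fun v => (v < n) ==> (wbit x n v == (v == v0))) &
      alln (N x) (fun a => (a < m) ==> block_check x n a)].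

Lemma definable_block_check d n a : vterm d n -> vterm d a ->
  definable d (fun x z e => block_check x (n e) (a e)).
Proof.
move=> hn ha; rewrite /block_check; apply: definable_and; last apply: definable_and;
  last apply: definable_and.
- apply: definable_alln; apply: definable_imp.
    apply: definable_exn; apply: definable_and; last by dfn.
    have hg := graph_double (vterm_behead hn).
    exact: hg.
  apply: definable_intw => //; apply: graph_widx => //; try vterm.
  by apply: graph_vterm; vterm.
- apply: definable_alln; apply: definable_eqb; last by dfn.
  by apply: definable_wlen_graph => //; [apply: graph_wtail; vterm|vterm].
- by apply: definable_intw => //; apply: graph_wtail.
by apply: definable_wlast => //; apply: graph_wtail.
Qed.

Lemma wcount_lt x j : wcount x j -> j < N x.
Proof.
move/eqP => e; have /andP[+ _] := pos_le x (size x); rewrite e /= => le.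
exact: leq_ltn_trans le (N_size x).
Qed.

Lemma definable_valid_check d n m v0 : vterm d n -> vterm d m -> vterm d v0 ->
  definable d (fun x z e => valid_check x (n e) (m e) (v0 e)).
Proof.
move=> hn hm hv; rewrite /valid_check; apply: definable_and.
  have hg : graph d (fun x z e => (n e).+1 + m e * (2 * n e + 3)).
    refine (graph_ext _ (graph_add N0 (graph_add N0 (graph_vterm N hn) (graph_const N0 d 1))
      (graph_mul N0 (graph_vterm N hm) (graph_add N0 (graph_double hn) (graph_const N0 d 3))))).
    by move=> x z e _; rewrite addn1.
  apply: (definable_graph (Q := fun x z j e => wcount x j) hg); last first.
    by apply: definable_wcount => //; vterm.
  move=> x z e _; case h: (wcount _ _); [left|by right].
  exact: wcount_lt h.
apply: definable_and; first by dfn.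
apply: definable_and.
  apply: definable_alln; apply: definable_imp; first by dfn.
  apply: definable_alln; apply: definable_eqb; last by dfn.
  by apply: definable_wlen => //; vterm.
apply: definable_and.
  apply: definable_alln; apply: definable_imp; first by dfn.
  by apply: definable_eqb; [apply: definable_wbit => //; vterm|dfn].
apply: definable_alln; apply: definable_imp; first by dfn.
by apply: definable_block_check; vterm.
Qed.

Definition edge_of x z n u v := [&& u < n, v < n & wbit x u v].

Definition flow_check x z n m v0 :=
  [&& alln (N x) (fun u => alln (N x) (fun v => flow_supp N x z n u v ==> wbit x u v)),
      alln (N x) (fun u => (u < n) ==> (flow_out x z n u == flow_in x z n u %[mod 2 ^ N x])),
      exn (N x) (fun s => [&& visited x z n s, reaches N edge_of x z n v0 s &
        alln (N x) (fun u => visited x z n u ==> reaches N (flow_supp N) x z n s u)]) &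
      alln (N x) (fun a => (a < m) ==> index_check x z n a)].

Lemma definable_flow_check d n m v0 : vterm d n -> vterm d m -> vterm d v0 ->
  definable d (fun x z e => flow_check x z (n e) (m e) (v0 e)).
Proof.
move=> hn hm hv; rewrite /flow_check; apply: definable_and.
  do 2 apply: definable_alln; apply: definable_imp.
    by apply: definable_flow_supp => //; vterm.
  by apply: definable_wbit => //; vterm.
apply: definable_and.
  apply: definable_alln; apply: definable_imp; first by dfn.
  by apply: definable_eqnum; [apply: number_flow_out|apply: number_flow_in] => //; vterm.
apply: definable_and.
  apply: definable_exn; apply: definable_and; first by apply: definable_visited => //; vterm.
  apply: definable_and.
    apply: definable_reaches => //; try vterm.
    move=> d' n' u v hn' hu' hv'; rewrite /edge_of; dfn.
    by apply: definable_wbit.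
  apply: definable_alln; apply: definable_imp; first by apply: definable_visited => //; vterm.
  apply: definable_reaches => //; try vterm.
  by move=> d' n' u v hn' hu' hv'; apply: definable_flow_supp.
apply: definable_alln; apply: definable_imp; first by dfn.
by apply: definable_index_check; vterm.
Qed.

Definition check x z := exn (N x) (fun n => exn (N x) (fun m => exn (N x) (fun v0 =>
  valid_check x n m v0 && flow_check x z n m v0))).

Lemma definable_check : definable 0 (fun x z _ => check x z).
Proof.
rewrite /check; do 3 apply: definable_exn; apply: definable_and.
  by apply: definable_valid_check; vterm.
by apply: definable_flow_check; vterm.
Qed.

End Check.

(** * Correctness of the certificate check *)

(** Parameters and auxiliary relations are guessed together. Existence of the latter gives
    completeness; soundness holds because every guess passing the check formula evaluates [f]
    correctly. *)
Lemma definable_in_NP (S : finType) k (P : seq S -> rels -> bool) (L : seq S -> Prop) :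
  definable (fun x => (size x + 2) ^ k) 0 (fun x z _ => P x z) ->
  (forall x, L x <-> exists z, P x z) -> in_NP L.
Proof.
move=> [c [f h]] hL; apply: (@eso_in_NP S k (FAnd c f)) => x.
rewrite hL; split=> [[z Pz]|[Y /= /andP[cY fY]]].
  have [[Y cY] hY] := h x z; exists (mix z Y) => /=.
  by rewrite cY (hY Y cY [::]).
pose z t := Y t.*2; pose A t := Y t.*2.+1.
have eY : Y = mix z A.
  apply/funext => t; rewrite /mix /z /A.
  by case ot: (odd t); rewrite -[in LHS](odd_double_half t) ot.
have [_ hY] := h x z; exists z; rewrite -(hY A _ [::]) -?eY //.
Qed.

Lemma nval_trunc k n b : k <= n -> (forall i, k <= i -> b i = false) -> nval n b = nval k b.
Proof.
move=> le_k hb; elim: n le_k => [|n IH]; first by rewrite leqn0 => /eqP ->.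
by rewrite leq_eqVlt => /orP[/eqP <- //|le]; rewrite nval_recr IH // hb // mul0n addn0.
Qed.

Lemma nval_gt0 n b : (0 < nval n b) = exn n b.
Proof.
apply/idP/exnP => [|[i lt_i bi]].
  rewrite lt0n sum_nat_eq0 negb_forall => /existsP[i] /=.
  by rewrite muln_eq0 negb_or eqb0 negbK => /andP[bi _]; exists i.
by rewrite /nval (bigD1 (Ordinal lt_i)) //= bi mul1n addn_gt0 expn_gt0.
Qed.

Lemma sum_nat_trunc k n (F : nat -> nat) : k <= n -> (forall i, k <= i -> F i = 0) ->
  \sum_(0 <= i < n) F i = \sum_(i < k) F i.
Proof.
move=> le_k hF; rewrite (big_cat_nat (n := k)) //= big_mkord [X in _ + X]big1_seq ?addn0 //.
by move=> i /andP[_]; rewrite mem_index_iota => /andP[/hF].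
Qed.

Section Words.
Variable N : seq sigma -> nat.
Hypothesis N_size : forall x, size x < N x.
Variable x : seq sigma.
Let w := word_of x.

Lemma magE j : mag N x j = natval (behead (w j)).
Proof.
have le_s : size (behead (w j)) <= N x.
  rewrite size_behead (leq_trans (leq_pred _)) // ltnW //.
  exact: leq_ltn_trans (size_parse_word x j) (N_size x).
rewrite /mag (nval_trunc le_s) => [|i le_i]; first by apply: eq_nval => i _; rewrite nth_behead.
by rewrite /wbit -nth_behead nth_default.
Qed.

Lemma natmagE j : natmag N x j = natval (w j).
Proof.
rewrite /natmag (@nval_trunc (size (w j))) // => [|i le_i]; last by rewrite /wbit nth_default.
by apply: ltnW; apply: leq_ltn_trans (size_parse_word x j) (N_size x).
Qed.

Lemma intvalE j : intval (w j) = if wneg x j then (- Posz (mag N x j))%R else Posz (mag N x j).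
Proof. by rewrite magE /wneg /wbit nth0. Qed.

Lemma natval_word_lt j : natval (w j) < 2 ^ size x.
Proof.
apply: leq_trans (nval_lt _ _) _; rewrite leq_pexp2l //; exact: size_parse_word.
Qed.

Lemma mag_lt j : mag N x j < 2 ^ size x.
Proof.
rewrite magE; apply: leq_trans (nval_lt _ _) _; rewrite leq_pexp2l // size_behead.
exact: leq_trans (leq_pred _) (size_parse_word x j).
Qed.

Lemma int_leE j' j : int_word (w j') -> int_word (w j) ->
  int_le N x j' j = (intval (w j') <= intval (w j))%R.
Proof.
(* With negative zero excluded, a set sign bit means a negative value, and comparing signs and
   magnitudes is correct. *)
have neg_pos i : int_word (w i) -> wneg x i -> 0 < mag N x i.
  have -> : wneg x i = nth false (w i) 0 by [].
  rewrite magE /int_word; case: (w i) => [|[] t] // /andP[/= t0 h] _.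
  case/orP: h => [l|/eqP e]; last by case: e.
  have l' : last false t by case: t t0 l.
  by apply: leq_trans (natval_gt0 l'); rewrite expn_gt0.
move=> /neg_pos n' /neg_pos n; rewrite !intvalE /int_le.
by case: (wneg x j') n'; case: (wneg x j) n => /=; lia.
Qed.

Lemma valid_checkP n m v0 : valid_check N x n m v0 <->
  wcount x (n.+1 + m * (2 * n + 3)) /\ valid_words w n m v0.
Proof.
split=> [/and5P[wc lt_v /allnP h1 /allnP h2 /allnP h3]|[wc [lt_v h1 h2 h3]]].
  have lt_N := wcount_lt N_size wc; have lt_n : n < N x by lia.
  have wlen_eq j c : alln (N x) (fun i => (i < wlen x j) == (i < c)) -> c < N x ->
      size (w j) = c.
    move=> /allnP h lt_c; apply/eqP; rewrite eqn_leq.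
    have lj := wlen_lt N_size x j; rewrite -[size _]/(wlen x j).
    have /eqP := h _ lj; have /eqP := h _ lt_c; rewrite !ltnn; lia.
  split=> //; split=> // [u le_u|v lt_vn|a lt_a].
  - apply: wlen_eq => //; have := h1 u (leq_ltn_trans le_u lt_n).
    by rewrite le_u.
  - by have := h2 v (ltn_trans lt_vn lt_n); rewrite lt_vn => /eqP.
  have lt_m : m < N x by nia.
  have := h3 a (ltn_trans lt_a lt_m); rewrite lt_a => /and4P[/allnP k1 k2 k3 k4].
  have lt_2n : 2 * n < N x by nia.
  split=> // [r lt_r|].
    have := k1 r (ltn_trans lt_r lt_2n); move/implyP; apply.
    by apply/exnP; exists (2 * n); rewrite ?eqxx.
  apply: wlen_eq; last by lia.
  by apply: etrans k2; apply: eq_alln => i _; rewrite ltnS leqn0.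
apply/and5P; split=> //; apply/allnP => i lt_i; apply/implyP => hi.
- apply/allnP => k _; rewrite /wlen -/(w i) (h1 i hi) eqxx //.
- by rewrite [wbit _ _ _](h2 i hi) eqxx.
have [k1 k2 k3 k4] := h3 i hi; apply/and4P; split=> //.
  apply/allnP => r _; apply/implyP => /exnP[t _ /andP[/eqP <-]]; exact: k1.
by apply/allnP => k _; rewrite /wlen -/(w _) [X in _ < X]k2 ltnS leqn0.
Qed.

End Words.

Section FlowCheck.
Variable N : seq sigma -> nat.
Hypothesis N_big : forall x, 8 * size x + 8 <= N x.
Variables (x : seq sigma) (n m : nat) (v0 : 'I_n).
Let w := word_of x.
Hypothesis wc : wcount x (n.+1 + m * (2 * n + 3)).
Hypothesis val : valid_words w n m v0.
Variable z : rels.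

Let N_size x' : size x' < N x'. Proof. by have := N_big x'; lia. Qed.

Let G := dec_graph w n m.
Let b (a : 'I_m) := dec_bot w n a.
Let q (a : 'I_m) := (dec_num w n a, dec_den w n a).
Let y (u v : 'I_n) := flow N x z n u v.
Let h := uphalf (N x).

Lemma total_words_le : n.+1 + m * (2 * n + 3) <= size x.
Proof. by have /andP[+ _] := pos_le x (size x); rewrite (eqP wc). Qed.

Lemma n_le_N : n <= N x.
Proof. by have := total_words_le; have := N_size x; lia. Qed.

Lemma flow_bit_half u v i : flow_bit N x z n u v i -> i + i < N x.
Proof. by case/and4P=> _ _ /exnP[k lt_k /eqP ->]. Qed.

Lemma flow_lt u v : flow N x z n u v < 2 ^ h.
Proof.
rewrite /flow (@nval_trunc h) ?nval_lt // => [|i le_i].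
  by rewrite /h; have := N_size x; lia.
by apply/negP => /flow_bit_half; move: le_i; rewrite /h; lia.
Qed.

Lemma flow_out_of_range u v : (n <= u) || (n <= v) -> flow N x z n u v = 0.
Proof.
move=> h'; rewrite /flow (@nval_trunc 0) /nval ?big_ord0 // => i _.
by rewrite /flow_bit; case/orP: h' => le; rewrite !ltnNge le ?andbF.
Qed.

Lemma flow_suppE u v : flow_supp N x z n u v = (0 < flow N x z n u v).
Proof. by rewrite nval_gt0. Qed.

Lemma flow_outE (u : 'I_n) : flow_out N x z n u = out y u.
Proof.
by apply: (sum_nat_trunc n_le_N) => v le; apply: flow_out_of_range; rewrite le orbT.
Qed.

Lemma flow_out0 u : n <= u -> flow_out N x z n u = 0.
Proof.
by move=> le; rewrite /flow_out big1 // => v _; rewrite flow_out_of_range ?le.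
Qed.

Lemma flow_inE (u : 'I_n) : flow_in N x z n u = \sum_(v < n) y v u.
Proof.
by apply: (sum_nat_trunc n_le_N) => v le; apply: flow_out_of_range; rewrite le.
Qed.

Lemma flow_supp_lt u v : flow_supp N x z n u v -> (u < n) && (v < n).
Proof. by case/exnP=> i _ /and4P[-> ->]. Qed.

Lemma visited_lt u : visited N x z n u -> u < n.
Proof. by case/exnP=> v _ /flow_supp_lt /andP[]. Qed.

Lemma visitedE (u : 'I_n) : visited N x z n u = (0 < out y u).
Proof.
rewrite /out lt0n sum_nat_eq0 negb_forall; apply/exnP/existsP => [[v _ sv]|[v yv]].
  have /andP[_ lt_v] := flow_supp_lt sv; exists (Ordinal lt_v).
  by rewrite /= -lt0n -flow_suppE.
by exists v; [apply: leq_trans (ltn_ord v) n_le_N|rewrite flow_suppE lt0n].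
Qed.

Lemma sum_lt_exp (F : 'I_n -> nat) k : (forall u, F u <= 2 ^ k) ->
  \sum_u F u <= 2 ^ (size x + k).
Proof.
move=> hF; apply: (@leq_trans (\sum_(u < n) 2 ^ k)); first exact: leq_sum.
rewrite sum_nat_const card_ord expnD leq_mul2r; apply/orP; right.
apply: leq_trans (ltnW (ltn_expl (size x) (ltnSn 1))).
by have := total_words_le; lia.
Qed.

Lemma out_le u : out y u <= 2 ^ (size x + h).
Proof. by apply: sum_lt_exp => v; apply: ltnW; apply: flow_lt. Qed.

(** The headroom: flows have at most [h] bits, about half of [N x]. Two summations over vertices
    cost [size x] bits each and a gain [2 * size x + 1] more, which [N_big] accommodates, so
    reduction modulo [2 ^ N x] changes nothing. *)
Lemma exp_small k : k <= 4 * size x + h + 1 -> 2 ^ k < 2 ^ N x.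
Proof. by move=> le_k; rewrite ltn_exp2l //; have := N_big x; move: le_k; rewrite /h; lia. Qed.

Lemma gain_le a u : (gain_pos N x n a u <= 2 ^ (2 * size x + 1)) &&
                    (gain_neg N x n a u <= 2 ^ (2 * size x + 1)).
Proof.
have e : 2 ^ (2 * size x + 1) = 2 ^ size x * 2 ^ size x + 2 ^ size x * 2 ^ size x.
  by rewrite addn1 expnS mul2n -addnn mul2n -addnn expnD.
have p0 : 0 < 2 ^ size x by rewrite expn_gt0.
have h1 : mag N x (wweight n a u) * natmag N x (wtail n a 2) <= 2 ^ size x * 2 ^ size x.
  apply: leq_mul; first by apply: ltnW; apply: mag_lt.
  by rewrite natmagE //; apply: ltnW; apply: natval_word_lt.
have h2 : mag N x (wtail n a 1) <= 2 ^ size x * 2 ^ size x.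
  by apply: leq_trans (ltnW (mag_lt N_size _ _)) _; rewrite leq_pmulr.
by rewrite e /gain_pos /gain_neg; apply/andP; split; apply: leq_add; case: ifP.
Qed.

Lemma total_modE (g : nat -> nat) : (forall u, g u <= 2 ^ (2 * size x + 1)) ->
  \sum_(0 <= u < N x) flow_out N x z n u * g u = \sum_(u < n) out y u * g u /\
  \sum_(u < n) out y u * g u < 2 ^ N x.
Proof.
move=> hg; split.
  rewrite (sum_nat_trunc n_le_N) => [|u le]; last by rewrite flow_out0.
  by apply: eq_bigr => u _; rewrite flow_outE.
apply: leq_ltn_trans (exp_small (leqnn _)).
have -> : 4 * size x + h + 1 = size x + ((size x + h) + (2 * size x + 1)) by lia.
by apply: sum_lt_exp => u; rewrite expnD leq_mul ?out_le.
Qed.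

Lemma weight_word (a : 'I_m) (u : 'I_n) : int_word (w (wweight n a u)) /\ int_word (w (wprio n a u)).
Proof.
have [_ _ _ /(_ a (ltn_ord a))[hw _ _ _]] := val; have lt_u := ltn_ord u.
by split; apply: hw; lia.
Qed.

Lemma gainE (a : 'I_m) (u : 'I_n) :
  gain G q a u = (Posz (gain_pos N x n a u) - Posz (gain_neg N x n a u))%R.
Proof.
rewrite /gain /= /dec_den /dec_num -!/(wtail _ _ _) -/(wweight _ _ _) /gain_pos /gain_neg.
rewrite -(natmagE N_size) !(intvalE N_size).
case: (wneg x (wweight n a u)); case: (wneg x (wtail n a 1)) => /=;
  rewrite ?addn0 ?add0n ?PoszD ?PoszM; ring.
Qed.

Lemma parity_okE (a : 'I_m) : parity_ok N x z n a = top_even G (out y) a.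
Proof.
have evenE (u : 'I_n) : (2 %| prio G a u)%Z = ~~ odd (mag N x (wprio n a u)).
  rewrite /= -/(wprio _ _ _) (intvalE N_size); case: (wneg _ _);
    by rewrite dvdzE ?abszN /= dvdn2.
apply/exnP/existsP => [[u _ /and3P[vis ev /allnP h1]]|[u /and3P[vis ev /forallP h1]]].
  exists (Ordinal (visited_lt vis)); rewrite -visitedE vis evenE ev.
  apply/forallP => u'; apply/implyP; rewrite -visitedE => vis'.
  have lt' : u' < N x by apply: leq_trans (ltn_ord u') n_le_N.
  have [_ p1] := weight_word a u'; have [_ p2] := weight_word a (Ordinal (visited_lt vis)).
  by have := h1 u' lt'; rewrite vis' (int_leE N_size p1 p2).
exists u; first by apply: leq_trans (ltn_ord u) n_le_N.
rewrite /top_prio visitedE vis -evenE ev; apply/allnP => u' _; apply/implyP => vis'.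
have lt' := visited_lt vis'; have [_ p1] := weight_word a (Ordinal lt'); have [_ p2] := weight_word a u.
have := h1 (Ordinal lt'); rewrite -visitedE vis' -[int_le _ _ _ _]/(int_le N x (wprio n a (Ordinal lt')) _).
by rewrite (int_leE N_size p1 p2).
Qed.

Lemma index_checkE (a : 'I_m) : index_check N x z n a = index_ok G b q (out y) a.
Proof.
rewrite /index_check /index_ok parity_okE; congr (_ || (_ && _)).
have gp u : gain_pos N x n a u <= 2 ^ (2 * size x + 1) by case/andP: (gain_le a u).
have gn u : gain_neg N x n a u <= 2 ^ (2 * size x + 1) by case/andP: (gain_le a u).
have [e1 l1] := total_modE gp; have [e2 l2] := total_modE gn.
rewrite /total_neg /total_pos e1 e2 !modn_small //.
have sumZ (F : 'I_n -> nat) : Posz (\sum_u F u) = (\sum_u Posz (F u))%R.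
  exact: (big_morph Posz PoszD).
rewrite -ltz_nat !sumZ -subr_gt0 -sumrB; congr (0 < _)%R.
apply: eq_bigr => u _; rewrite gainE !PoszM; ring.
Qed.

Lemma reachesE (Ed : seq sigma -> rels -> nat -> nat -> nat -> bool) (s v : 'I_n) :
  (forall u v, Ed x z n u v -> (u < n) && (v < n)) ->
  reaches N Ed x z n s v = connect (fun u v : 'I_n => Ed x z n u v) s v.
Proof.
move=> Ed_lt; apply/exnP/connectP => [[t _]|[p pth ->]].
  elim: t v => [|t IH] v /=; first by move/eqP/val_inj => <-; exists [::].
  case/exnP=> v' _ /andP[wv' ev']; have /andP[lt' _] := Ed_lt _ _ ev'.
  have [p pth lp] := IH (Ordinal lt') wv'.
  by exists (rcons p v); rewrite ?last_rcons // rcons_path pth -lp.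
(* A path without repetition has fewer than [n] edges, so its length is an element of the domain. *)
case/shortenP: pth => p' pth' up' _; exists (size p').
  have := card_uniqP up'; have := max_card (mem (s :: p')); rewrite card_ord /= => + e.
  by rewrite e => lt; apply: leq_trans lt n_le_N.
elim/last_ind: p' pth' {up'} => [|p' v' IH] /=; first by rewrite eqxx.
rewrite rcons_path last_rcons size_rcons => /andP[pth' ev'].
apply/exnP; exists (last s p'); first by apply: leq_trans (ltn_ord _) n_le_N.
by apply/andP; split; [exact: IH|].
Qed.

Lemma flow_checkP : flow_check N x z n m v0 <-> flow_ok G v0 b q y.
Proof.
have edgeE u v : edge_rel G u v = wbit x u v by rewrite /edge_rel inE.
have cE : connect (fun u v : 'I_n => edge_of x z n u v) =2 connect (edge_rel G).
  by apply: eq_connect => u v; rewrite edgeE /edge_of !ltn_ord.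
have cS : connect (fun u v : 'I_n => flow_supp N x z n u v) =2 connect (fun u v => 0 < y u v).
  by apply: eq_connect => u v; rewrite flow_suppE.
have E_lt u v : edge_of x z n u v -> (u < n) && (v < n) by case/and3P=> -> ->.
have lt_N (u : 'I_n) : u < N x by apply: leq_trans (ltn_ord u) n_le_N.
have balE (u : 'I_n) : (flow_out N x z n u == flow_in N x z n u %[mod 2 ^ N x]) =
    (\sum_v y u v == \sum_v y v u).
  rewrite flow_outE flow_inE !modn_small //.
    apply: leq_ltn_trans (exp_small (k := size x + h) _); last by lia.
    by apply: sum_lt_exp => v; apply: ltnW; apply: flow_lt.
  by apply: leq_ltn_trans (out_le u) (exp_small _); lia.
split=> [/and4P[/allnP h1 /allnP h2 /exnP[s _ /and3P[vs rs /allnP h3]] /allnP h4]|].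
  split.
  - move=> u v yuv; rewrite edgeE; have /allnP/(_ v (lt_N v)) := h1 u (lt_N u).
    by rewrite flow_suppE yuv.
  - by move=> u; apply/eqP; rewrite -balE; have := h2 u (lt_N u); rewrite ltn_ord.
  - have lt_s := visited_lt vs; exists (Ordinal lt_s); split.
    + by rewrite -visitedE.
    + by rewrite -cE -reachesE.
    move=> u; rewrite -visitedE => vu; rewrite -cS -reachesE //; last exact: flow_supp_lt.
    by have := h3 u (lt_N u); rewrite vu.
  move=> a; rewrite -index_checkE; have lt_a : a < N x.
    by have := total_words_le; have := N_size x; have := ltn_ord a; nia.
  by have := h4 a lt_a; rewrite ltn_ord.
move=> [h1 h2 [s [os cs hs]] h4]; apply/and4P; split.
- apply/allnP => u _; apply/allnP => v _; apply/implyP => suv.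
  have /andP[lu lv] := flow_supp_lt suv.
  rewrite -[wbit _ _ _](edgeE (Ordinal lu) (Ordinal lv)); apply: h1.
  by rewrite /y /= -flow_suppE.
- apply/allnP => u _; apply/implyP => lu; rewrite (balE (Ordinal lu)); apply/eqP; exact: h2.
- apply/exnP; exists s => //; rewrite visitedE os reachesE // cE cs /=.
  apply/allnP => u _; apply/implyP => vu; have lu := visited_lt vu.
  rewrite (reachesE s (Ordinal lu)) ?cS; last exact: flow_supp_lt.
  by apply: hs; rewrite -visitedE.
apply/allnP => a _; apply/implyP => la.
by rewrite -[a]/(nat_of_ord (Ordinal la)) index_checkE.
Qed.

End FlowCheck.

(* Dominates twice the bit length in [small_flow_bound] below. *)
Definition dom_size (x : seq sigma) : nat := (size x + 2) ^ 4.

Lemma dom_size_big x : 10 * size x ^ 2 + 8 * size x + 8 <= dom_size x.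
Proof.
rewrite /dom_size; set s := size x.
have -> : (s + 2) ^ 4 = s ^ 4 + 8 * s ^ 3 + 24 * s ^ 2 + 32 * s + 16 by ring.
lia.
Qed.

Lemma dom_size_linear x : 8 * size x + 8 <= dom_size x.
Proof. by have := dom_size_big x; lia. Qed.

Lemma dom_size_gt x : size x < dom_size x.
Proof. by have := dom_size_linear x; lia. Qed.

Lemma fact_le_exp k : k`! <= 2 ^ (k * k).
Proof.
elim: k => // k IH; rewrite factS.
have -> : k.+1 * k.+1 = k.+1 + (k + k * k) by ring.
rewrite !expnD; apply: leq_mul; first exact: ltnW (ltn_expl _ _).
by apply: leq_trans IH _; rewrite leq_pmull // expn_gt0.
Qed.

(** The bound of [small_flow] with gains up to [2 ^ (2 * s + 1)]: the factorial contributes [s * s]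
    bits, the power [(4 * s + 2) * s], the factor 2 one bit, and strictness one more. *)
Lemma small_flow_bound s n k : n <= s -> k <= s ->
  2 * (k`! * (1 + 2 ^ (2 * s + 1) * (n * n)) ^ k) < 2 ^ (5 * s ^ 2 + 2 * s + 2).
Proof.
move=> le_n le_k.
have expS2 i : 2 ^ i.+1 = 2 ^ i + 2 ^ i by rewrite expnS mul2n addnn.
have hK : 1 + 2 ^ (2 * s + 1) * (n * n) <= 2 ^ (4 * s + 2).
  have hn : n <= 2 ^ s by apply: leq_trans (ltnW (ltn_expl s (ltnSn 1))).
  have -> : 4 * s + 2 = ((2 * s + 1) + (s + s)).+1 by ring.
  rewrite expS2 leq_add ?expn_gt0 // [X in _ <= X]expnD leq_mul //.
  by rewrite expnD leq_mul.
have h1 : (1 + 2 ^ (2 * s + 1) * (n * n)) ^ k <= 2 ^ ((4 * s + 2) * s).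
  apply: (@leq_trans ((2 ^ (4 * s + 2)) ^ k)); first by case: (k) => // k'; rewrite leq_exp2r.
  by rewrite -expnM leq_pexp2l // leq_mul2l le_k orbT.
have h2 : k`! <= 2 ^ (s * s).
  by apply: leq_trans (fact_le_exp k) _; rewrite leq_pexp2l // leq_mul.
have -> : 5 * s ^ 2 + 2 * s + 2 = (1 + (s * s + (4 * s + 2) * s)).+1 by ring.
have le_e : 2 * (k`! * (1 + 2 ^ (2 * s + 1) * (n * n)) ^ k) <=
    2 ^ (1 + (s * s + (4 * s + 2) * s)).
  by rewrite [X in _ <= X]expnD leq_pmul2l // [X in _ <= X]expnD leq_mul.
by apply: leq_ltn_trans le_e _; rewrite ltn_exp2l.
Qed.

Section Correctness.
Variables (R : realType) (x : seq sigma) (n m : nat) (v0 : 'I_n).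
Let w := word_of x.
Hypothesis wc : wcount x (n.+1 + m * (2 * n + 3)).
Hypothesis val : valid_words w n m v0.

Let G := dec_graph w n m.
Let b (a : 'I_m) := dec_bot w n a.
Let q (a : 'I_m) := (dec_num w n a, dec_den w n a).

Lemma dec_den_gt0 a : 0 < (q a).2.
Proof.
have [_ _ _ /(_ a (ltn_ord a))[_ _ _ l]] := val.
by apply: leq_trans (natval_gt0 l); rewrite expn_gt0.
Qed.

Lemma flow_check_complete pi : good_path R G v0 b q pi ->
  exists z, flow_check dom_size x z n m v0.
Proof.
move=> /flow_of_path gp; have [y0 ok0] := gp dec_den_gt0.
(* By [gain_le], a gain is a difference of two natural numbers not exceeding this [C]. *)
set s := size x; pose C : int := Posz (2 ^ (2 * s + 1)).
have C1 : (1 <= C)%R by rewrite /C lez_nat expn_gt0.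
have gainC a u : (`|gain G q a u| <= C)%R.
  rewrite (gainE dom_size_linear wc) /C.
  by have /andP[] := gain_le dom_size_linear wc a u; rewrite -/s; lia.
have [y oky ley] := small_flow ok0 C1 gainC.
have {}ley u v : y u v < 2 ^ (5 * s ^ 2 + 2 * s + 2).
  have le_s := total_words_le wc; rewrite -/s in le_s.
  have le_n : n <= s by lia.
  have le_nm : n + m <= s by nia.
  apply: leq_ltn_trans (small_flow_bound le_n le_nm).
  rewrite -lez_nat; have := ley u v; rewrite !card_ord /C.
  by rewrite -[Posz (2 ^ _)]natz -[Posz (2 * _)]natz !(natrM, natrX, natrD).
pose z : rels := fun _ e => if e is [:: u; v; i] then
  (if insub u is Some u' then if insub v is Some v' then bit (y u' v') i else false else false)
  else false.
exists z; apply/(flow_checkP dom_size_linear wc val).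
suff -> : (fun u v : 'I_n => flow dom_size x z n u v) = y by [].
apply/funext => u; apply/funext => v; rewrite /flow.
(* Only bits at positions [i] with [2 * i < N x] are read, so twice the bit length has to fit into
   the domain. *)
have lt_N : 2 * (5 * s ^ 2 + 2 * s + 2) <= dom_size x.
  by have := dom_size_big x; rewrite -/s; lia.
rewrite (@eq_nval _ _ (bit (y u v))) => [|i lt_i].
  rewrite nval_bit modn_small //; apply: leq_trans (ley u v) _.
  by rewrite leq_pexp2l //; lia.
rewrite /flow_bit !ltn_ord /z !valK /=.
have [lt|ge] := ltnP (i + i) (dom_size x).
  by rewrite (_ : exn _ _ = true) //; apply/exnP; exists (i + i).
by rewrite (bit_small (ley u v)) ?andbF //; lia.
Qed.

Lemma flow_check_sound z : flow_check dom_size x z n m v0 ->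
  exists pi, good_path R G v0 b q pi.
Proof.
move/(flow_checkP dom_size_linear wc val); apply: path_of_flow; exact: dec_den_gt0.
Qed.

End Correctness.

Local Open Scope ring_scope.

Theorem theorem3 (R : realType) :
  in_NP (fun x : seq (option bool) =>
    exists (V A : finType) (G : mwgraph V A) (iota : V) (f : A -> omega R)
           (q : A -> int * nat),
      [/\ forall a, (0 < (q a).2)%N /\ (f a).2 = (q a).1%:~R / (q a).2%:R,
          x = encode G iota (fun a => (f a).1) q
        & exists pi : nat -> V,
            [/\ is_path G pi, ultimately_periodic pi, pi 0%N = iota
              & forall a, lex_lt (f a) (pay R G a pi)]]).
Proof.
apply: (definable_in_NP (definable_check dom_size_gt)) => x.
rewrite language_words; split=> [[n [m [v0 [wc val [pi gp]]]]]|[z]].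
  have [z hz] := flow_check_complete wc val gp; exists z.
  (* The check quantifies [n], [m] and [v0] over the domain; the number of words in [x] bounds all
     three. *)
  have le := total_words_le wc; have lt := dom_size_gt x.
  have lt_v := ltn_ord v0.
  apply/exnP; exists n; first by lia.
  apply/exnP; exists m; first by nia.
  apply/exnP; exists (nat_of_ord v0); first by lia.
  by rewrite hz andbT; apply/(valid_checkP dom_size_gt).
case/exnP=> n _ /exnP[m _ /exnP[v0 _ /andP[/(valid_checkP dom_size_gt)[wc val] hz]]].
have [lt_v _ _ _] := val.
exists n, m, (Ordinal lt_v); split=> //.
exact: (flow_check_sound R wc (v0 := Ordinal lt_v) val hz).
Qed.
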